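(* Let $\mathfrak{n}\in A$ be monic of degree $\geqslant 1$, let $1\leqslant\kappa\leqslant q-1$, put $r=(q+1)/2$, let $\mathbb{P}^1(\mathbb{F}_q)=\coprod_{i=1}^r\{a_i,b_i\}$ be a decomposition into $r$ pairs, and let $$f=f_\kappa^{\mathfrak{n}}=\sum_{\gamma\in\Gamma(\mathfrak{n})}\prod_{i=1}^ru(z;\gamma a_i,\gamma b_i)^\kappa.$$ Let $f=\sum_{n\geqslant1}c_n(f)\,t^n$ be the $t$-expansion of $f$ at $\infty$. For $1\leqslant n\leqslant\kappa(q+1)-1$, $$c_n(f)=\begin{cases}C_0^\kappa\,\varepsilon^{\kappa(q-1)}&\text{if }n=\kappa q,\\0&\text{otherwise.}\end{cases}$$ In other words, the $t$-expansion of $f$ at the cusp $\infty$ satisfies $f(z)=C_0^\kappa\,\varepsilon^{\kappa(q-1)}\,t(z)^{\kappa q}+O(t(z)^{\kappa(q+1)})$. In particular, $f$ vanishes to order exactly $\kappa q$ at every cusp of $\Gamma(\mathfrak{n})$ represented by an element of $\mathbb{P}^1(\mathbb{F}_q)$.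
   Context: $q$ is an odd prime power, $A=\mathbb{F}_q[T]$, $F=\mathbb{F}_q(T)$, $F_\infty=\mathbb{F}_q((1/T))$, $\mathbb{C}_\infty$ is the completion of an algebraic closure of $F_\infty$, $\Omega=\mathbb{C}_\infty\setminus F_\infty$, $|z|_i=\inf_{x\in F_\infty}|z-x|$. $\Gamma(\mathfrak{n})=\ker(\mathrm{GL}_2(A)\to\mathrm{GL}_2(A/\mathfrak{n}A))$, acting by linear fractional transformations; its cusps are its orbits in $\mathbb{P}^1(F)$. $u(z;a,b)=\frac1{z-b}-\frac1{z-a}$ with $\frac1{z-\infty}=0$. The series $f$ converges locally uniformly on $\Omega$ and is a cusp form of weight $\kappa(q+1)$ for $\Gamma(\mathfrak{n})$: $f(\gamma z)=(cz+d)^{\kappa(q+1)}f(z)$ for $\gamma=\begin{pmatrix}a&b\\c&d\end{pmatrix}\in\Gamma(\mathfrak{n})$. $e_{\mathfrak{n}A}(z)=z\prod_{b\in\mathfrak{n}A\setminus\{0\}}(1-z/b)$, $t=1/e_{\mathfrak{n}A}$, $\varepsilon=e_{\mathfrak{n}A}(1)\neq0$. The $t$-expansion at $\infty$ is the power series identity valid for $|z|_i$ large. $$C_0=\prod_{1\leqslant i\leqslant r,\ \infty\notin\{a_i,b_i\}}(b_i-a_i)\in\mathbb{F}_q^\times.$$ For a cusp represented by $\alpha\in\mathbb{P}^1(\mathbb{F}_q)$, write $\alpha=\nu\infty$ with $\nu=\begin{pmatrix}*&*\\c&d\end{pmatrix}\in\mathrm{GL}_2(\mathbb{F}_q)$;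 the order of vanishing of $f$ at the cusp is the smallest $n$ such that the coefficient of $t^n$ in the $t$-expansion at $\infty$ of $(cz+d)^{-\kappa(q+1)}f(\nu z)$ is nonzero.
   Formalization: If the pair containing ∞ is listed with b_i = ∞, the coefficient proved is (-1)^κ C_0^κ ε^{κ(q-1)}, since u(z;a,∞) = -1/(z-a) and C_0 ignores that pair; the printed formula then fails for odd κ. If ∞ is an a_i, the printed formula is proved as is. *)

(* Defs.v *)
From mathcomp Require Import all_boot all_order all_algebra.
From mathcomp Require Import finmap.
From mathcomp Require Import boolp classical_sets filter reals topology.
From mathcomp Require Import normedtype summability.

Set Implicit Arguments.
Unset Strict Implicit.
Unset Printing Implicit Defensive.

Import Order.TTheory GRing.Theory Num.Theory.
Import numFieldNormedType.Exports.

Local Open Scope classical_set_scope.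
Local Open Scope ring_scope.

(* The projective line: [None] is the point at infinity. *)
Notation "''P1' K" := (option K) (at level 8, K at level 2) : type_scope.

Definition moebius (K : fieldType) (M : 'M[K]_2) (x : 'P1 K) : 'P1 K :=
  let hom (v w : K) :=
    let den := M 1 0 * v + M 1 1 * w in
    if den == 0 then None else Some ((M 0 0 * v + M 0 1 * w) / den) in
  if x is Some v then hom v 1 else hom 1 0.

Definition ratfun (Fq : finFieldType) := {fraction {poly Fq}}.

Definition polyF (Fq : finFieldType) (p : {poly Fq}) : ratfun Fq :=
  @FracField.tofrac {poly Fq} p.

Definition cstF (Fq : finFieldType) (x : Fq) : ratfun Fq := polyF x%:P.

(* A field extension of Fq(T) with a nonarchimedean absolute value extending
   the one of the place at infinity; on Fq(T) the latter is determined by its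
   values |p| = q ^ deg p on nonzero polynomials. *)
Record valuedExt (Fq : finFieldType) (R : realType) := ValuedExt {
  vcar :> fieldType;
  vabs : vcar -> R;
  vemb : {rmorphism ratfun Fq -> vcar};
  vabs_ge0 : forall x, 0 <= vabs x;
  vabs_eq0 : forall x, (vabs x == 0) = (x == 0);
  vabsM : forall x y, vabs (x * y) = vabs x * vabs y;
  vabsD : forall x y, vabs (x + y) <= Num.max (vabs x) (vabs y);
  vabs_poly : forall p : {poly Fq}, p != 0 ->
    vabs (vemb (polyF p)) = (#|Fq| ^ (size p).-1)%N%:R
}.

Section ValuedExt.
Context (Fq : finFieldType) (R : realType) (C : valuedExt Fq R).

Definition vcvg (U : Type) (G : set_system U) (g : U -> C) (l : C) : Prop :=
  (fun x => vabs (g x - l)) @ G --> (0 : R).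

(* Total limit operator, equal to 0 when there is no limit. *)
Definition vlim (U : Type) (G : set_system U) (g : U -> C) : C :=
  xget 0 [set l | vcvg G g l].

(* Unconditional sums and products: limits along the finite sets of indices. *)
Definition vsum (I : choiceType) (D : {pred I}) (g : I -> C) : C :=
  vlim totally (fun S : {fset I} => \sum_(i <- S | i \in D) g i).

Definition vprod (I : choiceType) (D : {pred I}) (g : I -> C) : C :=
  vlim totally (fun S : {fset I} => \prod_(i <- S | i \in D) g i).

(* Fq((1/T)), as the set of sums of Laurent series in 1/T. *)
Definition Finf : set C :=
  [set x | exists (N : nat) (a : nat -> Fq),
    vcvg \oo (fun m => vemb C (polyF 'X) ^+ N *
      \sum_(i < m) vemb C (cstF (a i)) * vemb C (polyF 'X) ^- i) x].

Definition algFinf : set C :=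
  [set x | exists p : {poly C}, [/\ p != 0, forall i, Finf p`_i & root p x]].

Definition vcomplete : Prop :=
  forall u : nat -> C,
    (forall e : R, 0 < e -> exists N, forall m n,
       (N <= m)%N -> (N <= n)%N -> vabs (u m - u n) < e) ->
    exists l, vcvg \oo u l.

(* [C] is a completion of an algebraic closure of Fq((1/T)): it is complete,
   and the elements algebraic over Fq((1/T)) form an algebraically closed field
   that is dense in [C]. *)
Definition is_Cinf : Prop :=
  [/\ vcomplete,
      forall p : {poly C}, (1 < size p)%N -> (forall i, algFinf p`_i) ->
        exists2 x, algFinf x & root p x
    & forall (x : C) (e : R), 0 < e -> exists2 y, algFinf y & vabs (x - y) < e].

Definition Omega : set C := ~` Finf.

Definition imabs (z : C) : R := inf [set vabs (z - x) | x in Finf].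

Definition Gamma (n : {poly Fq}) : {pred 'M[{poly Fq}]_2} :=
  [pred M | (M \in unitmx) && [forall i, forall j, (n %| (M - 1%:M) i j)%R]].

Definition pt_cst (x : 'P1 Fq) : 'P1 (ratfun Fq) := omap (@cstF Fq) x.

Definition actF (g : 'M[{poly Fq}]_2) (x : 'P1 (ratfun Fq)) :
  'P1 (ratfun Fq) := moebius (map_mx (@polyF Fq) g) x.

Definition is_cusp (n : {poly Fq}) (s : set ('P1 (ratfun Fq))) : Prop :=
  exists x, s = [set actF g x | g in [set g | g \in Gamma n]].

Definition inv_sub (z : C) (a : 'P1 (ratfun Fq)) : C :=
  if a is Some x then (z - vemb C x)^-1 else 0.

Definition u_fun (z : C) (a b : 'P1 (ratfun Fq)) : C :=
  inv_sub z b - inv_sub z a.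

Definition fseries (n : {poly Fq}) (k r : nat) (a b : 'I_r -> 'P1 Fq)
    (z : C) : C :=
  vsum (Gamma n) (fun g =>
    \prod_(i < r) u_fun z (actF g (pt_cst (a i))) (actF g (pt_cst (b i))) ^+ k).

Definition e_lat (n : {poly Fq}) (z : C) : C :=
  z * vprod [pred b : {poly Fq} | (b != 0) && (n %| b)]
        (fun b => 1 - z / vemb C (polyF b)).

Definition t_par (n : {poly Fq}) (z : C) : C := (e_lat n z)^-1.

Definition t_expansion (n : {poly Fq}) (g : C -> C) (c : nat -> C) : Prop :=
  exists M : R, forall z, Omega z -> M < imabs z ->
    vcvg \oo (fun N => \sum_(m < N) c m * t_par n z ^+ m) (g z).

Definition order_at_oo (n : {poly Fq}) (g : C -> C) (m : nat) : Prop :=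
  exists c, [/\ t_expansion n g c, c m != 0 &
                forall j, (j < m)%N -> c j = 0].

Definition slash (w : nat) (nu : 'M[Fq]_2) (g : C -> C) (z : C) : C :=
  let M := map_mx (fun x => vemb C (cstF x)) nu in
  (M 1 0 * z + M 1 1) ^- w * g ((M 0 0 * z + M 0 1) / (M 1 0 * z + M 1 1)).

(* For a cusp [s] meeting P^1(Fq): the order does not depend on the choice of
   the representative alpha or of nu, and is required to be [m] for all. *)
Definition order_at_cusp (n : {poly Fq}) (w : nat) (g : C -> C)
    (s : set ('P1 (ratfun Fq))) (m : nat) : Prop :=
  forall (alpha : 'P1 Fq) (nu : 'M[Fq]_2),
    s (pt_cst alpha) -> nu \in unitmx -> moebius nu None = alpha ->
    order_at_oo n (slash w nu g) m.

End ValuedExt.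

Section Pairs.
Context (Fq : finFieldType) (r : nat) (a b : 'I_r -> 'P1 Fq).

Definition pair_decomposition : Prop :=
  (forall i, a i <> b i) /\ (forall x, exists! i, x = a i \/ x = b i).

Definition C0 : Fq :=
  \prod_(i < r | (a i != None) && (b i != None)) (odflt 0 (b i) - odflt 0 (a i)).

(* u(z; a, b) = (b - a) / ((z - a) (z - b)) for finite a and b, and
   u(z; oo, b) = 1 / (z - b), but u(z; a, oo) = - 1 / (z - a).  As C0 ignores
   the pair containing infinity, the last case has to be recorded separately. *)
Definition oo_sign : Fq := (-1) ^+ [exists i, b i == None].

End Pairs.

(* Main.v *)
(* Write Q(X, Y) = X Y^q - X^q Y.  The term of the series at gamma = (a b; c d) is
   a constant times Q(a - cz, dz - b)^(-k), independently of the decomposition into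
   pairs; in particular f is, up to a factor, invariant under the slash operators of
   GL_2(Fq), and its terms can be summed over the orbits of Lambda = nA + Fq, acting
   by translations.
   Modulo (z - y)^(q-1) the polynomial Q(a - cz, dz - b) is linear in z - y at each of
   its roots y, so for k < q the partial fraction decomposition of its -k-th power
   consists of pure k-th order poles r_y^k / (z - y)^k; and sum_y r_y^k = 0 if c <> 0.
   The same fact for Z - Z^q gives sum_(l in Lambda) (z - l)^(-k) = s(z)^k where
   1/s = e - e^q / eps^(q-1) is the exponential function of Lambda.  Hence the sum over
   an orbit with c <> 0 is sum_y (r_y s / (1 - e_Lambda(y) s))^k = O(s^(k+1)), which is
   O(t^(q(k+1))), and c = 0 contributes
   s^k = (-1)^k eps^(k(q-1)) t^(kq) (1 + O(t^(q-1))). *)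
Require Import Defs.
From HB Require Import structures.
From mathcomp Require Import all_boot all_order all_algebra all_field.
From mathcomp Require Import finmap ring lra zify generic_quotient fraction.
From mathcomp Require Import boolp classical_sets reals filter topology normedtype summability.

Set Implicit Arguments.
Unset Strict Implicit.
Unset Printing Implicit Defensive.

Import Order.TTheory GRing.Theory Num.Theory.
Import numFieldNormedType.Exports.
Local Open Scope classical_set_scope.
Local Open Scope ring_scope.

(** * Ultrametric limits *)

Section Ultrametric.
Context {Fq : finFieldType} {R : realType} {C : valuedExt Fq R}.
Implicit Types (x y z l : C) (e : R).

Lemma vabs0 : vabs (0 : C) = 0.
Proof. by apply/eqP; rewrite vabs_eq0. Qed.

Lemma vabs_gt0 x : (0 < vabs x) = (x != 0).
Proof. by rewrite lt0r vabs_eq0 vabs_ge0 andbT. Qed.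

Lemma vabs1 : vabs (1 : C) = 1.
Proof.
have v1 : vabs (1 : C) != 0 by rewrite vabs_eq0 oner_eq0.
by apply: (mulfI v1); rewrite -vabsM !mulr1.
Qed.

Lemma vabsN x : vabs (- x) = vabs x.
Proof.
rewrite -mulN1r vabsM; suff -> : vabs (-1 : C) = 1 by rewrite mul1r.
have /eqP : vabs (-1 : C) ^+ 2 = 1 by rewrite expr2 -vabsM mulrNN mulr1 vabs1.
by rewrite sqrf_eq1 => /orP[/eqP//|/eqP H]; have := vabs_ge0 (-1 : C); rewrite H ler0N1.
Qed.

Lemma vabsX x n : vabs (x ^+ n) = vabs x ^+ n.
Proof. by elim: n => [|n IH]; rewrite ?expr0 ?vabs1 // !exprS vabsM IH. Qed.

Lemma vabsV x : vabs x^-1 = (vabs x)^-1.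
Proof.
have [->|x0] := eqVneq x 0; first by rewrite invr0 vabs0 invr0.
have v0 : vabs x != 0 by rewrite vabs_eq0.
by apply: (mulfI v0); rewrite -vabsM !divff // vabs1.
Qed.

Lemma vabsBC x y : vabs (x - y) = vabs (y - x).
Proof. by rewrite -vabsN opprB. Qed.

Lemma vabsD_le x y e : vabs x <= e -> vabs y <= e -> vabs (x + y) <= e.
Proof. by move=> hx hy; apply: le_trans (vabsD x y) _; rewrite ge_max hx. Qed.

Lemma vabsB_le x y e : vabs x <= e -> vabs y <= e -> vabs (x - y) <= e.
Proof. by move=> hx hy; apply: vabsD_le; rewrite ?vabsN. Qed.

Lemma vabsD_lt x y e : vabs x < e -> vabs y < e -> vabs (x + y) < e.
Proof. by move=> hx hy; apply: le_lt_trans (vabsD x y) _; rewrite gt_max hx. Qed.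

Lemma vabsB_lt x y e : vabs x < e -> vabs y < e -> vabs (x - y) < e.
Proof. by move=> hx hy; apply: vabsD_lt; rewrite ?vabsN. Qed.

Lemma vabsD_dom x y : vabs y < vabs x -> vabs (x + y) = vabs x.
Proof.
move=> h; apply/eqP; rewrite eq_le vabsD_le ?(ltW h) //= leNgt; apply/negP => h2.
by have := vabsB_lt h2 h; rewrite addrK ltxx.
Qed.

Lemma vabsB_dom x y : vabs y < vabs x -> vabs (x - y) = vabs x.
Proof. by move=> h; rewrite vabsD_dom ?vabsN. Qed.

Lemma vabsB_domr x y : vabs x < vabs y -> vabs (x - y) = vabs y.
Proof. by move=> h; rewrite vabsBC vabsB_dom. Qed.

Lemma vabs_sum_le (I : eqType) (r : seq I) (P : pred I) (F : I -> C) e :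
  0 <= e -> (forall i, i \in r -> P i -> vabs (F i) <= e) ->
  vabs (\sum_(i <- r | P i) F i) <= e.
Proof.
move=> e0 H; rewrite big_seq_cond; apply: (big_ind (fun x => vabs x <= e)).
- by rewrite vabs0.
- by move=> x y; apply: vabsD_le.
- by move=> i /andP[]; apply: H.
Qed.

Lemma vabs_sum_lt (I : eqType) (r : seq I) (P : pred I) (F : I -> C) e :
  0 < e -> (forall i, i \in r -> P i -> vabs (F i) < e) ->
  vabs (\sum_(i <- r | P i) F i) < e.
Proof.
move=> e0 H; rewrite big_seq_cond; apply: (big_ind (fun x => vabs x < e)).
- by rewrite vabs0.
- by move=> x y; apply: vabsD_lt.
- by move=> i /andP[]; apply: H.
Qed.

Lemma vabs_prod (I : Type) (r : seq I) (P : pred I) (F : I -> C) :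
  vabs (\prod_(i <- r | P i) F i) = \prod_(i <- r | P i) vabs (F i).
Proof.
by elim/big_rec2: _ => [|i x y _ <-]; rewrite ?vabs1 ?vabsM.
Qed.

Lemma vabs_prod_sub1 (I : eqType) (r : seq I) (P : pred I) (F : I -> C) e :
  0 < e -> e <= 1 -> (forall i, i \in r -> P i -> vabs (F i - 1) < e) ->
  vabs (\prod_(i <- r | P i) F i - 1) < e.
Proof.
move=> e0 e1 H; rewrite big_seq_cond.
apply: (big_ind (fun x => vabs (x - 1) < e)).
- by rewrite subrr vabs0.
- move=> x y hx hy; rewrite (_ : x * y - 1 = (x - 1) * (y - 1) + (x - 1) + (y - 1)); last by ring.
  apply: vabsD_lt => //; apply: vabsD_lt => //; rewrite vabsM.
  apply: le_lt_trans hx; apply: ler_piMr; first exact: vabs_ge0.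
  by apply: le_trans (ltW hy) e1.
- by move=> i /andP[]; apply: H.
Qed.

Definition lims (u : nat -> C) l :=
  forall e, 0 < e -> exists N, forall m, (N <= m)%N -> vabs (u m - l) < e.

Lemma vcvg_filter (U : Type) (G : set_system U) {FG : Filter G} (g : U -> C) l :
  vcvg G g l <-> forall e, 0 < e -> G (fun w => vabs (g w - l) < e).
Proof.
rewrite /vcvg; split.
  move=> /cvgr_dist_lt H e e0; have := H e e0; apply: filterS => x /=.
  by rewrite sub0r normrN ger0_norm ?vabs_ge0.
move=> H; apply/cvgrPdist_lt => e e0; have := H e e0; apply: filterS => x /=.
by rewrite sub0r normrN ger0_norm ?vabs_ge0.
Qed.

Lemma vcvg_seqP (u : nat -> C) l : vcvg \oo u l <-> lims u l.
Proof.
rewrite vcvg_filter; split=> H e /H.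
  by case=> N _ HN; exists N => m /HN.
by case=> N HN; exists N.
Qed.

Lemma lims_unique u l l' : lims u l -> lims u l' -> l = l'.
Proof.
move=> H H'; apply/eqP; rewrite -subr_eq0 -vabs_eq0; apply/negPn/negP => h.
have e0 : 0 < vabs (l - l') by rewrite lt0r h vabs_ge0.
have [N HN] := H _ e0; have [N' HN'] := H' _ e0.
pose m := maxn N N'.
have := vabsB_lt (HN' m (leq_maxr _ _)) (HN m (leq_maxl _ _)).
by rewrite (_ : _ - _ - _ = l - l') ?ltxx //; ring.
Qed.

Lemma lims_cst l : lims (fun _ => l) l.
Proof. by move=> e e0; exists 0%N => m _; rewrite subrr vabs0. Qed.

Lemma lims_ext u v l : (forall m, u m = v m) -> lims u l -> lims v l.
Proof. by move=> E H e /H [N HN]; exists N => m /HN; rewrite E. Qed.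

Lemma limsD u v l l' : lims u l -> lims v l' -> lims (fun m => u m + v m) (l + l').
Proof.
move=> H H' e e0; have [N HN] := H _ e0; have [N' HN'] := H' _ e0.
exists (maxn N N') => m; rewrite geq_max => /andP[h h'].
rewrite (_ : _ - _ = (u m - l) + (v m - l')); last by ring.
by apply: vabsD_lt; [apply: HN|apply: HN'].
Qed.

Lemma lims_vabs_le u l e : lims u l -> (forall m, vabs (u m) <= e) -> vabs l <= e.
Proof.
move=> H B; rewrite leNgt; apply/negP => h.
have [N /(_ N (leqnn N)) HN] := H _ (le_lt_trans (le_trans (vabs_ge0 _) (B 0%N)) h).
have := vabsB_dom (le_lt_trans (B N) h); rewrite vabsBC => E.
by rewrite E ltxx in HN.
Qed.

Lemma lims_vabs u l : lims u l -> l != 0 ->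
  exists N, forall m, (N <= m)%N -> vabs (u m) = vabs l.
Proof.
rewrite -vabs_gt0 => H l0; have [N HN] := H _ l0; exists N => m /HN h.
by rewrite -(subrK l (u m)) addrC vabsD_dom.
Qed.

Lemma lims_bounded u l : lims u l -> exists B, [/\ 0 < B & forall m, vabs (u m) <= B].
Proof.
move=> H; have [N HN] := H 1 ltr01.
pose B := 1 + vabs l + \sum_(i < N) vabs (u i).
have S0 : 0 <= \sum_(i < N) vabs (u i) by apply: sumr_ge0 => i _; apply: vabs_ge0.
exists B; split; first by rewrite /B; have := vabs_ge0 l; lra.
move=> m; have [h|h] := leqP N m.
  rewrite -(subrK l (u m)); apply: vabsD_le; rewrite /B.
    by have := HN _ h; have := vabs_ge0 l; lra.
  by have := vabs_ge0 l; lra.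
have : vabs (u m) <= \sum_(i < N) vabs (u i).
  rewrite (bigD1 (Ordinal h)) //= lerDl; apply: sumr_ge0 => i _; exact: vabs_ge0.
by rewrite /B; have := vabs_ge0 l; lra.
Qed.

Lemma limsM u v l l' : lims u l -> lims v l' -> lims (fun m => u m * v m) (l * l').
Proof.
move=> H H' e e0; have [B [B0 HB]] := lims_bounded H.
pose K := Num.max B (vabs l' + 1).
have K0 : 0 < K by rewrite lt_max B0.
have [N HN] := H _ (divr_gt0 e0 K0); have [N' HN'] := H' _ (divr_gt0 e0 K0).
exists (maxn N N') => m; rewrite geq_max => /andP[h h'].
rewrite (_ : _ - _ = u m * (v m - l') + (u m - l) * l'); last by ring.
apply: vabsD_lt; rewrite vabsM.
  have : vabs (u m) * vabs (v m - l') <= K * vabs (v m - l').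
    by apply: ler_wpM2r; [apply: vabs_ge0|rewrite le_max HB].
  move/le_lt_trans; apply; rewrite -ltr_pdivlMl // mulrC; exact: HN'.
have : vabs (u m - l) * vabs l' <= vabs (u m - l) * K.
  apply: ler_wpM2l; [apply: vabs_ge0|rewrite le_max]; apply/orP; right.
  by rewrite lerDl ler01.
move/le_lt_trans; apply; rewrite -ltr_pdivlMr //; exact: HN.
Qed.

Lemma limsX u l n : lims u l -> lims (fun m => u m ^+ n) (l ^+ n).
Proof.
move=> H; elim: n => [|n IH]; first exact: lims_cst.
apply: (@lims_ext (fun m => u m * u m ^+ n)); first by move=> m; rewrite exprS.
by rewrite exprS; apply: limsM.
Qed.

Lemma limsZ u l x : lims u l -> lims (fun m => x * u m) (x * l).
Proof. by move=> H; apply: limsM H; apply: lims_cst. Qed.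

Lemma limsN u l : lims u l -> lims (fun m => - u m) (- l).
Proof. by move=> /(limsZ (-1)); rewrite mulN1r; apply: lims_ext => m; rewrite mulN1r. Qed.

Lemma limsB u v l l' : lims u l -> lims v l' -> lims (fun m => u m - v m) (l - l').
Proof. by move=> H /limsN; apply: limsD. Qed.

Lemma lims_sum (I : Type) (r : seq I) (P : pred I) (u : I -> nat -> C) (l : I -> C) :
  (forall i, P i -> lims (u i) (l i)) ->
  lims (fun m => \sum_(i <- r | P i) u i m) (\sum_(i <- r | P i) l i).
Proof.
move=> H; elim: r => [|i r IH].
  apply: (@lims_ext (fun=> 0)); first by move=> m; rewrite big_nil.
  by rewrite big_nil; apply: lims_cst.
rewrite big_cons; case: ifP => h.
  apply: (@lims_ext (fun m => u i m + \sum_(j <- r | P j) u j m)).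
    by move=> m; rewrite big_cons h.
  by apply: limsD => //; apply: H.
by apply: lims_ext IH => m; rewrite big_cons h.
Qed.

Lemma limsV u l : lims u l -> l != 0 -> lims (fun m => (u m)^-1) l^-1.
Proof.
move=> H l0; have [N HN] := lims_vabs H l0.
have v0 : 0 < vabs l by rewrite vabs_gt0.
move=> e e0; have [N' HN'] := H _ (mulr_gt0 e0 (mulr_gt0 v0 v0)).
exists (maxn N N') => m; rewrite geq_max => /andP[/HN h /HN' h'].
have u0 : u m != 0 by rewrite -vabs_gt0 h.
rewrite (_ : _ - _ = (l - u m) / (u m * l)); last by field; rewrite u0 l0.
by rewrite vabsM vabsV vabsM h vabsBC ltr_pdivrMr ?mulr_gt0.
Qed.

Lemma lims_sub0 (u v : nat -> C) l :
  lims u l -> (forall e, 0 < e -> exists N, forall m, (N <= m)%N -> vabs (v m - u m) < e) ->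
  lims v l.
Proof.
move=> H H'; rewrite -[l]addr0.
apply: (@lims_ext (fun m => u m + (v m - u m))); first by move=> m; ring.
apply: limsD => // e /H' [N HN]; exists N => m /HN; by rewrite subr0.
Qed.


Lemma cauchy_lims (u : nat -> C) : vcomplete C ->
  (forall e, 0 < e -> exists N, forall m, (N <= m)%N -> vabs (u m.+1 - u m) < e) ->
  exists l, lims u l.
Proof.
move=> Cc H; have [|l hl] := Cc u; last by exists l; apply/vcvg_seqP.
move=> e e0; have [N HN] := H _ e0; exists N.
suff K m : (N <= m)%N -> vabs (u m - u N) < e.
  move=> m n /K hm /K hn; rewrite (_ : _ - _ = (u m - u N) - (u n - u N)); last by ring.
  exact: vabsB_lt.
elim: m => [|m IH]; first by rewrite leqn0 => /eqP ->; rewrite subrr vabs0.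
rewrite leq_eqVlt => /orP[/eqP <-|h]; first by rewrite subrr vabs0.
rewrite (_ : _ - _ = (u m.+1 - u m) + (u m - u N)); last by ring.
by apply: vabsD_lt; [apply: HN|apply: IH].
Qed.

End Ultrametric.

(** * Unordered sums and products *)

Section UnorderedSums.
Context {Fq : finFieldType} {R : realType} {C : valuedExt Fq R}.
Context {I : choiceType}.
Implicit Types (D : {pred I}) (g : I -> C) (l : C) (e : R) (S : {fset I}).

Definition hassum D g l := forall e, 0 < e -> exists S0 : {fset I},
  forall S, (S0 `<=` S)%fset -> vabs (\sum_(i <- S | i \in D) g i - l) < e.

Definition hasprod D g l := forall e, 0 < e -> exists S0 : {fset I},
  forall S, (S0 `<=` S)%fset -> vabs (\prod_(i <- S | i \in D) g i - l) < e.

Lemma vcvg_totally (u : {fset I} -> C) l :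
  vcvg totally u l <-> forall e, 0 < e -> exists S0 : {fset I},
    forall S, (S0 `<=` S)%fset -> vabs (u S - l) < e.
Proof.
have FT := @totally_filter I; rewrite vcvg_filter; split=> H e /H.
  by case=> S0 _ HS; exists S0 => S /HS.
by case=> S0 HS; exists S0.
Qed.

Lemma vcvg_totally_unique (u : {fset I} -> C) l l' :
  vcvg totally u l -> vcvg totally u l' -> l = l'.
Proof.
move=> /vcvg_totally H /vcvg_totally H'.
apply/eqP; rewrite -subr_eq0 -vabs_eq0; apply/negPn/negP => h.
have e0 : 0 < vabs (l - l') by rewrite lt0r h vabs_ge0.
have [S HS] := H _ e0; have [S' HS'] := H' _ e0.
have := vabsB_lt (HS' (S `|` S')%fset (fsubsetUr _ _)) (HS (S `|` S')%fset (fsubsetUl _ _)).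
by rewrite (_ : _ - _ - _ = l - l') ?ltxx //; ring.
Qed.

Lemma vlim_eq (u : {fset I} -> C) l : vcvg totally u l -> vlim totally u = l.
Proof.
move=> H; apply: (vcvg_totally_unique _ H).
by rewrite /vlim; apply: (@xgetPex _ 0 [set l | vcvg totally u l]); exists l.
Qed.

Lemma vsum_hassum D g l : hassum D g l -> vsum D g = l.
Proof. by move=> H; apply: vlim_eq; apply/vcvg_totally. Qed.

Lemma vprod_hasprod D g l : hasprod D g l -> vprod D g = l.
Proof. by move=> H; apply: vlim_eq; apply/vcvg_totally. Qed.

Lemma hassum_unique D g l l' : hassum D g l -> hassum D g l' -> l = l'.
Proof. by move=> /vsum_hassum <- /vsum_hassum. Qed.

Definition vanishing (D : {pred I}) (h : I -> R) := forall e, 0 < e ->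
  exists S0 : {fset I}, forall i, i \in D -> i \notin S0 -> h i < e.

Definition exhausts (D : {pred I}) (s : nat -> seq I) :=
  [/\ forall m, uniq (s m), forall m i, i \in s m -> i \in D
    & forall i, i \in D -> exists N, forall m, (N <= m)%N -> i \in s m].

Lemma exhausts_fset D s S : exhausts D s ->
  exists N, forall m, (N <= m)%N -> forall i, i \in S -> i \in D -> i \in s m.
Proof.
case=> _ _ H.
suff [N HN] : exists N, forall m, (N <= m)%N ->
    forall i, i \in (S : seq I) -> i \in D -> i \in s m by exists N.
elim: (S : seq I) => [|i r [N IH]]; first by exists 0%N.
have [iD|iD] := boolP (i \in D); last first.
  exists N => m hm j; rewrite inE => /orP[/eqP ->|jr]; first by rewrite (negPf iD).
  exact: IH.
have [N' HN'] := H _ iD; exists (maxn N N') => m; rewrite geq_max => /andP[h h'] j.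
by rewrite inE => /orP[/eqP -> _|jr]; [apply: HN'|apply: IH].
Qed.

Lemma big_fset_split (T : Type) (idx : T) (op : Monoid.com_law idx) D (g : I -> T) S (s : seq I) :
  uniq s -> (forall i, i \in s -> i \in D) -> (forall i, i \in s -> i \in S) ->
  \big[op/idx]_(i <- S | i \in D) g i =
  op (\big[op/idx]_(i <- s) g i) (\big[op/idx]_(i <- S | (i \in D) && (i \notin s)) g i).
Proof.
move=> us sD sS; rewrite (bigID (mem s)) /=; congr (op _ _).
rewrite -[LHS]big_filter; apply: perm_big; apply: uniq_perm => //.
  exact/filter_uniq/fset_uniq.
move=> i; rewrite mem_filter; apply/idP/idP => [/andP[/andP[]]|is_] //.
by rewrite is_ (sD _ is_) (sS _ is_).
Qed.

Lemma hassum_exhaust D g s l : vanishing D (fun i => vabs (g i)) -> exhausts D s ->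
  lims (fun m => \sum_(i <- s m) g i) l -> hassum D g l.
Proof.
move=> V E L e e0; have [S0 HS0] := V _ e0; have [us sD _] := E.
have [N HN] := exhausts_fset S0 E; have [N' HN'] := L _ e0.
pose m := maxn N N'; exists [fset i in s m]%fset => S sS.
rewrite (@big_fset_split _ _ _ D g S (s m)) //=; first last.
- by move=> i im; apply: (fsubsetP sS); rewrite !inE.
- exact: sD.
rewrite addrAC; apply: vabsD_lt; first by apply: HN'; exact: leq_maxr.
apply: vabs_sum_lt => // i iS /andP[iD iN]; apply: HS0 => //.
by apply: contra iN => /(HN m (leq_maxl _ _)); apply.
Qed.

Lemma hasprod_exhaust D g s l : vanishing D (fun i => vabs (g i - 1)) -> exhausts D s ->
  lims (fun m => \prod_(i <- s m) g i) l -> hasprod D g l.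
Proof.
move=> V E L e e0; have [us sD _] := E.
have [B [B0 HB]] := lims_bounded L.
pose d := Num.min 1 (e / B).
have d0 : 0 < d by rewrite lt_min ltr01 divr_gt0.
have [S0 HS0] := V _ d0.
have [N HN] := exhausts_fset S0 E; have [N' HN'] := L _ e0.
pose m := maxn N N'; exists [fset i in s m]%fset => S sS.
rewrite (@big_fset_split _ _ _ D g S (s m)) //=; first last.
- by move=> i im; apply: (fsubsetP sS); rewrite !inE.
- exact: sD.
set x := \prod_(i <- s m) _; set y := \prod_(_ <- _ | _) _.
rewrite (_ : _ - l = (x - l) + x * (y - 1)); last by ring.
apply: vabsD_lt; first by apply: HN'; exact: leq_maxr.
have hy : vabs (y - 1) < d.
  apply: vabs_prod_sub1 => //; first by rewrite ge_min lexx.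
  move=> i iS /andP[iD iN]; apply: HS0 => //.
  by apply: contra iN => /(HN m (leq_maxl _ _)); apply.
rewrite vabsM; have : vabs x * vabs (y - 1) <= B * vabs (y - 1).
  by apply: ler_wpM2r; [apply: vabs_ge0|apply: HB].
move/le_lt_trans; apply; rewrite mulrC -ltr_pdivlMr //.
by apply: lt_le_trans hy _; rewrite ge_min lexx orbT.
Qed.

Lemma hassum_lims D g s l : exhausts D s -> hassum D g l ->
  lims (fun m => \sum_(i <- s m) g i) l.
Proof.
move=> E H e e0; have [S0 HS0] := H _ e0; have [us sD _] := E.
have [N HN] := exhausts_fset S0 E; exists N => m hm.
have := HS0 (S0 `|` [fset i in s m])%fset (fsubsetUl _ _).
rewrite (@big_fset_split _ _ _ D g _ (s m)) //=; first last.
- by move=> i im; rewrite !inE im orbT.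
- exact: sD.
rewrite [X in vabs (_ + X - _)]big1_seq ?addr0 // => i /andP[/andP[iD /negP iN]].
by rewrite !inE => /orP[/(HN m hm)/(_ iD)/iN|/iN].
Qed.

Lemma hassum_exists D g s : vcomplete C -> exhausts D s ->
  vanishing D (fun i => vabs (g i)) -> exists l, hassum D g l.
Proof.
move=> Cc E V; have [us sD _] := E.
have [l hl] : exists l, lims (fun m => \sum_(i <- s m) g i) l; last first.
  by exists l; apply: hassum_exhaust hl.
apply: cauchy_lims => // e e0; have [S0 HS0] := V _ e0.
have [N HN] := exhausts_fset S0 E; exists N => m hm.
pose S := ([fset i in s m] `|` [fset i in s m.+1])%fset.
have K n : (N <= n)%N -> n \in [:: m; m.+1] ->
    vabs (\sum_(i <- S | i \in D) g i - \sum_(i <- s n) g i) < e.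
  move=> hn nm; rewrite (@big_fset_split _ _ _ D g S (s n)) //=; first last.
  - by move=> i im; rewrite !inE; move: nm im; rewrite !inE => /orP[] /eqP -> ->; rewrite ?orbT.
  - exact: sD.
  rewrite addrAC subrr add0r; apply: vabs_sum_lt => // i _ /andP[iD iN].
  by apply: HS0 => //; apply: contra iN => /(HN n hn); apply.
have := vabsB_lt (K m hm (mem_head _ _)) (K m.+1 (leqW hm) _).
by rewrite !inE eqxx orbT => /(_ isT); congr (vabs _ < e); ring.
Qed.

Lemma hassumD D g h l l' : hassum D g l -> hassum D h l' ->
  hassum D (fun i => g i + h i) (l + l').
Proof.
move=> H H' e e0; have [S HS] := H _ e0; have [S' HS'] := H' _ e0.
exists (S `|` S')%fset => T; rewrite fsubUset => /andP[hT hT'].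
rewrite big_split /= (_ : _ - _ = (\sum_(i <- T | i \in D) g i - l) +
  (\sum_(i <- T | i \in D) h i - l')); last by ring.
by apply: vabsD_lt; [apply: HS|apply: HS'].
Qed.

Lemma hassumZ D g l (x : C) : hassum D g l -> hassum D (fun i => x * g i) (x * l).
Proof.
have [->|x0] := eqVneq x 0.
  move=> _ e e0; exists fset0 => S _; rewrite mul0r big1 ?subr0 ?vabs0 // => i _.
  by rewrite mul0r.
rewrite -vabs_gt0 in x0.
move=> H e e0; have [S HS] := H _ (divr_gt0 e0 x0); exists S => T /HS.
by rewrite -mulr_sumr -mulrBr vabsM -ltr_pdivlMl // [_^-1 * e]mulrC.
Qed.

Lemma hassum_ext D g h l : (forall i, i \in D -> g i = h i) ->
  hassum D g l -> hassum D h l.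
Proof.
move=> E H e /H [S HS]; exists S => T /HS.
by rewrite (eq_bigr h) // => i; apply: E.
Qed.

Lemma hassum_le D g l e : hassum D g l -> 0 <= e ->
  (forall i, i \in D -> vabs (g i) <= e) -> vabs l <= e.
Proof.
move=> H e0 B; rewrite leNgt; apply/negP => h.
have [S /(_ S (fsubset_refl _)) HS] := H _ (le_lt_trans e0 h).
have hS : vabs (\sum_(i <- S | i \in D) g i) <= e.
  by apply: vabs_sum_le => // i _; apply: B.
by move: HS; rewrite vabsBC (vabsB_dom (le_lt_trans hS h)) ltxx.
Qed.

Lemma hassum0 D : hassum D (fun=> 0) 0.
Proof. by move=> e e0; exists fset0 => S _; rewrite big1 // subrr vabs0. Qed.

Lemma hassum_sum (J : Type) (r : seq J) (P : pred J) D (g : J -> I -> C) (l : J -> C) :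
  (forall j, P j -> hassum D (g j) (l j)) ->
  hassum D (fun i => \sum_(j <- r | P j) g j i) (\sum_(j <- r | P j) l j).
Proof.
move=> H; elim: r => [|j r IH].
  by rewrite big_nil; apply: hassum_ext (hassum0 D) => i _; rewrite big_nil.
rewrite big_cons; case: ifP => h; last by apply: hassum_ext IH => i _; rewrite big_cons h.
apply: hassum_ext (hassumD (H j h) IH) => i _; by rewrite big_cons h.
Qed.

Lemma hassum_bij D g l (f f' : I -> I) : cancel f f' -> cancel f' f ->
  (forall i, (f i \in D) = (i \in D)) ->
  hassum D g l -> hassum D (fun i => g (f i)) l.
Proof.
move=> fK f'K fD H e /H [S HS]; exists [fset f' i | i in S]%fset => T sT.
have {HS} := HS [fset f i | i in T]%fset; rewrite big_mkcond big_imfset /=; last first.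
  by move=> i j _ _; apply: (can_inj fK).
under [X in vabs (X - _)]eq_bigr do rewrite fD; rewrite -big_mkcond; apply.
apply/fsubsetP => i iS; rewrite -[i]f'K; apply: in_imfset.
by apply: (fsubsetP sT); apply: in_imfset.
Qed.

Lemma lims_dominated D (s : nat -> seq I) (G : nat -> I -> C) g (B : I -> R) l :
  exhausts D s -> vanishing D B -> (forall m i, i \in D -> vabs (G m i) <= B i) ->
  (forall i, i \in D -> lims (G^~ i) (g i)) -> hassum D g l ->
  lims (fun m => \sum_(i <- s m) G m i) l.
Proof.
move=> E V HB L H; have [us sD _] := E.
apply: lims_sub0 (hassum_lims E H) _ => e e0; have [S0 HS0] := V _ e0.
have gB i : i \in D -> vabs (g i) <= B i.
  by move=> iD; apply: lims_vabs_le (L i iD) _ => m; apply: HB.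
have [N HN] : exists N, forall m, (N <= m)%N -> forall i, i \in (S0 : seq I) -> i \in D ->
    vabs (G m i - g i) < e.
  elim: (S0 : seq I) => [|i r [N IH]]; first by exists 0%N.
  have [iD|iD] := boolP (i \in D); last first.
    exists N => m hm j; rewrite inE => /orP[/eqP ->|jr]; first by rewrite (negPf iD).
    exact: IH.
  have [N' HN'] := L _ iD _ e0; exists (maxn N N') => m; rewrite geq_max => /andP[h h'] j.
  by rewrite inE => /orP[/eqP -> _|jr]; [apply: HN'|apply: IH].
exists N => m hm; rewrite -sumrB; apply: vabs_sum_lt => // i /sD iD _.
have [iS|iS] := boolP (i \in S0); first exact: HN.
by have b := HS0 _ iD iS; apply: vabsB_lt; apply: le_lt_trans b; [apply: HB|apply: gB].
Qed.

End UnorderedSums.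

(** * Pure partial fractions *)

Section Embedding.
Context {Fq : finFieldType} {R : realType}.
Local Notation q := #|Fq|.

Definition pemb (C : valuedExt Fq R) (p : {poly Fq}) : C := vemb C (polyF p).

HB.instance Definition _ (C : valuedExt Fq R) :=
  GRing.RMorphism.copy (pemb C) (vemb C \o @FracField.tofrac {poly Fq}).

Context {C : valuedExt Fq R}.
Local Notation pC := (pemb C).
Local Notation iota x := (pC x%:P).
Implicit Types (z w u : C) (p : {poly Fq}).

Lemma card_Fq_gt1 : (1 < q)%N.
Proof. exact: finNzRing_gt1. Qed.

Lemma card_Fq_gt0 : (0 < q)%N. Proof. exact: ltnW card_Fq_gt1. Qed.
Hint Resolve card_Fq_gt0 : core.

Lemma qR_gt1 : 1 < q%:R :> R.
Proof. by rewrite ltr1n card_Fq_gt1. Qed.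

Lemma qR_gt0 : 0 < q%:R :> R.
Proof. by rewrite ltr0n. Qed.

Lemma vabs_pemb p : p != 0 -> vabs (pC p) = q%:R ^+ (size p).-1.
Proof. by move=> p0; rewrite /pemb vabs_poly // natrX. Qed.

Lemma vabs_pemb_ge1 p : p != 0 -> 1 <= vabs (pC p).
Proof. by move=> p0; rewrite vabs_pemb // exprn_ege1 // ltW // qR_gt1. Qed.

Lemma vabs_pemb_le p p' : p' != 0 -> (size p <= size p')%N -> vabs (pC p) <= vabs (pC p').
Proof.
move=> p'0 h; have [->|p0] := eqVneq p 0; first by rewrite rmorph0 vabs0 vabs_ge0.
rewrite !vabs_pemb // ler_eXn2l ?qR_gt1 //.
by move: p0 p'0 h; rewrite -!size_poly_gt0; lia.
Qed.

Lemma vabs_pemb_lt p p' : p' != 0 -> (size p < size p')%N -> vabs (pC p) < vabs (pC p').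
Proof.
move=> p'0 h; have [->|p0] := eqVneq p 0.
  by rewrite rmorph0 vabs0 (lt_le_trans ltr01) // vabs_pemb_ge1.
rewrite !vabs_pemb // ltr_eXn2l ?qR_gt1 //.
by move: p0 p'0 h; rewrite -!size_poly_gt0; lia.
Qed.

Lemma pemb_eq0 p : (pC p == 0) = (p == 0).
Proof.
apply/eqP/eqP => [h|->]; last by rewrite rmorph0.
apply/eqP/negPn/negP => /vabs_pemb_ge1; by rewrite h vabs0 ler10.
Qed.

Lemma pemb_inj : injective pC.
Proof. by move=> p p' /eqP; rewrite -subr_eq0 -rmorphB pemb_eq0 subr_eq0 => /eqP. Qed.

Lemma vabs_iota (x : Fq) : x != 0 -> vabs (iota x) = 1.
Proof. by move=> x0; rewrite vabs_pemb ?polyC_eq0 // size_polyC x0. Qed.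


Lemma pchar_nat_card (L : nzRingType) (h : {rmorphism Fq -> L}) : [pchar L].-nat q.
Proof.
have [p p_pr pch] := finPcharP Fq.
rewrite (eq_pnat _ (pcharf_eq (rmorph_pchar h pch))).
rewrite -[#|Fq|]/(#|pPrimeCharType pch|) card_pprimeChar.
by rewrite pnatX pnat_id.
Qed.

Lemma frobD z w : (z + w) ^+ q = z ^+ q + w ^+ q.
Proof.
exact: exprDn_pchar (pchar_nat_card (pC \o polyC)).
Qed.

Lemma frobN z : (- z) ^+ q = - z ^+ q.
Proof.
apply/eqP; rewrite -addr_eq0 -frobD addNr expr0n.
by case: #|Fq| card_Fq_gt0.
Qed.

Lemma frobB z w : (z - w) ^+ q = z ^+ q - w ^+ q.
Proof. by rewrite frobD frobN. Qed.

Lemma iota_expq (x : Fq) : iota x ^+ q = iota x.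
Proof. by rewrite -!rmorphXn /= expf_card. Qed.

Lemma prod_XsubC_iota : \prod_(x : Fq) ('X - (iota x)%:P) = 'X^q - 'X :> {poly C}.
Proof.
have /(congr1 (map_poly (pC \o polyC))) := finField_genPoly Fq.
rewrite /= rmorphB rmorphXn /= map_polyX rmorph_prod /= => ->.
by apply: eq_bigr => x _; rewrite rmorphB /= map_polyX map_polyC.
Qed.

Lemma prod_subr_iota z : \prod_(x : Fq) (z - iota x) = z ^+ q - z.
Proof.
have /(congr1 (fun P : {poly C} => P.[z])) := prod_XsubC_iota.
rewrite !hornerE => <-; rewrite horner_prod.
by apply: eq_bigr => x _; rewrite !hornerE.
Qed.

Lemma prod_subr_iotaM z u : \prod_(x : Fq) (z - iota x * u) = z ^+ q - u ^+ q.-1 * z.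
Proof.
have [->|u0] := eqVneq u 0.
  have q1 : (q.-1 == 0)%N = false by have := card_Fq_gt1; case: #|Fq| => [|[]].
  rewrite expr0n q1 mul0r subr0.
  under eq_bigr do rewrite mulr0 subr0.
  by rewrite prodr_const.
have -> : \prod_(x : Fq) (z - iota x * u) = u ^+ q * \prod_(x : Fq) (z / u - iota x).
  rewrite -[u ^+ q]prodr_const -big_split /=; apply: eq_bigr => x _.
  by field.
rewrite prod_subr_iota expr_div_n mulrBr; congr (_ - _).
  by field; rewrite expf_neq0.
have -> : u ^+ q = u * u ^+ q.-1 by rewrite -exprS prednK.
by field.
Qed.

End Embedding.

Section PurePartialFractions.
Context {Fq : finFieldType} {R : realType} {C : valuedExt Fq R}.
Local Notation q := #|Fq|.
Variables (A B B' D : C).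

Let Q : {poly C} := A *: 'X^(q.+1) + B *: 'X^q + B' *: 'X + D%:P.

Definition quot_at (y : C) : {poly C} :=
  (A * y ^+ q + B')%:P + ('X - y%:P) ^+ q.-1 * (A *: 'X + B%:P).

Lemma quot_atP y : root Q y -> Q = ('X - y%:P) * quot_at y.
Proof.
move=> /rootP; rewrite /Q !hornerE => Qy.
have H : ('X - y%:P) * ('X - y%:P) ^+ q.-1 = 'X^q - (y ^+ q)%:P :> {poly C}.
  rewrite -exprS prednK ?card_Fq_gt0 //.
  have pn := pchar_nat_card (polyC \o (pemb C \o polyC)).
  rewrite exprDn_pchar // -polyCN -polyC_exp; congr (_ + _).
  by rewrite -polyCN; congr (_%:P); rewrite (@frobN Fq R C).
rewrite /quot_at mulrDr mulrA H.
have -> : D = - (A * y ^+ q.+1 + B * y ^+ q + B' * y).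
  by apply/eqP; rewrite -addr_eq0 addrC; apply/eqP.
rewrite !exprS -!mul_polyC !(polyCN, polyCD, polyCM); ring.
Qed.

Variables (lc : C) (ys : seq C) (k : nat).
Hypotheses (lc0 : lc != 0) (Qfact : Q = lc *: \prod_(y <- ys) ('X - y%:P)) (ys_uniq : uniq ys).
Hypotheses (ys0 : (0 < size ys)%N) (dQ0 : forall y, y \in ys -> A * y ^+ q + B' != 0).
Hypotheses (k_gt0 : (0 < k)%N) (k_lt : (k < q)%N).

Let dQ y := A * y ^+ q + B'.

Lemma size_Q : size Q = (size ys).+1.
Proof. by rewrite Qfact size_scale // size_prod_XsubC. Qed.

Lemma rootQ y : root Q y = (y \in ys).
Proof. by rewrite Qfact rootZ // root_prod_XsubC. Qed.

Lemma size_quot_at y : y \in ys -> size (quot_at y) = size ys.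
Proof.
rewrite -rootQ => /quot_atP E; have := size_Q; rewrite E.
have h0 : quot_at y != 0.
  by apply: contra_eq_neq size_Q => h; rewrite E h mulr0 size_poly0.
by rewrite size_mul ?polyXsubC_eq0 // size_XsubC /= => -[].
Qed.

Lemma dvdp_prod_exp (rs : seq C) (P : {poly C}) :
  uniq rs -> (forall y, y \in rs -> ('X - y%:P) ^+ k %| P)%R ->
  ((\prod_(y <- rs) ('X - y%:P)) ^+ k %| P)%R.
Proof.
elim: rs => [|y rs IH]; first by rewrite big_nil expr1n dvd1p.
move=> /= /andP[yr ur] H; rewrite big_cons exprMn Gauss_dvdp.
  rewrite H ?mem_head //=; apply: IH => // y' h; apply: H; by rewrite inE h orbT.
apply: coprimep_expl; apply: coprimep_expr.
by rewrite coprimep_sym coprimep_XsubC root_prod_XsubC.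
Qed.

(* The only poles of 1/Q^k are of exact order k: modulo ('X - y)^(q-1), Q is
   Q'(y) ('X - y). *)
Lemma pure_partial_fractions : \sum_(y <- ys) ((dQ y)^-1 *: quot_at y) ^+ k = 1.
Proof.
apply/eqP; rewrite -subr_eq0; set P := _ - 1; apply/negPn/negP => P0.
have : ((\prod_(y <- ys) ('X - y%:P)) ^+ k %| P)%R.
  apply: dvdp_prod_exp => // y yys.
  rewrite /P (bigD1_seq y) //= addrAC; apply: dvdp_add.
    rewrite -(expr1n _ k) subrXX; apply: dvdp_mulr.
    have -> : (dQ y)^-1 *: quot_at y - 1 =
        ('X - y%:P) ^+ q.-1 * ((dQ y)^-1 *: (A *: 'X + B%:P)).
      rewrite /quot_at scalerDr -!mul_polyC -polyCM mulVf ?polyC1; last exact: dQ0.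
      ring.
    by apply: dvdp_mulr; apply: dvdp_exp2l; rewrite -ltnS prednK ?card_Fq_gt0.
  rewrite big_seq_cond; apply: (big_ind (fun S => (('X - y%:P) ^+ k %| S)%R)).
  - exact: dvdp0.
  - by move=> S S'; apply: dvdp_add.
  move=> y' /andP[y'ys ny].
  apply: dvdp_exp2r; rewrite dvdpZr ?invr_eq0; last exact: dQ0.
  rewrite dvdp_XsubCl; have : root Q y by rewrite rootQ.
  rewrite (@quot_atP y') ?rootQ // rootM root_XsubC => /orP[/eqP E|//].
  by rewrite E eqxx in ny.
move=> /(dvdp_leq P0); apply/negP; rewrite -ltnNge.
have -> : size ((\prod_(y <- ys) ('X - y%:P)) ^+ k) = (size ys * k).+1.
  rewrite polySpred ?expf_neq0 ?monic_neq0 ?monic_prod_XsubC //.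
  by rewrite size_exp size_prod_XsubC.
rewrite ltnS.
have b1 : (1 <= size ys * k)%N by rewrite muln_gt0 ys0.
apply: leq_trans (size_polyD _ _) _; rewrite size_polyN size_poly1 geq_max b1 andbT.
rewrite big_seq_cond; apply: (big_ind (fun S : {poly C} => (size S <= size ys * k)%N)).
- by rewrite size_poly0.
- by move=> S S' h h'; apply: leq_trans (size_polyD _ _) _; rewrite geq_max h.
- move=> y /andP[yys _]; apply: leq_trans (size_poly_exp_leq _ _) _.
  rewrite size_scale ?invr_eq0 ?size_quot_at //; last exact: dQ0.
  have : (0 < size ys)%N by []. 
  by case: (size ys) => // m _ /=; rewrite mulSn; lia.
Qed.

Lemma pure_partial_fractions_horner z : z \notin ys ->
  \sum_(y <- ys) ((dQ y)^-1 / (z - y)) ^+ k = Q.[z] ^- k.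
Proof.
rewrite -rootQ => /negP rz.
have Qz : Q.[z] != 0 by apply/negP => /eqP/rootP.
apply: (mulfI (expf_neq0 k Qz)); rewrite divff ?expf_neq0 //.
have := congr1 (fun P : {poly C} => P.[z]) pure_partial_fractions.
rewrite /= hornerC horner_sum => <-.
rewrite mulr_sumr; apply: eq_big_seq => y yys.
rewrite horner_exp hornerZ -exprMn; congr (_ ^+ _).
have ry : root Q y by rewrite rootQ.
have zy : z - y != 0.
  by rewrite subr_eq0; apply/negP => /eqP E; apply: rz; rewrite E.
rewrite [in LHS](quot_atP ry) hornerM hornerXsubC.
by field; rewrite zy dQ0.
Qed.

Lemma sum_residues0 : size ys = q.+1 -> \sum_(y <- ys) (dQ y)^-1 ^+ k = 0.
Proof.
move=> sys.
have := congr1 (fun P : {poly C} => P`_(q * k)) pure_partial_fractions.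
rewrite /= coef1 (_ : (q * k == 0)%N = false); last first.
  by apply/negbTE; rewrite -lt0n muln_gt0 k_gt0 card_Fq_gt0.
rewrite coef_sum.
under eq_big_seq => y yys.
  have -> : (((dQ y)^-1 *: quot_at y) ^+ k)`_(q * k) = (dQ y)^-1 ^+ k * lc ^+ k.
    rewrite exprZn coefZ; congr (_ * _).
    have sq := size_quot_at yys.
    have lq : lead_coef (quot_at y) = lc.
      have ry : root Q y by rewrite rootQ.
      have := congr1 lead_coef (quot_atP ry); rewrite lead_coefM lead_coefXsubC mul1r => <-.
      by rewrite Qfact lead_coefZ (monicP (monic_prod_XsubC _ _ _)) mulr1.
    by rewrite -lq -lead_coef_exp lead_coefE size_exp sq sys mulnC.
  over.
by rewrite -mulr_suml => /eqP; rewrite mulf_eq0 expf_eq0 (negPf lc0) andbF orbF => /eqP.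
Qed.

End PurePartialFractions.

(** * Exponential functions of lattices *)

Section Lattice.
Context {Fq : finFieldType} {R : realType}.
Local Notation q := #|Fq|.

Fixpoint polys (N : nat) : seq {poly Fq} :=
  if N is N'.+1 then [seq x%:P * 'X^N' + p | x <- enum Fq, p <- polys N'] else [:: 0].

Lemma mem_polys N (p : {poly Fq}) : (p \in polys N) = (size p <= N)%N.
Proof.
elim: N p => [|N IH] p; first by rewrite inE size_poly_leq0.
apply/allpairsP/idP => [[[x p'] /= [_ hp ->]]|h].
  rewrite IH in hp; apply: leq_trans (size_polyD _ _) _; rewrite geq_max.
  rewrite (leqW hp) andbT mul_polyC; apply: leq_trans (size_scale_leq _ _) _.
  by rewrite size_polyXn.
exists (p`_N, p - (p`_N)%:P * 'X^N); split => /=; rewrite ?mem_enum //; last by ring.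
rewrite IH; apply/leq_sizeP => j hj; rewrite coefB mul_polyC coefZ coefXn.
have [->|ne] := eqVneq j N; first by rewrite mulr1 subrr.
by rewrite mulr0 subr0; move/leq_sizeP: h; apply; rewrite ltn_neqAle eq_sym ne.
Qed.

Lemma uniq_polys N : uniq (polys N).
Proof.
elim: N => //= N IH; apply: allpairs_uniq => //; first exact: enum_uniq.
move=> [x p] [x' p'] /allpairsP[[y s] /= [_ hs [-> ->]]] /allpairsP[[y' s'] /= [_ hs' [-> ->]]] E.
rewrite mem_polys in hs; rewrite mem_polys in hs'.
have yy : y = y'.
  have /= := congr1 (fun P : {poly Fq} => P`_N) E.
  by rewrite !coefD !mul_polyC !coefZ !coefXn eqxx !mulr1 !(nth_default 0) // !addr0.
by move: E; rewrite yy => /addrI ->.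
Qed.

Lemma big_polysS (T : Type) (idx : T) (op : Monoid.com_law idx) N (F : {poly Fq} -> T) :
  \big[op/idx]_(p <- polys N.+1) F p =
  \big[op/idx]_(x : Fq) \big[op/idx]_(p <- polys N) F (x%:P * 'X^N + p).
Proof. by rewrite /= big_allpairs_dep big_enum. Qed.

Context {C : valuedExt Fq R}.
Local Notation pC := (pemb C).
Local Notation iota x := (pC x%:P).
Variable n : {poly Fq}.
Implicit Types (z w u : C) (p : {poly Fq}).

Lemma prod_iotaM_neq0 u : \prod_(x : Fq | x != 0) (- (iota x * u)) = - u ^+ q.-1.
Proof.
have P : \prod_(x : Fq | x != 0) ('X - (iota x)%:P) = 'X^(q.-1) - 1 :> {poly C}.
  apply: (@mulfI _ 'X); first by rewrite polyX_eq0.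
  rewrite mulrBr mulr1 -exprS prednK ?card_Fq_gt0 //.
  rewrite -prod_XsubC_iota [RHS](bigD1 0) //=; congr (_ * _).
  by rewrite polyC0 rmorph0 subr0.
have /(congr1 (fun P : {poly C} => P.[0])) := P.
rewrite /= horner_prod !hornerE expr0n.
have q1 : (q.-1 == 0)%N = false by have := @card_Fq_gt1 Fq; case: #|Fq| => [|[]].
rewrite q1 sub0r => E.
under eq_bigr => x _ do rewrite -mulNr -sub0r.
rewrite big_split /= prodr_const (_ : #|_| = q.-1); last first.
  by rewrite -(cardC1 (0 : Fq)); apply: eq_card => x; rewrite !inE.
rewrite -[RHS]mulN1r -E; congr (_ * _); apply: eq_bigr => x _; by rewrite !hornerE.
Qed.

Lemma goss_step k z u : u != 0 -> (0 < k < q)%N -> (forall x, z != iota x * u) ->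
  \sum_(x : Fq) (z - iota x * u) ^- k = (z - z ^+ q / u ^+ q.-1) ^- k.
Proof.
move=> u0 /andP[k0 kq] zu.
pose ys := [seq iota x | x <- enum Fq].
have zys : z / u \notin ys.
  apply/negP => /mapP[x _ E]; have := zu x; by rewrite -E divfK ?eqxx.
have yu : uniq ys by rewrite map_inj_uniq ?enum_uniq // => x y /pemb_inj/polyC_inj.
have sy : (0 < size ys)%N by rewrite size_map -cardT card_Fq_gt0.
have Qf : 0 *: 'X^(q.+1) + -1 *: 'X^q + 1 *: 'X + 0%:P =
    -1 *: \prod_(y <- ys) ('X - y%:P) :> {poly C}.
  rewrite scale0r add0r scale1r polyC0 addr0 big_map big_enum /=.
  by rewrite prod_XsubC_iota !scaleN1r; ring.
have l0 : -1 != 0 :> C by rewrite oppr_eq0 oner_eq0.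
have d0 (y : C) : y \in ys -> 0 * y ^+ q + 1 != 0.
  by rewrite mul0r add0r oner_eq0.
have H := pure_partial_fractions_horner l0 Qf yu sy d0 k0 kq zys.
move: H; rewrite big_map big_enum /= => H.
transitivity (u ^- k * \sum_(x : Fq) ((0 * (iota x) ^+ q + 1)^-1 / (z / u - iota x)) ^+ k).
  rewrite mulr_sumr; apply: eq_bigr => x _.
  have h : z - iota x * u != 0 by rewrite subr_eq0.
  rewrite mul0r add0r invr1 mul1r -!exprVn -exprMn -invfM; congr (_^-1 ^+ _).
  by field.
rewrite H.
rewrite -!exprVn -exprMn -invfM; congr (_^-1 ^+ _).
rewrite !hornerE /= expr_div_n.
have -> : u ^+ q = u * u ^+ q.-1 by rewrite -exprS prednK ?card_Fq_gt0.
rewrite exprVn; field; by rewrite u0 expf_neq0.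
Qed.

Definition PN N z := \prod_(p <- polys N) (z - pC (n * p)).

Definition EN N z := z * \prod_(p <- polys N | p != 0) (1 - z / pC (n * p)).

Hypothesis n_neq0 : n != 0.

Lemma PN_SE N z : PN N.+1 z = \prod_(x : Fq) PN N (z - iota x * pC (n * 'X^N)).
Proof.
rewrite /PN big_polysS; apply: eq_bigr => x _; apply: eq_bigr => p _.
by rewrite !(rmorphM, rmorphD) /=; ring.
Qed.

Lemma PN_linear N : (forall z w, PN N (z - w) = PN N z - PN N w) /\
  (forall (x : Fq) z, PN N (iota x * z) = iota x * PN N z).
Proof.
elim: N => [|N [IHD IHZ]].
  by split=> *; rewrite /PN /= !big_seq1 mulr0 rmorph0 !subr0.
have S z : PN N.+1 z = PN N z ^+ q - PN N (pC (n * 'X^N)) ^+ q.-1 * PN N z.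
  by rewrite PN_SE -prod_subr_iotaM; apply: eq_bigr => x _; rewrite IHD IHZ.
split=> [z w|x z]; first by rewrite !S IHD frobB; ring.
by rewrite !S IHZ exprMn iota_expq; ring.
Qed.

Lemma PNB N z w : PN N (z - w) = PN N z - PN N w.
Proof. by case: (PN_linear N). Qed.

Lemma PNZ N (x : Fq) z : PN N (iota x * z) = iota x * PN N z.
Proof. by case: (PN_linear N). Qed.

Lemma PN_S N z : PN N.+1 z = PN N z ^+ q - PN N (pC (n * 'X^N)) ^+ q.-1 * PN N z.
Proof. by rewrite PN_SE -prod_subr_iotaM; apply: eq_bigr => x _; rewrite PNB PNZ. Qed.

Definition piN N := \prod_(p <- polys N | p != 0) (- pC (n * p)).

Lemma pC_nM_eq0 p : (pC (n * p) == 0) = (p == 0).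
Proof. by rewrite pemb_eq0 mulf_eq0 (negPf n_neq0). Qed.

Lemma piN_neq0 N : piN N != 0.
Proof. by rewrite prodf_seq_neq0; apply/allP => p _; rewrite oppr_eq0 pC_nM_eq0 implybb. Qed.

Lemma EN_PN N z : EN N z = PN N z / piN N.
Proof.
apply: (mulIf (piN_neq0 N)); rewrite divfK ?piN_neq0 // /EN /piN /PN.
rewrite (bigD1_seq 0) ?mem_polys ?size_poly0 ?uniq_polys //= mulr0 rmorph0 subr0.
rewrite -mulrA -big_split /=; congr (_ * _); apply: eq_bigr => p p0.
have := pC_nM_eq0 p; rewrite (negPf p0); move: (pC _) => v v0.
by field; rewrite v0.
Qed.

Lemma ENB N z w : EN N (z - w) = EN N z - EN N w.
Proof. by rewrite !EN_PN PNB mulrBl. Qed.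

Lemma ENZ N (x : Fq) z : EN N (iota x * z) = iota x * EN N z.
Proof. by rewrite !EN_PN PNZ mulrA. Qed.

Lemma EN_eq0 N z : (EN N z == 0) = has (fun p => z == pC (n * p)) (polys N).
Proof.
rewrite EN_PN mulf_eq0 invr_eq0 (negPf (piN_neq0 N)) orbF.
apply/idP/hasP => [|[p pN /eqP ->]]; last first.
  by rewrite /PN (big_rem p) //= subrr mul0r.
move=> h; apply/hasP; apply: contraLR h => /hasPn h.
by rewrite /PN prodf_seq_neq0; apply/allP => p /h; rewrite subr_eq0.
Qed.

Lemma EN_basis_neq0 N : EN N (pC (n * 'X^N)) != 0.
Proof.
rewrite EN_eq0; apply/hasPn => p; rewrite mem_polys => h.
apply/negP => /eqP/pemb_inj/(mulfI n_neq0) E.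
by rewrite -E size_polyXn ltnn in h.
Qed.

Lemma piN_S N : piN N.+1 = - PN N (pC (n * 'X^N)) ^+ q.-1 * piN N.
Proof.
rewrite /piN big_mkcond big_polysS (bigD1 0) //= mulrC; congr (_ * _); last first.
  rewrite [RHS]big_mkcond; apply: eq_bigr => p _; by rewrite polyC0 mul0r add0r.
rewrite -prod_iotaM_neq0; apply: eq_bigr => x x0.
rewrite -mulNr -rmorphN -polyCN -PNZ big_seq /PN [RHS]big_seq; apply: eq_bigr => p.
rewrite mem_polys => hp; case: eqP => [E|_].
  have /= := congr1 (fun P : {poly Fq} => P`_N) E.
  rewrite coefD mul_polyC coefZ coefXn eqxx mulr1 (nth_default 0 hp) addr0 coef0.
  by move=> E0; rewrite E0 eqxx in x0.
rewrite polyCN !(rmorphM, rmorphD, rmorphN) /=; ring.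
Qed.

Lemma EN_S N z :
  EN N.+1 z = EN N z - EN N z ^+ q / EN N (pC (n * 'X^N)) ^+ q.-1.
Proof.
have := EN_basis_neq0 N; rewrite !EN_PN piN_S PN_S mulf_eq0 => /norP[w0 _].
set u := PN N _ in w0 *; have pi0 := piN_neq0 N.
rewrite !expr_div_n.
have -> : piN N ^+ q = piN N * piN N ^+ q.-1 by rewrite -exprS prednK ?card_Fq_gt0.
by field; rewrite oppr_eq0 pi0 !expf_neq0.
Qed.

Lemma goss_EN k N z : (0 < k < q)%N -> (forall p, z != pC (n * p)) ->
  \sum_(p <- polys N) (z - pC (n * p)) ^- k = EN N z ^- k.
Proof.
move=> kq; elim: N z => [|N IH] z zp.
  rewrite /= big_seq1 /EN /= -big_filter /= eqxx big_nil.
  by rewrite mulr0 rmorph0 subr0 mulr1.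
rewrite big_polysS EN_S -goss_step //; first last.
- move=> x; rewrite -ENZ -subr_eq0 -ENB EN_eq0; apply/hasPn => p _.
  rewrite subr_eq addrC; have := zp (x%:P * 'X^N + p).
  by congr (_ != _); rewrite !(rmorphM, rmorphD) /=; ring.
- exact: EN_basis_neq0.
apply: eq_bigr => x _; rewrite -ENZ -ENB -IH.
  by apply: eq_bigr => p _; congr (_ ^- _); rewrite !(rmorphM, rmorphD) /=; ring.
move=> p; rewrite subr_eq addrC; have := zp (x%:P * 'X^N + p).
by congr (_ != _); rewrite !(rmorphM, rmorphD) /=; ring.
Qed.

Hypothesis n_size : (1 < size n)%N.

Lemma EN1_neq0 N : EN N 1 != 0.
Proof.
rewrite EN_eq0; apply/hasPn => p _; rewrite -(rmorph1 pC).
apply/negP => /eqP/pemb_inj E; have [p0|p0] := eqVneq p 0.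
  by move/eqP: E; rewrite p0 mulr0 oner_eq0.
have := congr1 (size : {poly Fq} -> nat) E; rewrite size_poly1 size_mul //.
move: n_size p0; rewrite -size_poly_gt0; case: (size n) => [|[|a]] //; case: (size p) => [|b] // _ _.
by rewrite addSn addnS.
Qed.

Definition ELam N z := EN N z - EN N z ^+ q / EN N 1 ^+ q.-1.

Lemma goss_ELam k N z : (0 < k < q)%N -> (forall p, z != pC p) ->
  \sum_(x : Fq) \sum_(p <- polys N) (z - iota x - pC (n * p)) ^- k = ELam N z ^- k.
Proof.
move=> kq zp; rewrite /ELam -goss_step //; last first.
- move=> x; rewrite -ENZ -subr_eq0 -ENB EN_eq0; apply/hasPn => p _.
  rewrite subr_eq addrC mulr1; have := zp (x%:P + n * p).
  by rewrite rmorphD.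
- exact: EN1_neq0.
apply: eq_bigr => x _; rewrite -ENZ -ENB -goss_EN ?mulr1 // => p.
by rewrite subr_eq addrC; have := zp (x%:P + n * p); rewrite rmorphD.
Qed.

End Lattice.

Section LatticeFunction.
Context {Fq : finFieldType} {R : realType} {C : valuedExt Fq R}.
Local Notation q := #|Fq|.
Local Notation pC := (pemb C).
Local Notation iota x := (pC x%:P).
Variable n : {poly Fq}.
Implicit Types (z w u : C) (p : {poly Fq}) (e : R).

Lemma lims_vabs_ge (u : nat -> C) l e : lims u l -> (forall m, e <= vabs (u m)) -> e <= vabs l.
Proof.
move=> H B; rewrite leNgt; apply/negP => h.
have e0 : 0 < e by apply: le_lt_trans h; apply: vabs_ge0.
have [N /(_ N (leqnn N)) HN] := H _ e0.
have := vabsD_lt HN h; rewrite subrK; apply/negP; rewrite -leNgt; exact: B.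
Qed.

Lemma lims_vabs_eq (u : nat -> C) l e : lims u l -> (forall m, vabs (u m) = e) -> vabs l = e.
Proof.
move=> H B; apply/eqP; rewrite eq_le (lims_vabs_le H) => [|m]; last by rewrite B.
by rewrite (lims_vabs_ge H) // => m; rewrite B.
Qed.

Lemma qexp_gt (K : R) : exists N, forall m, (N <= m)%N -> K < q%:R ^+ m.
Proof.
exists (Num.bound `|K|) => m hm; apply: le_lt_trans (ler_norm K) _.
apply: lt_trans (archi_boundP (normr_ge0 _)) _.
rewrite -natrX ltr_nat; apply: leq_ltn_trans hm _.
exact: ltn_expl (@card_Fq_gt1 Fq).
Qed.

Hypothesis n_size : (1 < size n)%N.

Lemma size_gt1_neq0 : n != 0.
Proof. by rewrite -size_poly_gt0; apply: ltnW. Qed.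
Hint Resolve size_gt1_neq0 : core.

Lemma size_nXn N p : p != 0 -> (size p = N.+1)%N -> size (n * p) = size (n * 'X^N).
Proof. by move=> p0 sp; rewrite size_mulXn // size_mul // sp addnS addnC. Qed.

Lemma vabs_basis N : vabs (pC (n * 'X^N)) = vabs (pC n) * q%:R ^+ N.
Proof. by rewrite rmorphM vabsM (vabs_pemb (p := 'X^N)) ?size_polyXn // monic_neq0 ?monicXn. Qed.

Lemma size_lead_add N (x : Fq) p : x != 0 -> (size p <= N)%N ->
  size (x%:P * 'X^N + p) = N.+1.
Proof.
by move=> x0 hp; rewrite mul_polyC size_polyDl size_scale ?size_polyXn.
Qed.

Lemma vabs_lead_add N (x : Fq) p : x != 0 -> p \in polys N ->
  vabs (pC (n * (x%:P * 'X^N + p))) = vabs (pC (n * 'X^N)).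
Proof.
move=> x0; rewrite mem_polys => hp.
have s := size_lead_add x0 hp.
have nz : x%:P * 'X^N + p != 0 by rewrite -size_poly_gt0 s.
have Xz : 'X^N != 0 :> {poly Fq} by rewrite monic_neq0 ?monicXn.
by rewrite !vabs_pemb ?(size_nXn nz s) // mulf_neq0 // size_gt1_neq0.
Qed.

Definition AN N z := \prod_(p <- polys N | p != 0) (1 - z / pC (n * p)).

Lemma AN_S N z : AN N.+1 z = AN N z *
  \prod_(x : Fq | x != 0) \prod_(p <- polys N) (1 - z / pC (n * (x%:P * 'X^N + p))).
Proof.
rewrite /AN [in LHS]big_mkcond big_polysS (bigD1 0) //=; congr (_ * _).
  rewrite [RHS]big_mkcond; apply: eq_bigr => p _; by rewrite polyC0 mul0r add0r.
apply: eq_bigr => x x0; rewrite big_seq [RHS]big_seq; apply: eq_bigr => p.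
by rewrite mem_polys => hp; rewrite -size_poly_gt0 size_lead_add.
Qed.

Lemma AN_stable N0 N z : (N0 <= N)%N -> vabs z < vabs (pC (n * 'X^N0)) ->
  vabs (AN N z) = vabs (AN N0 z).
Proof.
move=> h hz; elim: N h => [|N IH]; first by rewrite leqn0 => /eqP ->.
rewrite leq_eqVlt => /orP[/eqP -> //|h].
have hz' : vabs z < vabs (pC (n * 'X^N)).
  apply: lt_le_trans hz _; rewrite !vabs_basis ler_wpM2l ?vabs_ge0 //.
  by rewrite ler_weXn2l // ltW // qR_gt1.
have b0 : 0 < vabs (pC (n * 'X^N)) by apply: le_lt_trans hz'; apply: vabs_ge0.
rewrite AN_S vabsM IH // [X in _ * X](_ : _ = 1) ?mulr1 //.
rewrite vabs_prod big1 // => x x0.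
rewrite vabs_prod big1_seq // => p /andP[_ hp].
by rewrite vabsB_dom vabs1 // vabsM vabsV vabs_lead_add // ltr_pdivrMr // mul1r.
Qed.

Hypothesis Ccomplete : vcomplete C.

Lemma AN_cvg z : exists l, lims (AN^~ z) l.
Proof.
apply: cauchy_lims => // e e0.
have n0 : 0 < vabs (pC n) by rewrite vabs_gt0 pemb_eq0.
have [N0 HN0] := qexp_gt (vabs z / vabs (pC n)).
have hz m : (N0 <= m)%N -> vabs z < vabs (pC (n * 'X^m)).
  by move=> /HN0; rewrite ltr_pdivrMr // vabs_basis mulrC.
pose B := vabs (AN N0 z) + 1.
have B0 : 0 < B by rewrite /B ltr_wpDl // vabs_ge0.
pose d := Num.min 1 (e / B).
have d0 : 0 < d by rewrite lt_min ltr01 divr_gt0.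
have [N1 HN1] := qexp_gt (vabs z / d / vabs (pC n)).
exists (maxn N0 N1) => m; rewrite geq_max => /andP[h0 h1].
rewrite AN_S; set P := \prod_(_ | _) _.
have hP : vabs (P - 1) < d.
  apply: vabs_prod_sub1 => //; first by rewrite ge_min lexx.
  move=> x _ x0; apply: vabs_prod_sub1 => //; first by rewrite ge_min lexx.
  move=> p hp _; rewrite addrAC subrr add0r vabsN vabsM vabsV vabs_lead_add //.
  rewrite ltr_pdivrMr; last by apply: le_lt_trans (hz _ h0); apply: vabs_ge0.
  by have := HN1 _ h1; rewrite ltr_pdivrMr // ltr_pdivrMr // vabs_basis; congr (_ < _); ring.
rewrite (_ : _ - _ = AN m z * (P - 1)); last by ring.
rewrite vabsM (AN_stable h0 (hz _ (leqnn _))).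
have : vabs (AN N0 z) * vabs (P - 1) <= B * vabs (P - 1).
  by rewrite ler_wpM2r ?vabs_ge0 // lerDl.
move/le_lt_trans; apply; rewrite mulrC -ltr_pdivlMr //.
by apply: lt_le_trans hP _; rewrite ge_min lexx orbT.
Qed.

Lemma EN_lims z : lims (EN n ^~ z) (e_lat n z).
Proof.
have [l hl] := AN_cvg z.
rewrite /e_lat; set P := vprod _ _.
suff -> : P = l by exact: limsZ.
apply: vprod_hasprod.
pose s N := [seq n * p | p <- polys N & p != 0 :> {poly Fq}].
apply: (@hasprod_exhaust _ _ _ _ _ _ s).
- move=> e e0; have n0 : 0 < vabs (pC n) by rewrite vabs_gt0 pemb_eq0.
  have [N HN] := qexp_gt (vabs z / e).
  exists [fset b in polys N.+1]%fset => b; rewrite !inE mem_polys -ltnNge => /andP[b0 _] sb.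
  rewrite addrAC subrr add0r vabsN vabsM vabsV ltr_pdivrMr ?vabs_gt0 ?pemb_eq0 //.
  rewrite mulrC -ltr_pdivrMr // vabs_pemb //; apply: HN.
  by case: (size b) sb => // m; rewrite ltnS => /ltnW.
- split.
  + move=> m; rewrite map_inj_uniq ?filter_uniq ?uniq_polys //.
    by move=> x y /(mulfI size_gt1_neq0).
  + move=> m b /mapP[p]; rewrite mem_filter => /andP[p0 _] ->.
    by rewrite inE mulf_neq0 //= dvdp_mulIl.
  + move=> b; rewrite inE => /andP[b0 /dvdpP[p E]].
    exists (size p) => m hm; rewrite E mulrC; apply: map_f.
    rewrite mem_filter mem_polys hm andbT; apply: contraNneq b0 => p0.
    by rewrite E p0 mul0r.
- by apply: lims_ext hl => m; rewrite big_map big_filter.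
Qed.

Lemma e_latB z w : e_lat n (z - w) = e_lat n z - e_lat n w.
Proof.
apply: lims_unique (EN_lims _) _.
apply: lims_ext (limsB (EN_lims z) (EN_lims w)) => m; by rewrite ENB.
Qed.

Lemma vabs_EN_small N z : vabs z < vabs (pC n) -> vabs (EN n N z) = vabs z.
Proof.
move=> h; have h0 : vabs z < vabs (pC (n * 'X^0)) by rewrite expr0 mulr1.
rewrite -[EN n N z]/(z * AN N z) vabsM (AN_stable (leq0n N) h0).
by rewrite /AN /= -big_filter /= eqxx big_nil vabs1 mulr1.
Qed.

Lemma vabs_e_lat_small z : vabs z < vabs (pC n) -> vabs (e_lat n z) = vabs z.
Proof. by move=> h; apply: lims_vabs_eq (EN_lims z) _ => N; apply: vabs_EN_small. Qed.

Lemma vabs_n_gt1 : 1 < vabs (pC n).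
Proof.
rewrite -(@vabs1 _ _ C) -(rmorph1 pC); apply: vabs_pemb_lt => //; by rewrite size_poly1.
Qed.

Lemma vabs_e_lat1 : vabs (e_lat n (1 : C)) = 1.
Proof. by rewrite vabs_e_lat_small vabs1 ?vabs_n_gt1. Qed.

Lemma e_lat1_neq0 : e_lat n (1 : C) != 0.
Proof. by rewrite -vabs_gt0 vabs_e_lat1. Qed.

Definition eLam z := e_lat n z - e_lat n z ^+ q / e_lat n 1 ^+ q.-1.

Lemma ELam_lims z : lims (ELam n ^~ z) (eLam z).
Proof.
apply: limsB (EN_lims z) _; apply: limsM; first exact/limsX/EN_lims.
by apply: limsV; [exact/limsX/EN_lims|rewrite expf_neq0 // e_lat1_neq0].
Qed.

Lemma eLamB z w : eLam (z - w) = eLam z - eLam w.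
Proof. by rewrite /eLam e_latB frobB; ring. Qed.

Definition far (M : R) z := forall x : ratfun Fq, M <= vabs (z - vemb C x).

Lemma far_pC M z p : far M z -> M <= vabs (z - pC p).
Proof. exact. Qed.

Lemma far_neq M z p : 0 < M -> far M z -> z != pC p.
Proof. by move=> M0 /far_pC => /(_ p) h; rewrite -subr_eq0 -vabs_gt0; apply: lt_le_trans h. Qed.

Lemma farB M z (x : ratfun Fq) : far M z -> far M (z - vemb C x).
Proof.
move=> h y; have := h (x + y); rewrite rmorphD; congr (_ <= vabs _); ring.
Qed.

Lemma vabs_inv_le (M : R) z : 0 < M -> M <= vabs z -> vabs z^-1 <= M^-1.
Proof. by move=> M0 h; rewrite vabsV lef_pV2 ?posrE // (lt_le_trans M0). Qed.

Lemma vabs_ge_of_inv (M : R) z : 0 < M -> z != 0 -> vabs z^-1 <= M^-1 -> M <= vabs z.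
Proof. by move=> M0 z0; rewrite vabsV lef_pV2 ?posrE // vabs_gt0. Qed.

Lemma far_EN M N z : 0 < M -> far M z -> M <= vabs (EN n N z).
Proof.
move=> M0 fz; have [e0|e0] := eqVneq (EN n N z) 0.
  move/eqP: e0; rewrite EN_eq0 // => /hasP[p _ /eqP E].
  by move: (far_neq (n * p) M0 fz); rewrite E eqxx.
apply: vabs_ge_of_inv => //; rewrite -[EN n N z]expr1 -goss_EN //; last first.
- by move=> p; apply: far_neq fz.
- by rewrite card_Fq_gt1.
apply: vabs_sum_le => [|p _ _]; first by rewrite invr_ge0 ltW.
by rewrite expr1; apply: vabs_inv_le => //; apply: fz.
Qed.

Lemma ELam_neq0 N z : (forall p, z != pC p) -> ELam n N z != 0.
Proof.
move=> zp; have EN0 p : EN n N (z - pC p) != 0.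
  rewrite EN_eq0 //; apply/hasPn => p' _; rewrite subr_eq -rmorphD; exact: zp.
have e1 : EN n N 1 != 0 :> C by apply: EN1_neq0.
have /negP h : ~ EN n N z ^+ q == EN n N 1 ^+ q.-1 * EN n N z.
  rewrite -subr_eq0 -prod_subr_iotaM; apply/negP/prodf_neq0 => x _.
  by rewrite -ENZ // -ENB // mulr1; apply: EN0.
apply: contra h; rewrite /ELam subr_eq0 => /eqP E.
by rewrite [X in _ == _ * X]E mulrC divfK // expf_neq0.
Qed.

Lemma far_ELam M N z : 0 < M -> far M z -> M <= vabs (ELam n N z).
Proof.
move=> M0 fz; have zp p : z != pC p by apply: far_neq fz.
apply: vabs_ge_of_inv => //; first exact: ELam_neq0.
rewrite -[ELam n N z]expr1 -goss_ELam //; last by rewrite card_Fq_gt1.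
have M1 : 0 <= M^-1 by rewrite invr_ge0 ltW.
apply: vabs_sum_le => // x _ _; apply: vabs_sum_le => // p _ _.
rewrite expr1; apply: vabs_inv_le => //; rewrite -addrA -opprD -rmorphD; exact: fz.
Qed.

Lemma far_e_lat M z : 0 < M -> far M z -> M <= vabs (e_lat n z).
Proof. by move=> M0 fz; apply: lims_vabs_ge (EN_lims z) _ => N; apply: far_EN. Qed.

Lemma far_eLam M z : 0 < M -> far M z -> M <= vabs (eLam z).
Proof. by move=> M0 fz; apply: lims_vabs_ge (ELam_lims z) _ => N; apply: far_ELam. Qed.

End LatticeFunction.

(** * The group and the terms of the series *)

Lemma big_option (T : Type) (idx : T) (op : Monoid.com_law idx) (J : finType) (F : option J -> T) :
  \big[op/idx]_(o : option J) F o = op (F None) (\big[op/idx]_(x : J) F (Some x)).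
Proof.
rewrite (bigD1 None) //=; congr (op _ _).
rewrite (reindex_omap Some id) => [|[x|]] //=.
by apply: eq_bigl => x; rewrite eqxx.
Qed.

Lemma sum_ord2 (V : nmodType) (F : 'I_2 -> V) : \sum_(i < 2) F i = F 0 + F 1.
Proof. by rewrite !big_ord_recl big_ord0 addr0; congr (_ + F _); apply/val_inj. Qed.

Lemma det_mx2 (L : comNzRingType) (M : 'M[L]_2) : \det M = M 0 0 * M 1 1 - M 0 1 * M 1 0.
Proof.
rewrite (expand_det_row _ 0) sum_ord2 /cofactor !det_mx11 !mxE /=.
rewrite !expr0 !expr1 mul1r mulN1r mulrN.
by congr (M 0 0 * M _ _ - M 0 1 * M _ _); apply/val_inj.
Qed.

Lemma ord2P (P : 'I_2 -> Prop) : P 0 -> P 1 -> forall i, P i.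
Proof.
move=> P0 P1 [[|[|//]] h]; first by rewrite (_ : Ordinal h = 0) //; apply/val_inj.
by rewrite (_ : Ordinal h = 1) //; apply/val_inj.
Qed.

Lemma mx2_eq (L : Type) (M M' : 'M[L]_2) : M 0 0 = M' 0 0 -> M 0 1 = M' 0 1 ->
  M 1 0 = M' 1 0 -> M 1 1 = M' 1 1 -> M = M'.
Proof. by move=> *; apply/matrixP; apply: ord2P; apply: ord2P. Qed.

Section Gamma.
Context {Fq : finFieldType} (n : {poly Fq}).
Hypothesis n_size : (1 < size n)%N.

Lemma GammaP (M : 'M[{poly Fq}]_2) : reflect
  [/\ M 0 0 * M 1 1 - M 0 1 * M 1 0 = 1, (n %| M 0 0 - 1)%R, (n %| M 0 1)%R,
      (n %| M 1 0)%R & (n %| M 1 1 - 1)%R] (M \in Gamma n).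
Proof.
rewrite -det_mx2; apply: (iffP andP) => [[uM /forallP H]|[dM h00 h01 h10 h11]].
  have {}H i j : (n %| M i j - (i == j)%:R)%R by have /forallP/(_ j) := H i; rewrite !mxE.
  have h00 := H 0 0; have h01 := H 0 1; have h10 := H 1 0; have h11 := H 1 1.
  rewrite /= ?subr0 ?mulr1n in h00 h01 h10 h11.
  split=> //.
  move: uM; rewrite unitmxE poly_unitE => /andP[/size_poly1P[c c0 dM] _].
  have d1 : (n %| c%:P - 1)%R.
    rewrite -dM det_mx2.
    have -> : M 0 0 * M 1 1 - M 0 1 * M 1 0 - 1 =
      (M 0 0 - 1) * M 1 1 + (M 1 1 - 1) - M 0 1 * M 1 0 by ring.
    apply: dvdp_add; last by rewrite dvdpNr; apply: dvdp_mulr.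
    by apply: dvdp_add => //; apply: dvdp_mulr.
  rewrite dM; apply/eqP; rewrite -subr_eq0; apply/negPn/negP => h.
  have := dvdp_leq h d1; rewrite leqNgt; apply/negP/negPn.
  by apply: leq_ltn_trans n_size; rewrite -polyC1 -polyCB size_polyC leq_b1.
split; first by rewrite unitmxE dM unitr1.
apply/forallP => i; apply/forallP => j; rewrite !mxE; move: i j.
by do 2!apply: ord2P; rewrite /= ?subr0 ?mulr1n.
Qed.

End Gamma.

Section Terms.
Context {Fq : finFieldType} {R : realType} {C : valuedExt Fq R}.
Local Notation q := #|Fq|.
Local Notation pC := (pemb C).
Local Notation iota x := (pC x%:P).
Implicit Types (z : C) (M : 'M[{poly Fq}]_2).

Definition lin1 M z := pC (M 0 0) - pC (M 1 0) * z.
Definition lin2 M z := pC (M 1 1) * z - pC (M 0 1).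

Definition cusp_lin M z (o : option Fq) : C :=
  if o is Some x then lin2 M z - iota x * lin1 M z else lin1 M z.

Definition QM M z := lin1 M z * lin2 M z ^+ q - lin1 M z ^+ q * lin2 M z.

Lemma QM_prod M z : QM M z = \prod_(o : option Fq) cusp_lin M z o.
Proof.
rewrite big_option /= prod_subr_iotaM mulrBr mulrA -exprS prednK ?card_Fq_gt0 //.
Qed.

Definition cusp_diff (o o' : option Fq) : Fq :=
  match o, o' with
  | Some x, Some y => y - x
  | None, Some _ => 1
  | Some _, None => -1
  | None, None => 0
  end.

Lemma inv_sub_cusp M z (o : option Fq) : cusp_lin M z o != 0 ->
  inv_sub z (actF M (pt_cst o)) =
  (if o is Some x then pC (M 1 0) * iota x + pC (M 1 1) else - pC (M 1 0)) / cusp_lin M z o.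
Proof.
have vE (p : {poly Fq}) : vemb C (polyF p) = pC p by [].
case: o => [x|] /= ; rewrite /actF /moebius /= !mxE ?mulr1 ?mulr0 ?addr0.
  have E : vemb C (polyF (M 1 0) * cstF x + polyF (M 1 1)) = pC (M 1 0) * iota x + pC (M 1 1).
    by rewrite rmorphD rmorphM.
  move=> L; case: ifPn => [/eqP h|h] /=.
    by rewrite -E h rmorph0 mul0r.
  have d0 : pC (M 1 0) * iota x + pC (M 1 1) != 0 by rewrite -E fmorph_eq0.
  rewrite rmorphM fmorphV E rmorphD rmorphM /= !vE.
  rewrite -[RHS]invrK invfM invrK; congr (_^-1).
  by rewrite /lin1 /lin2; field.
move=> L; case: ifPn => [/eqP h|h] /=.
  by rewrite /pemb h rmorph0 oppr0 mul0r.
have d0 : pC (M 1 0) != 0 by rewrite /pemb fmorph_eq0.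
rewrite rmorphM fmorphV /= !vE -[RHS]invrK invfM invrK; congr (_^-1).
by rewrite /lin1; field; rewrite oppr_eq0 d0.
Qed.

Lemma u_fun_cusp M z (o o' : option Fq) : \det M = 1 ->
  cusp_lin M z o != 0 -> cusp_lin M z o' != 0 ->
  u_fun z (actF M (pt_cst o)) (actF M (pt_cst o')) =
  iota (cusp_diff o o') / (cusp_lin M z o * cusp_lin M z o').
Proof.
rewrite det_mx2 => /(congr1 pC); rewrite rmorphB !rmorphM rmorph1 => d1 h h'.
rewrite /u_fun !inv_sub_cusp //.
transitivity ((pC (M 0 0) * pC (M 1 1) - pC (M 0 1) * pC (M 1 0)) *
  iota (cusp_diff o o') / (cusp_lin M z o * cusp_lin M z o')); last by rewrite d1 mul1r.
case: o h => [x|] h; case: o' h' => [y|] h' /=.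
- rewrite polyCB rmorphB; move: h h'; rewrite /= /lin1 /lin2.
  move: (pC (M 0 0)) (pC (M 0 1)) (pC (M 1 0)) (pC (M 1 1)) (iota x) (iota y) => a b c d X Y h h'.
  by field; rewrite h h'.
- rewrite polyCN polyC1 rmorphN rmorph1; move: h h'; rewrite /= /lin1 /lin2.
  move: (pC (M 0 0)) (pC (M 0 1)) (pC (M 1 0)) (pC (M 1 1)) (iota x) => a b c d X h h'.
  by field; rewrite h h'.
- rewrite polyC1 rmorph1; move: h h'; rewrite /= /lin1 /lin2.
  move: (pC (M 0 0)) (pC (M 0 1)) (pC (M 1 0)) (pC (M 1 1)) (iota y) => a b c d X h h'.
  by field; rewrite h h'.
- by rewrite polyC0 rmorph0 mulr0 mul0r subrr.
Qed.

Section PairProduct.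
Context (r : nat) (a b : 'I_r -> option Fq).
Hypothesis hab : pair_decomposition a b.

Lemma pair_prod (T : comNzRingType) (F : option Fq -> T) :
  \prod_(i < r) (F (a i) * F (b i)) = \prod_(o : option Fq) F o.
Proof.
case: hab => ne ex.
transitivity (\prod_(i < r) \prod_(o : option Fq | (o == a i) || (o == b i)) F o).
  apply: eq_bigr => i _; rewrite (bigD1 (a i)) ?eqxx //=; congr (_ * _).
  rewrite (big_pred1 (b i)) // => o /=.
  have [->|] := eqVneq o (a i); last by rewrite andbT.
  by rewrite andbF; apply/esym/negbTE/eqP/ne.
rewrite (exchange_big_dep predT) //=; apply: eq_bigr => o _.
have [i [hi ui]] := ex o; rewrite (big_pred1 i) // => j /=.
apply/idP/eqP => [/orP[/eqP|/eqP] h|->].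
- by rewrite (ui j) //; left.
- by rewrite (ui j) //; right.
- by case: hi => ->; rewrite eqxx ?orbT.
Qed.

Lemma prod_cusp_diff : \prod_(i < r) cusp_diff (a i) (b i) = oo_sign b * C0 a b.
Proof.
case: hab => ne ex.
have E : \prod_(i < r) (if b i == None then -1 else 1) = oo_sign b.
  rewrite /oo_sign; case: existsP => [[i /eqP bi]|h].
    rewrite (bigD1 i) //= bi eqxx big1 ?mulr1 // => j ji.
    case: eqP => // bj; have [k [_ uk]] := ex None.
    by rewrite -(uk i (or_intror (esym bi))) -(uk j (or_intror (esym bj))) eqxx in ji.
  rewrite expr0 big1 // => i _; case: eqP => // bi; case: h; exists i; exact/eqP.
rewrite -E /C0 [X in _ * X]big_mkcond -big_split /=; apply: eq_bigr => i _.
by case: (a i) (b i) (ne i) => [x|] [y|] //= _; rewrite ?mul1r ?mulr1.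
Qed.

Lemma C0_neq0 : oo_sign b * C0 a b != 0.
Proof.
case: hab => ne ex.
rewrite -prod_cusp_diff; apply/prodf_neq0 => i _.
case: (a i) (b i) (ne i) => [x|] [y|] //= h; rewrite ?oppr_eq0 ?oner_eq0 //.
by rewrite subr_eq0; apply/eqP => E; apply: h; rewrite E.
Qed.

Lemma prod_u_fun M z : \det M = 1 -> (forall o, cusp_lin M z o != 0) ->
  \prod_(i < r) u_fun z (actF M (pt_cst (a i))) (actF M (pt_cst (b i))) =
  iota (oo_sign b * C0 a b) / QM M z.
Proof.
move=> d1 L; under eq_bigr => i _ do rewrite u_fun_cusp //.
by rewrite big_split /= prodfV pair_prod -QM_prod -!rmorph_prod prod_cusp_diff.
Qed.

End PairProduct.

Lemma lin_neq0 (p p' : {poly Fq}) z : (forall x, z != vemb C x) ->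
  (p != 0) || (p' != 0) -> pC p * z - pC p' != 0.
Proof.
move=> hz; have [->|p0 _] := eqVneq p 0.
  by rewrite /= rmorph0 mul0r sub0r oppr_eq0 pemb_eq0.
apply: contra (hz (polyF p' / polyF p)); rewrite subr_eq0 => /eqP E.
rewrite rmorphM fmorphV /= -[vemb C (polyF p')]/(pC p') -[vemb C (polyF p)]/(pC p) -E.
by rewrite mulrAC mulfV ?mul1r // pemb_eq0.
Qed.

Lemma vabs_lin_ge (p p' : {poly Fq}) z (N : R) : 1 <= N -> far N z ->
  (p != 0) || (p' != 0) -> 1 <= vabs (pC p * z - pC p') /\ vabs (pC p) <= vabs (pC p * z - pC p').
Proof.
move=> N1 hz; have [->|p0 _] := eqVneq p 0.
  rewrite /= rmorph0 mul0r sub0r vabsN vabs0 => p'0.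
  by split; [apply: vabs_pemb_ge1|apply: vabs_ge0].
have pC0 : pC p != 0 by rewrite pemb_eq0.
have E : pC p * z - pC p' = pC p * (z - vemb C (polyF p' / polyF p)).
  rewrite rmorphM fmorphV /= -[vemb C (polyF p')]/(pC p') -[vemb C (polyF p)]/(pC p).
  by field.
have p1 := vabs_pemb_ge1 (C := C) p0.
have z1 : 1 <= vabs (z - vemb C (polyF p' / polyF p)) by apply: le_trans N1 (hz _).
rewrite E vabsM; split; first by rewrite mulr_ege1.
by rewrite ler_peMr // vabs_ge0.
Qed.

Lemma cusp_linE M z (o : option Fq) : cusp_lin M z o = if o is Some x then
  pC (M 1 1 + x%:P * M 1 0) * z - pC (M 0 1 + x%:P * M 0 0)
  else - (pC (M 1 0) * z - pC (M 0 0)).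
Proof.
case: o => [x|] /=; rewrite /lin1 /lin2 ?(rmorphD, rmorphM) /=; ring.
Qed.

Lemma cusp_coef_neq0 M (o : option Fq) : \det M = 1 -> if o is Some x then
   (M 1 1 + x%:P * M 1 0 != 0) || (M 0 1 + x%:P * M 0 0 != 0)
   else (M 1 0 != 0) || (M 0 0 != 0).
Proof.
rewrite det_mx2; case: o => [x|] d1; rewrite -negb_and; apply/negP => /andP[/eqP h /eqP h'];
  move/eqP: d1; rewrite eq_sym.
  have -> : M 0 0 * M 1 1 - M 0 1 * M 1 0 =
    M 0 0 * (M 1 1 + x%:P * M 1 0) - M 1 0 * (M 0 1 + x%:P * M 0 0) by ring.
  by rewrite h h' !mulr0 subrr oner_eq0.
by rewrite h h' mulr0 mul0r subrr oner_eq0.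
Qed.

Lemma cusp_lin_neq0 M z o : \det M = 1 -> (forall x, z != vemb C x) -> cusp_lin M z o != 0.
Proof.
move=> d1 hz; have := cusp_coef_neq0 o d1; rewrite cusp_linE.
by case: o => [x|] h; rewrite ?oppr_eq0; apply: lin_neq0.
Qed.

Lemma QM_neq0 M z : \det M = 1 -> (forall x, z != vemb C x) -> QM M z != 0.
Proof. by move=> d1 hz; rewrite QM_prod; apply/prodf_neq0 => o _; apply: cusp_lin_neq0. Qed.

Lemma vabs_cusp_lin_ge1 M z (N : R) o : \det M = 1 -> 1 <= N -> far N z ->
  1 <= vabs (cusp_lin M z o).
Proof.
move=> d1 N1 hz; have := cusp_coef_neq0 o d1; rewrite cusp_linE.
by case: o => [x|] /(vabs_lin_ge N1 hz)[]; rewrite ?vabsN.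
Qed.

Lemma vabs_QM_ge_cusp M z (N : R) o : \det M = 1 -> 1 <= N -> far N z ->
  vabs (cusp_lin M z o) <= vabs (QM M z).
Proof.
move=> d1 N1 hz; rewrite QM_prod (bigD1 o) //= vabsM ler_peMr ?vabs_ge0 //.
rewrite vabs_prod; elim/big_ind: _ => // [x y|o' _]; first exact: mulr_ege1.
exact: vabs_cusp_lin_ge1 hz.
Qed.

Lemma vabs_QM_ge1 M z (N : R) : \det M = 1 -> 1 <= N -> far N z -> 1 <= vabs (QM M z).
Proof.
move=> d1 N1 hz; apply: le_trans (vabs_QM_ge_cusp None d1 N1 hz).
exact: vabs_cusp_lin_ge1 hz.
Qed.

Lemma vabs_QM_ge_row M z (N : R) : \det M = 1 -> 1 <= N -> far N z ->
  vabs (pC (M 1 0)) <= vabs (QM M z) /\ vabs (pC (M 1 1)) <= vabs (QM M z).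
Proof.
move=> d1 N1 hz; split.
  apply: le_trans (vabs_QM_ge_cusp None d1 N1 hz); rewrite cusp_linE vabsN.
  by have /(vabs_lin_ge N1 hz)[] := cusp_coef_neq0 None d1.
apply: le_trans (vabs_QM_ge_cusp (Some 0) d1 N1 hz); rewrite cusp_linE.
have /(vabs_lin_ge N1 hz)[_] := cusp_coef_neq0 (Some 0) d1.
by rewrite polyC0 mul0r addr0.
Qed.

Lemma QM_entries_le M z (N B : R) : \det M = 1 -> 1 <= N -> far N z -> vabs (QM M z) <= B ->
  forall i j, vabs (pC (M i j)) <= B * (1 + vabs z).
Proof.
move=> d1 N1 hz hB.
have [h10 h11] := vabs_QM_ge_row d1 N1 hz.
have B0 : 0 <= B by apply: le_trans hB; apply: vabs_ge0.
have z0 := vabs_ge0 z.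
have BB : B <= B * (1 + vabs z) by rewrite ler_peMr // lerDl.
have Bz y : vabs y <= B -> vabs (y * z) <= B * (1 + vabs z).
  by move=> hy; rewrite vabsM ler_pM ?vabs_ge0 // lerDr.
apply: ord2P; apply: ord2P; try by apply: le_trans BB; apply: le_trans hB.
  have -> : pC (M 0 0) = pC (M 1 0) * z + cusp_lin M z None by rewrite /= /lin1; ring.
  apply: vabsD_le; first by apply: Bz; apply: le_trans hB.
  by apply: le_trans BB; apply: le_trans hB; apply: vabs_QM_ge_cusp hz.
have -> : pC (M 0 1) = pC (M 1 1) * z - cusp_lin M z (Some 0).
  by rewrite /= /lin2 polyC0 rmorph0; ring.
apply: vabsB_le; first by apply: Bz; apply: le_trans hB.
by apply: le_trans BB; apply: le_trans hB; apply: vabs_QM_ge_cusp hz.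
Qed.

End Terms.

Section Conjugation.
Context {Fq : finFieldType} {R : realType} {C : valuedExt Fq R}.
Local Notation q := #|Fq|.
Local Notation pC := (pemb C).
Local Notation iota x := (pC x%:P).
Implicit Types (z : C) (M : 'M[{poly Fq}]_2).

Definition mx2 (a b c d : {poly Fq}) : 'M[{poly Fq}]_2 :=
  \matrix_(i < 2, j < 2) if i == 0 then (if j == 0 then a else b) else (if j == 0 then c else d).

Lemma mx2E a b c d : (mx2 a b c d 0 0 = a) * (mx2 a b c d 0 1 = b) *
  (mx2 a b c d 1 0 = c) * (mx2 a b c d 1 1 = d).
Proof. by rewrite !mxE. Qed.

(* The matrix of (translation by v) M (translation by -x). *)
Definition conj_trans M (v : {poly Fq}) (x : Fq) :=
  mx2 (M 0 0 + v * M 1 0) (M 0 1 - x%:P * M 0 0 + v * (M 1 1 - x%:P * M 1 0))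
      (M 1 0) (M 1 1 - x%:P * M 1 0).

Lemma QM_conj_trans M v x z : QM (conj_trans M v x) z = QM M (z - pC v).
Proof.
have E1 : lin1 (conj_trans M v x) z = lin1 M (z - pC v).
  by rewrite /lin1 !mx2E rmorphD rmorphM /=; ring.
have E2 : lin2 (conj_trans M v x) z = lin2 M (z - pC v) + iota x * lin1 M (z - pC v).
  by rewrite /lin1 /lin2 !mx2E !(rmorphD, rmorphB, rmorphM) /=; ring.
by rewrite /QM E1 E2 frobD exprMn iota_expq; ring.
Qed.

Variable nu : 'M[Fq]_2.
Hypothesis nu_unit : nu \in unitmx.

Let N := map_mx polyC nu.

Definition conj_mx M := invmx N *m M *m N.
Definition conj_mx_inv M := N *m M *m invmx N.

Lemma polyC_mx_unit : N \in unitmx.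
Proof. by rewrite unitmxE det_map_mx rmorph_unit // -unitmxE. Qed.

Lemma conj_mxK : cancel conj_mx conj_mx_inv.
Proof.
move=> M; rewrite /conj_mx /conj_mx_inv !mulmxA mulmxV ?polyC_mx_unit // mul1mx.
by rewrite -mulmxA mulmxV ?polyC_mx_unit // mulmx1.
Qed.

Lemma conj_mx_invK : cancel conj_mx_inv conj_mx.
Proof.
move=> M; rewrite /conj_mx /conj_mx_inv !mulmxA mulVmx ?polyC_mx_unit // mul1mx.
by rewrite -mulmxA mulVmx ?polyC_mx_unit // mulmx1.
Qed.

Lemma dvd_mulmx n (A B : 'M[{poly Fq}]_2) :
  (forall i j, (n %| A i j)%R) -> forall i j, (n %| (A *m B) i j)%R /\ (n %| (B *m A) i j)%R.
Proof.
by move=> H i j; rewrite !mxE; split; rewrite sum_ord2; apply: dvdp_add;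
  (exact: dvdp_mulr || exact: dvdp_mull).
Qed.

Lemma conj_mx_Gamma n M : (conj_mx M \in Gamma n) = (M \in Gamma n).
Proof.
have F (P Q : 'M[{poly Fq}]_2) : Q *m P = 1%:M -> P *m Q = 1%:M -> P \in unitmx -> Q \in unitmx ->
    forall M, M \in Gamma n -> Q *m M *m P \in Gamma n.
  move=> QP PQ uP uQ X /andP[uX /forallP H]; apply/andP; split.
    by rewrite !unitmx_mul uP uQ uX.
  apply/forallP => i; apply/forallP => j.
  have -> : Q *m X *m P - 1%:M = Q *m (X - 1%:M) *m P.
    by rewrite mulmxBr mulmxBl mulmx1 QP.
  apply: (proj1 (dvd_mulmx _ _ i j)) => {}i {}j; apply: (proj2 (dvd_mulmx _ _ i j)) => {}i {}j.
  by have /forallP := H i.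
apply/idP/idP => h; last by apply: F h; rewrite ?mulVmx ?mulmxV ?unitmx_inv ?polyC_mx_unit.
by rewrite -[M]conj_mxK; apply: F h; rewrite ?mulVmx ?mulmxV ?unitmx_inv ?polyC_mx_unit.
Qed.

Local Notation nuC i j := (iota (nu i j)).

Lemma QM_conj M z : nuC 1 0 * z + nuC 1 1 != 0 ->
  (nuC 1 0 * z + nuC 1 1) ^+ q.+1 * QM M ((nuC 0 0 * z + nuC 0 1) / (nuC 1 0 * z + nuC 1 1)) =
  iota (\det nu) * QM (conj_mx M) z.
Proof.
set J := _ + nuC 1 1 => J0; set z' := _ / J; set M' := conj_mx M.
have NM : M *m N = N *m M' by rewrite /M' /conj_mx !mulmxA mulmxV ?polyC_mx_unit // mul1mx.
pose t := pC (M 0 0) + pC (M 1 1) - pC (M' 0 0) - pC (M' 1 1).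
have T : t = 0.
  rewrite /t.
  have : \tr M' = \tr M by rewrite /M' /conj_mx mxtrace_mulC mulmxA mulmxV ?polyC_mx_unit // mul1mx.
  rewrite /mxtrace !sum_ord2 => /(congr1 pC); rewrite !rmorphD => h.
  transitivity (pC (M 0 0) + pC (M 1 1) - (pC (M' 0 0) + pC (M' 1 1))); first by ring.
  by rewrite h subrr.
move: @t T; clearbody M' => t T.
pose e i j := pC (M i 0) * nuC 0 j + pC (M i 1) * nuC 1 j
    - (nuC i 0 * pC (M' 0 j) + nuC i 1 * pC (M' 1 j)).
have E i j : e i j = 0.
  rewrite /e.
  have := congr1 (fun X : 'M_2 => pC (X i j)) NM.
  by rewrite !mxE !sum_ord2 !mxE !(rmorphD, rmorphM) /= => ->; rewrite subrr.
have L2 : J * lin2 M z' = nuC 0 0 * lin2 M' z + nuC 0 1 * lin1 M' z.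
  have -> : J * lin2 M z' = pC (M 1 1) * (nuC 0 0 * z + nuC 0 1) - pC (M 0 1) * J.
    by rewrite /lin2 /z'; field.
  apply/eqP; rewrite -subr_eq0; apply/eqP.
  transitivity ((t * nuC 0 0 - e 0 0) * z + (t * nuC 0 1 - e 0 1)).
    by rewrite /t /e /lin1 /lin2 /J; ring.
  by rewrite T !E; ring.
have L1 : J * lin1 M z' = nuC 1 0 * lin2 M' z + nuC 1 1 * lin1 M' z.
  have -> : J * lin1 M z' = pC (M 0 0) * J - pC (M 1 0) * (nuC 0 0 * z + nuC 0 1).
    by rewrite /lin1 /z'; field.
  apply/eqP; rewrite -subr_eq0; apply/eqP.
  transitivity ((t * nuC 1 0 - e 1 0) * z + (t * nuC 1 1 - e 1 1)).
    by rewrite /t /e /lin1 /lin2 /J; ring.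
  by rewrite T !E; ring.
have -> : J ^+ q.+1 * QM M z' =
    (J * lin1 M z') * (J * lin2 M z') ^+ q - (J * lin1 M z') ^+ q * (J * lin2 M z').
  by rewrite /QM !exprMn exprS; ring.
rewrite L1 L2 !frobD !exprMn !iota_expq det_mx2 polyCB !polyCM rmorphB !rmorphM /= /QM.
ring.
Qed.

End Conjugation.

(** * Summation over orbits *)

Section Representatives.
Context {Fq : finFieldType} {R : realType} {C : valuedExt Fq R}.
Local Notation q := #|Fq|.
Local Notation pC := (pemb C).
Local Notation iota x := (pC x%:P).
Implicit Types (M g : 'M[{poly Fq}]_2) (p : {poly Fq}).

Definition mats (m : nat) : seq 'M[{poly Fq}]_2 :=
  [seq mx2 r.1 r.2 s.1 s.2 | r <- [seq (x, y) | x <- polys m, y <- polys m],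
                             s <- [seq (x, y) | x <- polys m, y <- polys m]].

Lemma mem_mats m M : reflect (forall i j, (size (M i j) <= m)%N) (M \in mats m).
Proof.
apply: (iffP allpairsP) => [[[r s] /= [hr hs ->]]|H].
  case/allpairsP: hr => [[x y] /= [hx hy ->]]; case/allpairsP: hs => [[u v] /= [hu hv ->]].
  rewrite !mem_polys in hx hy hu hv.
  by apply: ord2P; apply: ord2P; rewrite mx2E.
exists ((M 0 0, M 0 1), (M 1 0, M 1 1)); split => /=.
- by apply/allpairsP; exists (M 0 0, M 0 1); rewrite !mem_polys !H.
- by apply/allpairsP; exists (M 1 0, M 1 1); rewrite !mem_polys !H.
- by apply: mx2_eq; rewrite mx2E.
Qed.

Lemma mx2_inj (r s r' s' : {poly Fq} * {poly Fq}) :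
  mx2 r.1 r.2 s.1 s.2 = mx2 r'.1 r'.2 s'.1 s'.2 -> r = r' /\ s = s'.
Proof.
case: r s r' s' => [a b] [c d] [a' b'] [c' d'] /= E.
have e i j := congr1 (fun M : 'M[{poly Fq}]_2 => M i j) E.
by have := (e 0 0, e 0 1, e 1 0, e 1 1); rewrite !mx2E => -[[[-> ->] ->] ->].
Qed.

Lemma uniq_mats m : uniq (mats m).
Proof.
rewrite /mats; set s := [seq (x, y) | x <- _, y <- _]; have u : uniq s.
  by apply: (allpairs_uniq (uniq_polys m) (uniq_polys m)) => -[x y] [x' y'] _ _.
by apply: (allpairs_uniq u u) => -[r t] [r' t'] _ _ /= /mx2_inj[-> ->].
Qed.

Lemma mats_exhaust M : exists N, forall m, (N <= m)%N -> M \in mats m.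
Proof.
exists (\max_(ij : 'I_2 * 'I_2) size (M ij.1 ij.2))%N => m hm.
apply/mem_mats => i j; apply: leq_trans hm.
exact: (leq_bigmax (i, j)).
Qed.

Lemma size_bounded (K : R) : exists N, forall p, vabs (pC p) <= K -> (size p <= N)%N.
Proof.
have [N HN] := @qexp_gt Fq R K; exists N.+1 => p; apply: contraLR; rewrite -ltnNge => h.
have p0 : p != 0 by rewrite -size_poly_gt0; apply: leq_trans h.
rewrite -ltNge vabs_pemb //; apply: HN; by case: (size p) h => // s; rewrite ltnS => /ltnW.
Qed.

Lemma vanishing_mats (D : {pred 'M[{poly Fq}]_2}) (h : 'M[{poly Fq}]_2 -> R) :
  (forall e, 0 < e -> exists K, forall M, M \in D -> e <= h M ->
     forall i j, vabs (pC (M i j)) <= K) -> vanishing D h.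
Proof.
move=> H e /H[K HK]; have [N HN] := size_bounded K.
exists [fset M in mats N]%fset => M MD; rewrite !inE => hM.
rewrite ltNge; apply: contra hM => /(HK _ MD) hM.
by apply/mem_mats => i j; apply: HN.
Qed.

Variable n : {poly Fq}.
Hypothesis n_size : (1 < size n)%N.

(* Representatives, among the matrices of Gamma with c <> 0, of the orbits of
   the translations by nA (acting on the left) and by Fq (by conjugation). *)
Definition reps : {pred 'M[{poly Fq}]_2} :=
  [pred M | [&& M \in Gamma n, M 1 0 != 0, (M 1 1)`_(size (M 1 0)).-1 == 0
                & (size (M 0 0)%R < size (n * M 1 0)%R)%N]].

Definition reps_seq m := [seq M <- mats m | M \in reps].

Lemma reps_exhausts : exhausts reps reps_seq.
Proof.
split=> [m|m M|M MS]; first by rewrite filter_uniq // uniq_mats.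
  by rewrite mem_filter => /andP[].
by have [N HN] := mats_exhaust M; exists N => m /HN h; rewrite mem_filter MS.
Qed.

Definition trans_seq m : seq 'M[{poly Fq}]_2 := [seq mx2 1 (n * p) 0 1 | p <- polys m].

Definition orbit_seq m : seq 'M[{poly Fq}]_2 :=
  [seq conj_trans g (n * xp.2 + xp.1%:P) xp.1 | g <- reps_seq m,
     xp <- [seq (x, p) | x <- enum Fq, p <- polys m]].

Definition Gamma_seq m := trans_seq m ++ orbit_seq m.

Lemma conj_trans_Gamma g p (x : Fq) : g \in Gamma n ->
  conj_trans g (n * p + x%:P) x \in Gamma n.
Proof.
move=> /(GammaP n_size)[dt h00 h01 h10 h11]; apply/(GammaP n_size); rewrite !mx2E; split => //.
- by rewrite -dt; ring.
- by rewrite addrAC; apply: dvdp_add => //; apply: dvdp_mull.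
- rewrite (_ : _ + _ = g 0 1 + x%:P * (g 1 1 - 1) + x%:P * - (g 0 0 - 1)
      + n * (p * (g 1 1 - x%:P * g 1 0)) + - x%:P * x%:P * g 1 0); last by ring.
  apply: dvdp_add; last exact: dvdp_mull.
  apply: dvdp_add; last by apply: dvdp_mulIl.
  by do 2?apply: dvdp_add => //; apply: dvdp_mull; rewrite ?dvdpNr.
- rewrite (_ : _ - 1 = (g 1 1 - 1) + - x%:P * g 1 0); last by ring.
  by apply: dvdp_add => //; apply: dvdp_mull.
Qed.

Lemma conj_transK g v x : conj_trans (conj_trans g (- v) (- x)) v x = g.
Proof. by apply: mx2_eq; rewrite !mx2E ?polyCN; ring. Qed.

Lemma conj_trans_inj g g' p p' x x' : g \in reps -> g' \in reps ->
  conj_trans g (n * p + x%:P) x = conj_trans g' (n * p' + x'%:P) x' ->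
  [/\ g = g', p = p' & x = x'].
Proof.
move=> /and4P[_ c0 /eqP d0 sa] /and4P[_ c0' /eqP d0' sa'] E.
have e i j := congr1 (fun M : 'M[{poly Fq}]_2 => M i j) E.
have e10 := e 1 0; have e11 := e 1 1; have e00 := e 0 0; have e01 := e 0 1.
rewrite !mx2E in e10 e11 e00 e01.
rewrite -e10 in e11 e00 e01 d0' sa'.
have xx : x = x'.
  have /= := congr1 (fun P : {poly Fq} => P`_(size (g 1 0)).-1) e11.
  rewrite !coefB !mul_polyC !coefZ d0 d0' !sub0r => /oppr_inj.
  by apply: mulIf; rewrite -lead_coefE lead_coef_eq0.
rewrite -xx in e11 e00 e01 *.
have dd : g 1 1 = g' 1 1 by apply: (addIr (- (x%:P * g 1 0))).
have pp : p = p'.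
  apply/eqP; rewrite eq_sym -subr_eq0; apply/negPn/negP => h.
  have E2 : g 0 0 - g' 0 0 = n * g 1 0 * (p' - p).
    apply/eqP; rewrite -subr_eq0; apply/eqP.
    transitivity ((g 0 0 + (n * p + x%:P) * g 1 0) - (g' 0 0 + (n * p' + x%:P) * g 1 0)).
      by ring.
    by rewrite e00 subrr.
  have := leq_ltn_trans (size_polyD (g 0 0) (- g' 0 0)) _.
  rewrite size_polyN E2 => /(_ (size (n * g 1 0)%R)); rewrite gtn_max sa sa' => /(_ isT).
  have nc0 : n * g 1 0 != 0 by rewrite mulf_neq0 // size_gt1_neq0.
  rewrite size_mul //; move: h; rewrite -size_poly_gt0; case: (size (p' - p)) => // s _.
  by rewrite addnS /= ltnNge leq_addr.
rewrite -pp in e00 e01 *.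
have aa : g 0 0 = g' 0 0 by apply: (addIr ((n * p + x%:P) * g 1 0)).
split=> //; apply: mx2_eq => //; move: e01; rewrite -dd -aa.
by move=> /addIr/addIr.
Qed.

Lemma reps_decomp M : M \in Gamma n -> M 1 0 != 0 ->
  exists g p x, g \in reps /\ M = conj_trans g (n * p + x%:P) x.
Proof.
move=> MG c0.
have [x hx] : exists x : Fq, (M 1 1 + x%:P * M 1 0)`_(size (M 1 0)).-1 = 0.
  exists (- ((M 1 1)`_(size (M 1 0)).-1 / lead_coef (M 1 0))).
  rewrite coefD mul_polyC coefZ -lead_coefE mulNr divfK ?subrr //.
  by rewrite lead_coef_eq0.
have [p hp] : exists p, (size (M 0 0 - (n * p + x%:P) * M 1 0)%R < size (n * M 1 0)%R)%N.
  exists ((M 0 0 - x%:P * M 1 0) %/ (n * M 1 0))%R.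
  have -> : M 0 0 - (n * ((M 0 0 - x%:P * M 1 0) %/ (n * M 1 0))%R + x%:P) * M 1 0 =
      ((M 0 0 - x%:P * M 1 0) %% (n * M 1 0))%R.
    have := divp_eq (M 0 0 - x%:P * M 1 0) (n * M 1 0).
    move: (_ %/ _)%R (_ %% _)%R => d r H.
    transitivity ((M 0 0 - x%:P * M 1 0) - d * (n * M 1 0)); first by ring.
    by rewrite H; ring.
  by rewrite ltn_modp mulf_neq0 // size_gt1_neq0.
have E : - (n * p + x%:P) = n * (- p) + (- x)%:P by rewrite polyCN; ring.
exists (conj_trans M (- (n * p + x%:P)) (- x)), p, x; split; last by rewrite conj_transK.
apply/and4P; split; rewrite ?mx2E //.
- by rewrite E; apply: conj_trans_Gamma.
- by rewrite polyCN mulNr opprK hx.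
- by rewrite mulNr.
Qed.

Lemma Gamma_c0 M : M \in Gamma n -> M 1 0 = 0 -> M = mx2 1 (M 0 1) 0 1.
Proof.
move=> /(GammaP n_size)[dt h00 h01 h10 h11] c0.
have H u v : u * v = 1 -> (n %| u - 1)%R -> u = 1 :> {poly Fq}.
  move=> uv; have : u \is a GRing.unit by apply/unitrPr; exists v.
  rewrite poly_unitE => /andP[/size_poly1P[c _ ->] _].
  rewrite -polyC1 -polyCB => h; apply/eqP; rewrite -subr_eq0 -polyCB; apply/negPn/negP => h0.
  have := dvdp_leq h0 h; rewrite leqNgt; apply/negP/negPn.
  by apply: leq_ltn_trans n_size; rewrite size_polyC leq_b1.
rewrite c0 mulr0 subr0 in dt.
apply: mx2_eq; rewrite mx2E //; first exact: H dt h00.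
by apply: H h11; rewrite mulrC; apply: dt.
Qed.

Lemma trans_Gamma p : mx2 1 (n * p) 0 1 \in Gamma n.
Proof.
apply/(GammaP n_size); rewrite !mx2E !subrr dvdp0 dvdp_mulIl; split=> //; ring.
Qed.

Lemma Gamma_seq_exhausts : exhausts (Gamma n) Gamma_seq.
Proof.
split.
- move=> m; rewrite cat_uniq map_inj_uniq ?uniq_polys /=; last first.
    move=> p p' /(congr1 (fun M : 'M[{poly Fq}]_2 => M 0 1)); rewrite !mx2E.
    exact/mulfI/size_gt1_neq0.
  apply/andP; split.
    apply/hasPn => M /allpairsP[[g [x p]] /= [hg _ ->]].
    move: hg; rewrite mem_filter => /andP[/and4P[_ c0 _ _] _].
    apply/negP => /mapP[p' _ /(congr1 (fun M : 'M[{poly Fq}]_2 => M 1 0))].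
    by rewrite !mx2E => /eqP; rewrite (negPf c0).
  have up : uniq [seq (x, p) | x <- enum Fq, p <- polys m].
    by apply: (allpairs_uniq (enum_uniq _) (uniq_polys m)) => -[x p] [x' p'] _ _.
  have ur : uniq (reps_seq m) by case: reps_exhausts.
  apply: (allpairs_uniq ur up) => -[g [x p]] [g' [x' p']].
  move=> hg hg'.
  have {}hg : g \in reps_seq m by case/allpairsP: hg => -[h y] /= [hh _ [->]].
  have {}hg' : g' \in reps_seq m by case/allpairsP: hg' => -[h y] /= [hh _ [->]].
  move: hg hg'; rewrite !mem_filter => /andP[hh _] /andP[hh' _].
  by rewrite /= => /(conj_trans_inj hh hh')[-> -> ->].
- move=> m M; rewrite mem_cat => /orP[/mapP[p _ ->]|]; first exact: trans_Gamma.
  move=> /allpairsP[[g [x p]] /= [hg _ ->]].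
  move: hg; rewrite mem_filter => /andP[/and4P[gG _ _ _] _].
  exact: conj_trans_Gamma.
- move=> M MG; have [c0|c0] := eqVneq (M 1 0) 0.
    have E := Gamma_c0 MG c0; have /(GammaP n_size)[_ _ /dvdpP[p Ep] _ _] := MG.
    exists (size p) => m hm; rewrite mem_cat; apply/orP; left; apply/mapP.
    by exists p; [rewrite mem_polys|rewrite mulrC -Ep].
  have [g [p [x [gr E]]]] := reps_decomp MG c0.
  have [N HN] := mats_exhaust g.
  exists (maxn N (size p)) => m; rewrite geq_max => /andP[h h'].
  rewrite mem_cat; apply/orP; right; apply/allpairsP; exists (g, (x, p)); split => //=.
    by rewrite mem_filter gr HN.
  by apply/allpairsP; exists (x, p); rewrite mem_enum mem_polys.
Qed.

End Representatives.

Section PolyEq.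
Context {Fq : finFieldType} {R : realType} {C : valuedExt Fq R}.
Local Notation q := #|Fq|.
Local Notation pC := (pemb C).

Lemma poly_horner_inj (P Q : {poly C}) : (forall z, P.[z] = Q.[z]) -> P = Q.
Proof.
move=> H; apply/eqP; rewrite -subr_eq0; apply/negPn/negP => h.
pose rs := [seq pC 'X^i | i <- iota 0 (size (P - Q))].
have : (size rs < size (P - Q)%R)%N.
  apply: max_poly_roots => //.
    by apply/allP => z _; rewrite rootE hornerD hornerN H subrr.
  rewrite map_inj_uniq ?iota_uniq // => i j /pemb_inj.
  by move=> /(congr1 (fun p : {poly Fq} => size p)); rewrite !size_polyXn => -[].
by rewrite size_map size_iota ltnn.
Qed.

Lemma quot_at_horner (A B B' D lc : C) (ys : seq C) y : lc != 0 ->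
  A *: 'X^(q.+1) + B *: 'X^q + B' *: 'X + D%:P = lc *: \prod_(y <- ys) ('X - y%:P) ->
  uniq ys -> y \in ys -> A * y ^+ q + B' != 0.
Proof.
move=> lc0 E ysu yys.
have ry : root (A *: 'X^(q.+1) + B *: 'X^q + B' *: 'X + D%:P) y.
  by rewrite E rootZ // root_prod_XsubC.
have F := quot_atP ry.
have -> : A * y ^+ q + B' = (quot_at A B B' y).[y].
  rewrite /quot_at hornerD hornerC hornerM horner_exp hornerXsubC subrr expr0n.
  have q1 : (q.-1 == 0)%N = false by have := @card_Fq_gt1 Fq; case: #|Fq| => [|[]].
  by rewrite q1 mul0r addr0.
have : quot_at A B B' y = lc *: \prod_(y' <- rem y ys) ('X - y'%:P).
  apply: (@mulfI _ ('X - y%:P)); first by rewrite polyXsubC_eq0.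
  by rewrite -F E (big_rem y) //= scalerAr.
move=> ->; rewrite -rootE rootZ // root_prod_XsubC mem_rem_uniq // inE eqxx //.
Qed.

End PolyEq.

Section RepresentativeTerms.
Context {Fq : finFieldType} {R : realType} {C : valuedExt Fq R}.
Local Notation q := #|Fq|.
Local Notation pC := (pemb C).
Local Notation iota x := (pC x%:P).
Variable n : {poly Fq}.
Hypothesis n_size : (1 < size n)%N.
Variable g : 'M[{poly Fq}]_2.
Hypothesis gr : g \in reps n.

Definition cusp_num (o : option Fq) : {poly Fq} :=
  if o is Some x then g 0 0 * x%:P + g 0 1 else g 0 0.
Definition cusp_den (o : option Fq) : {poly Fq} :=
  if o is Some x then g 1 0 * x%:P + g 1 1 else g 1 0.
Definition cuspF (o : option Fq) : ratfun Fq := polyF (cusp_num o) / polyF (cusp_den o).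
Definition cuspC (o : option Fq) : C := vemb C (cuspF o).

Let A := pC (g 1 0) ^+ q * pC (g 1 1) - pC (g 1 0) * pC (g 1 1) ^+ q.
Let B := pC (g 0 0) * pC (g 1 1) ^+ q - pC (g 1 0) ^+ q * pC (g 0 1).
Let B' := pC (g 1 0) * pC (g 0 1) ^+ q - pC (g 0 0) ^+ q * pC (g 1 1).
Let D := pC (g 0 0) ^+ q * pC (g 0 1) - pC (g 0 0) * pC (g 0 1) ^+ q.

Definition cusp_res (o : option Fq) : C := (A * cuspC o ^+ q + B')^-1.

Lemma reps_Gamma : g \in Gamma n. Proof. by case/and4P: gr. Qed.

Lemma reps_det : \det g = 1.
Proof. by rewrite det_mx2; case/(GammaP n_size): reps_Gamma. Qed.

Lemma cusp_den_neq0 o : cusp_den o != 0.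
Proof.
case/and4P: gr => /(GammaP n_size)[_ _ _ h10 h11] c0 _ _; case: o => [x|] //=.
apply/negP => /eqP E.
have : (n %| 1)%R.
  rewrite (_ : 1 = g 1 0 * x%:P + g 1 1 - g 1 0 * x%:P - (g 1 1 - 1)); last by ring.
  rewrite E sub0r; apply: dvdp_add; rewrite dvdpNr //; exact: dvdp_mulr.
by move=> /dvdp_leq -/(_ (oner_neq0 _)); rewrite size_poly1 leqNgt n_size.
Qed.

Lemma cuspCE o : cuspC o = pC (cusp_num o) / pC (cusp_den o).
Proof. by rewrite /cuspC /cuspF rmorphM fmorphV. Qed.

Definition cusp_lead (o : option Fq) : C :=
  if o is Some _ then pC (cusp_den o) else - pC (cusp_den o).

Lemma cusp_lin_fact z o : cusp_lin g z o = cusp_lead o * (z - cuspC o).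
Proof.
have d0 : pC (cusp_den o) != 0 by rewrite pemb_eq0 cusp_den_neq0.
have -> : cusp_lead o * (z - cuspC o) =
    (if o is Some _ then 1 else -1) * (pC (cusp_den o) * z - pC (cusp_num o)).
  rewrite cuspCE /cusp_lead; case: o d0 => [x|];
    by move: (pC (cusp_den _)) (pC (cusp_num _)) => d e d0; field.
case: o {d0} => [x|]; rewrite /= /lin2 /lin1 ?(rmorphD, rmorphM) /=; ring.
Qed.

Let ys := [seq cuspC o | o <- enum {: option Fq}].

Lemma cuspC_inj : injective cuspC.
Proof.
move=> o o' /eqP; rewrite !cuspCE eqr_div ?pemb_eq0 ?cusp_den_neq0 // -!rmorphM /=.
move=> /eqP/pemb_inj; move: reps_det; rewrite det_mx2.
have K (d : {poly Fq}) : d = 0 -> d = 1 -> False by move=> -> /esym/eqP; rewrite oner_eq0.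
case: o o' => [x|] [y|] //= dt H.
- have E : (x - y)%:P = 0 :> {poly Fq}.
    rewrite -[LHS]mul1r -dt polyCB.
    transitivity ((g 0 0 * x%:P + g 0 1) * (g 1 0 * y%:P + g 1 1)
      - (g 0 0 * y%:P + g 0 1) * (g 1 0 * x%:P + g 1 1)); first by ring.
    by rewrite H subrr.
  by move/eqP: E; rewrite polyC_eq0 subr_eq0 => /eqP ->.
- exfalso; apply: K dt; transitivity (g 0 0 * (g 1 0 * x%:P + g 1 1)
      - (g 0 0 * x%:P + g 0 1) * g 1 0); first by ring.
  by rewrite H subrr.
- exfalso; apply: K dt; transitivity (g 0 0 * (g 1 0 * y%:P + g 1 1)
      - (g 0 0 * y%:P + g 0 1) * g 1 0); first by ring.
  by rewrite H subrr.
Qed.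

Let Q : {poly C} := A *: 'X^(q.+1) + B *: 'X^q + B' *: 'X + D%:P.

Lemma cusp_poly_horner z : Q.[z] = QM g z.
Proof.
rewrite /Q !(hornerD, hornerZ, hornerXn, hornerX, hornerC) /QM /lin1 /lin2 !frobB !exprMn !exprS /A /B /B' /D; ring.
Qed.

Lemma cusp_poly_fact : Q = (\prod_o cusp_lead o) *: \prod_(y <- ys) ('X - y%:P).
Proof.
apply: poly_horner_inj => z.
rewrite cusp_poly_horner QM_prod hornerZ horner_prod /ys big_map big_enum /= -big_split /=.
by apply: eq_bigr => o _; rewrite cusp_lin_fact hornerXsubC.
Qed.

Lemma cusp_lead_neq0 : \prod_o cusp_lead o != 0.
Proof.
apply/prodf_neq0 => o _; have := cusp_den_neq0 o; rewrite -(@pemb_eq0 _ _ C).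
by case: o => [x|]; rewrite /= ?oppr_eq0.
Qed.

Lemma cusps_uniq : uniq ys.
Proof. by rewrite map_inj_uniq ?enum_uniq //; apply: cuspC_inj. Qed.

Lemma size_cusps : size ys = q.+1.
Proof. by rewrite size_map -cardT card_option. Qed.

Variable k : nat.
Hypothesis hk : (0 < k < q)%N.

Lemma QM_partial_fractions z : (forall x, z != vemb C x) ->
  QM g z ^- k = \sum_o (cusp_res o / (z - cuspC o)) ^+ k.
Proof.
case/andP: hk => k0 kq hz.
have zys : z \notin ys by apply/negP => /mapP[o _ E]; have := hz (cuspF o); rewrite E eqxx.
have dQ y : y \in ys -> A * y ^+ q + B' != 0.
  exact: quot_at_horner cusp_lead_neq0 cusp_poly_fact cusps_uniq.
have s0 : (0 < size ys)%N by rewrite size_cusps.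
have := pure_partial_fractions_horner cusp_lead_neq0 cusp_poly_fact cusps_uniq s0 dQ k0 kq zys.
by rewrite -/Q cusp_poly_horner big_map big_enum.
Qed.

Lemma sum_cusp_res0 : \sum_o cusp_res o ^+ k = 0.
Proof.
case/andP: hk => k0 kq.
have dQ y : y \in ys -> A * y ^+ q + B' != 0.
  exact: quot_at_horner cusp_lead_neq0 cusp_poly_fact cusps_uniq.
have s0 : (0 < size ys)%N by rewrite size_cusps.
have := sum_residues0 cusp_lead_neq0 cusp_poly_fact cusps_uniq s0 dQ k0 kq size_cusps.
by rewrite big_map big_enum.
Qed.

Lemma vabs_cuspC o : vabs (cuspC o) < vabs (pC n).
Proof.
have [_ c0 _ sa] := and4P gr.
have c1 : 1 <= vabs (pC (g 1 0)) by apply: vabs_pemb_ge1.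
have n1 : 1 < vabs (pC n) by apply: vabs_n_gt1.
have yN : vabs (cuspC None) < vabs (pC n).
  rewrite cuspCE /= vabsM vabsV ltr_pdivrMr ?(lt_le_trans ltr01) // -vabsM -rmorphM.
  by apply: vabs_pemb_lt => //; rewrite mulf_neq0 // size_gt1_neq0.
case: o => [x|] //.
have c0' : pC (g 1 0) != 0 by rewrite pemb_eq0.
have d0 : pC (cusp_den (Some x)) != 0 by rewrite pemb_eq0 cusp_den_neq0.
have d1 : 1 <= vabs (pC (cusp_den (Some x))) by apply: vabs_pemb_ge1; apply: cusp_den_neq0.
have -> : cuspC (Some x) = cuspC None - (pC (g 1 0) * pC (cusp_den (Some x)))^-1.
  rewrite !cuspCE /cusp_num [cusp_den None]/=.
  have := reps_det; rewrite det_mx2 => /(congr1 pC); rewrite rmorphB !rmorphM rmorph1 => dt.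
  move: d0 dt c0'; rewrite /cusp_den !(rmorphD, rmorphM) /=.
  move: (pC (g 0 0)) (pC (g 0 1)) (pC (g 1 0)) (pC (g 1 1)) (iota x) => a b c d X d0 dt c0'.
  transitivity (a / c - (a * d - b * c) / (c * (c * X + d))); last by rewrite dt mul1r.
  by field; rewrite d0 c0'.
apply: vabsB_lt => //; rewrite vabsV; apply: le_lt_trans n1.
have h := mulr_ege1 c1 d1; rewrite -vabsM in h.
by rewrite invf_le1 // (lt_le_trans ltr01).
Qed.

End RepresentativeTerms.

Section SumOverGamma.
Context {Fq : finFieldType} {R : realType} {C : valuedExt Fq R}.
Local Notation q := #|Fq|.
Local Notation pC := (pemb C).
Local Notation iota x := (pC x%:P).
Variable n : {poly Fq}.
Hypothesis n_size : (1 < size n)%N.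
Hypothesis Ccomplete : vcomplete C.
Variable k : nat.
Hypothesis hk : (0 < k < q)%N.
Implicit Types (z : C) (g : 'M[{poly Fq}]_2) (N : R).

Definition rep_term g z : C :=
  \sum_(o : option Fq) (cusp_res g o / eLam n (z - cuspC g o)) ^+ k.

Definition rep_term_lat m g z : C :=
  \sum_(o : option Fq) (cusp_res g o / ELam n m (z - cuspC g o)) ^+ k.

Definition row_bound g : R := (Num.max (vabs (pC (g 1 0))) (vabs (pC (g 1 1))))^-1.

Lemma far_notin N z : 1 <= N -> far N z -> forall x, z != vemb C x.
Proof.
move=> N1 h x; rewrite -subr_eq0 -vabs_gt0; apply: lt_le_trans (h x).
exact: lt_le_trans N1.
Qed.

Lemma far_pB N z p : far N z -> far N (z - pC p).
Proof. exact: farB. Qed.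

Lemma rep_term_latE m g z N : g \in reps n -> 1 <= N -> far N z ->
  \sum_(x : Fq) \sum_(p <- polys m) QM g (z - iota x - pC (n * p)) ^- k = rep_term_lat m g z.
Proof.
move=> gr N1 hz.
transitivity (\sum_(x : Fq) \sum_(p <- polys m) \sum_o
    (cusp_res g o / (z - iota x - pC (n * p) - cuspC g o)) ^+ k).
  apply: eq_bigr => x _; apply: eq_bigr => p _.
  by apply: (QM_partial_fractions n_size gr hk); apply: (far_notin N1 (far_pB _ (far_pB _ hz))).
under eq_bigr => x _ do rewrite exchange_big /=.
rewrite exchange_big /=; apply: eq_bigr => o _.
rewrite expr_div_n -(goss_ELam (size_gt1_neq0 n_size) n_size) //; last first.
- by move=> p; apply: (far_notin N1 (farB _ hz)).
rewrite mulr_sumr; apply: eq_bigr => x _; rewrite mulr_sumr; apply: eq_bigr => p _.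
by rewrite expr_div_n; congr (_ * _ ^- _); ring.
Qed.

Lemma rep_term_lat_lims g z N : 1 <= N -> far N z ->
  lims (fun m => rep_term_lat m g z) (rep_term g z).
Proof.
move=> N1 hz; apply: lims_sum => o _; apply: limsX; apply: limsZ.
apply: limsV; first exact: ELam_lims.
have h : far N (z - cuspC g o) by apply: farB.
rewrite -vabs_gt0; apply: lt_le_trans (far_eLam n_size Ccomplete _ h); exact: lt_le_trans N1.
Qed.

Lemma reps_max_ge1 g : g \in reps n -> 1 <= Num.max (vabs (pC (g 1 0))) (vabs (pC (g 1 1))).
Proof. by case/and4P=> _ c0 _ _; rewrite le_max vabs_pemb_ge1. Qed.

Lemma vabs_QMV_le g z N : g \in Gamma n -> 1 <= N -> far N z ->
  vabs (QM g z ^- k) <= (vabs (QM g z))^-1.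
Proof.
move=> /(GammaP n_size)[dt _ _ _ _] N1 hz; rewrite -det_mx2 in dt.
have q1 := vabs_QM_ge1 dt N1 hz.
rewrite vabsV vabsX lef_pV2 ?posrE ?exprn_gt0 ?(lt_le_trans ltr01) //.
case/andP: hk; case: k => // k' _ _; rewrite exprS ler_peMr ?exprn_ege1 //.
exact: vabs_ge0.
Qed.

Lemma vabs_QMV_le_row g z N : g \in reps n -> 1 <= N -> far N z ->
  vabs (QM g z ^- k) <= row_bound g.
Proof.
move=> gr N1 hz; apply: le_trans (vabs_QMV_le (reps_Gamma gr) N1 hz) _.
have dt := reps_det n_size gr.
rewrite lef_pV2 ?posrE ?(lt_le_trans ltr01) ?reps_max_ge1 //; last exact: vabs_QM_ge1 hz.
by have [h h'] := vabs_QM_ge_row dt N1 hz; rewrite ge_max h.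
Qed.

Lemma vabs_rep_term_lat_le m g z N : g \in reps n -> 1 <= N -> far N z ->
  vabs (rep_term_lat m g z) <= row_bound g.
Proof.
move=> gr N1 hz; rewrite -(rep_term_latE m gr N1 hz).
have b0 : 0 <= row_bound g by rewrite invr_ge0 (le_trans ler01) // reps_max_ge1.
apply: vabs_sum_le => // x _ _; apply: vabs_sum_le => // p _ _.
exact: vabs_QMV_le_row (far_pB _ (far_pB _ hz)).
Qed.

Lemma vabs_rep_term_le g z N : g \in reps n -> 1 <= N -> far N z ->
  vabs (rep_term g z) <= row_bound g.
Proof.
move=> gr N1 hz; apply: lims_vabs_le (rep_term_lat_lims g N1 hz) _ => m.
exact: vabs_rep_term_lat_le hz.
Qed.

Lemma vanishing_row_bound : vanishing (reps n) row_bound.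
Proof.
apply: (@vanishing_mats Fq R C) => e e0; pose K := e^-1; pose v := vabs (pC n).
have K0 : 0 < K by rewrite invr_gt0.
have v0 : 0 <= v by apply: vabs_ge0.
exists (v * K + K + v * K * K + 1) => g gr he.
have m1 := reps_max_ge1 gr.
have : Num.max (vabs (pC (g 1 0))) (vabs (pC (g 1 1))) <= K.
  by rewrite -[X in X <= _]invrK lef_pV2 // posrE ?invr_gt0 (lt_le_trans ltr01).
rewrite ge_max => /andP[hc hd].
have [gG c0 _ sa] := and4P gr.
have vK : 0 <= v * K by rewrite mulr_ge0 // ltW.
have vKK : 0 <= v * K * K by rewrite mulr_ge0 // ltW.
have ha : vabs (pC (g 0 0)) <= v * K.
  have nc0 : n * g 1 0 != 0 by rewrite mulf_neq0 // size_gt1_neq0.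
  apply: le_trans (vabs_pemb_le nc0 (ltnW sa)) _.
  by rewrite rmorphM vabsM ler_wpM2l.
have hb : vabs (pC (g 0 1)) <= v * K * K + 1.
  have c1 : 1 <= vabs (pC (g 1 0)) by apply: vabs_pemb_ge1.
  apply: (@le_trans _ _ (vabs (pC (g 0 1)) * vabs (pC (g 1 0)))).
    by rewrite ler_peMr // vabs_ge0.
  rewrite -vabsM -rmorphM.
  have -> : g 0 1 * g 1 0 = g 0 0 * g 1 1 - 1.
    by have := reps_det n_size gr; rewrite det_mx2 => <-; ring.
  rewrite rmorphB rmorphM rmorph1; apply: vabsB_le; last by rewrite vabs1; lra.
  rewrite vabsM; have : vabs (pC (g 0 0)) * vabs (pC (g 1 1)) <= v * K * K.
    by rewrite ler_pM ?vabs_ge0.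
  lra.
by apply: ord2P; apply: ord2P; lra.
Qed.

Lemma vanishing_QMV z N : 1 <= N -> far N z ->
  vanishing (Gamma n) (fun g => vabs (QM g z ^- k)).
Proof.
move=> N1 hz; apply: (@vanishing_mats Fq R C) => e e0.
exists (e^-1 * (1 + vabs z)) => g gG he.
have dt : \det g = 1 by rewrite det_mx2; case/(GammaP n_size): gG.
apply: (QM_entries_le dt N1 hz).
have q1 := vabs_QM_ge1 dt N1 hz.
rewrite -[X in X <= _]invrK lef_pV2 // ?posrE ?invr_gt0 ?(lt_le_trans ltr01) //.
exact: le_trans he (vabs_QMV_le gG N1 hz).
Qed.

Lemma trans_seq_sum m z N : 1 <= N -> far N z ->
  \sum_(g <- trans_seq n m) QM g z ^- k = (-1) ^+ k * ELam n m z ^- k.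
Proof.
move=> N1 hz; rewrite big_map -(goss_ELam (size_gt1_neq0 n_size) n_size) //; last first.
  by move=> p; apply: far_notin hz _.
rewrite exchange_big mulr_sumr; apply: eq_bigr => p _.
rewrite /QM /lin1 /lin2 !mx2E rmorph1 rmorph0 mul0r subr0 expr1n !mul1r.
set w := z - pC (n * p).
have -> : w ^+ q - w = - (w - w ^+ q / 1 ^+ q.-1) by rewrite expr1n divr1 [RHS]opprB.
rewrite [in LHS]exprNn invfM invr_sign -goss_step ?oner_neq0 //; last first.
  by move=> x; rewrite mulr1; apply: (far_notin N1 (far_pB _ hz)).
congr (_ * _); apply: eq_bigr => x _; congr (_ ^- _); rewrite /w; ring.
Qed.

Lemma orbit_seq_sum m z N : 1 <= N -> far N z ->
  \sum_(g <- orbit_seq n m) QM g z ^- k = \sum_(g <- reps_seq n m) rep_term_lat m g z.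
Proof.
move=> N1 hz; rewrite big_allpairs_dep big_seq [RHS]big_seq; apply: eq_bigr => g.
rewrite mem_filter => /andP[gr _]; rewrite -(rep_term_latE m gr N1 hz).
rewrite big_allpairs_dep big_enum /=; apply: eq_bigr => x _; apply: eq_bigr => p _.
by rewrite QM_conj_trans; congr (QM _ _ ^- _); rewrite rmorphD /=; ring.
Qed.

Lemma hassum_Gamma z N : 1 <= N -> far N z -> exists F,
  hassum (reps n) (rep_term ^~ z) F /\
  hassum (Gamma n) (fun g => QM g z ^- k) ((-1) ^+ k * eLam n z ^- k + F).
Proof.
move=> N1 hz.
have [F hF] : exists F, hassum (reps n) (rep_term ^~ z) F.
  apply: hassum_exists (reps_exhausts n) _ => // e e0.
  have [S HS] := vanishing_row_bound e0; exists S => g gr gS.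
  exact: le_lt_trans (vabs_rep_term_le gr N1 hz) (HS _ gr gS).
exists F; split => //.
apply: hassum_exhaust (vanishing_QMV N1 hz) (Gamma_seq_exhausts n_size) _.
apply: (@lims_ext _ _ _ (fun m => (-1) ^+ k * ELam n m z ^- k +
   \sum_(g <- reps_seq n m) rep_term_lat m g z)).
  by move=> m; rewrite big_cat /= (trans_seq_sum _ N1 hz) (orbit_seq_sum _ N1 hz).
apply: limsD.
  apply: limsZ; apply: limsV; first exact/limsX/ELam_lims.
  rewrite expf_neq0 // -vabs_gt0; apply: lt_le_trans (far_eLam n_size Ccomplete _ hz);
  exact: lt_le_trans N1.
apply: lims_dominated (reps_exhausts n) vanishing_row_bound _ _ hF.
  by move=> m g gr; apply: vabs_rep_term_lat_le hz.
by move=> g gr; apply: rep_term_lat_lims hz.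
Qed.

End SumOverGamma.

(** * Power series with bounded coefficients *)

Section PowerSeries.
Context {Fq : finFieldType} {R : realType} {C : valuedExt Fq R}.
Variable L : R.
Hypothesis L0 : 0 <= L.
Implicit Types (P Q D : {poly C}) (B : R) (t : C).

Definition gauss_le B P := forall i, vabs P`_i <= B * L ^+ i.

Definition vanish_upto (e : nat) P := forall i, (i < e)%N -> P`_i = 0.

Lemma gauss_leM B B' P Q : gauss_le B P -> gauss_le B' Q -> gauss_le (B * B') (P * Q).
Proof.
move=> hP hQ i.
have B0 : 0 <= B by have := le_trans (vabs_ge0 _) (hP 0%N); rewrite expr0 mulr1.
have B0' : 0 <= B' by have := le_trans (vabs_ge0 _) (hQ 0%N); rewrite expr0 mulr1.
rewrite coefM; apply: vabs_sum_le => [|j _ _]; first by rewrite !mulr_ge0 ?exprn_ge0.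
rewrite vabsM; apply: le_trans (ler_pM (vabs_ge0 _) (vabs_ge0 _) (hP j) (hQ _)) _.
by rewrite mulrACA -exprD subnKC // -ltnS.
Qed.

Lemma gauss_leD B P Q : gauss_le B P -> gauss_le B Q -> gauss_le B (P + Q).
Proof. by move=> hP hQ i; rewrite coefD; apply: vabsD_le. Qed.

Lemma gauss_leN B P : gauss_le B P -> gauss_le B (- P).
Proof. by move=> hP i; rewrite coefN vabsN. Qed.

Lemma gauss_leB B P Q : gauss_le B P -> gauss_le B Q -> gauss_le B (P - Q).
Proof. by move=> hP /gauss_leN; apply: gauss_leD. Qed.

Lemma gauss_le_c (c : C) B : vabs c <= B -> gauss_le B c%:P.
Proof.
move=> h [|i]; rewrite coefC /= ?expr0 ?mulr1 // vabs0 mulr_ge0 ?exprn_ge0 //.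
exact: le_trans (vabs_ge0 _) h.
Qed.

Lemma gauss_le1 : gauss_le 1 1.
Proof. by apply: gauss_le_c; rewrite vabs1. Qed.

Lemma gauss_le_cXn (c : C) B m : vabs c <= B * L ^+ m -> 0 <= B -> gauss_le B (c *: 'X^m).
Proof.
move=> h B0 i; rewrite coefZ coefXn; case: eqP => [->|_]; first by rewrite mulr1.
by rewrite mulr0 vabs0 mulr_ge0 // exprn_ge0.
Qed.

Lemma gauss_leX P m : gauss_le 1 P -> gauss_le 1 (P ^+ m).
Proof.
move=> h; elim: m => [|m IH]; first exact: gauss_le1.
by rewrite exprS -[1]mulr1; apply: gauss_leM.
Qed.

Lemma gauss_le_prod (I : Type) (r : seq I) (S : pred I) (F : I -> {poly C}) :
  (forall i, S i -> gauss_le 1 (F i)) -> gauss_le 1 (\prod_(i <- r | S i) F i).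
Proof.
move=> h; elim/big_ind: _ => //; first exact: gauss_le1.
by move=> P Q hP hQ; rewrite -[1]mulr1; apply: gauss_leM.
Qed.

Lemma gauss_le_sum (I : Type) (r : seq I) (S : pred I) (F : I -> {poly C}) B : 0 <= B ->
  (forall i, S i -> gauss_le B (F i)) -> gauss_le B (\sum_(i <- r | S i) F i).
Proof.
move=> B0 h; elim/big_ind: _ => //; last exact: gauss_leD.
by move=> i; rewrite coef0 vabs0 mulr_ge0 ?exprn_ge0.
Qed.

Lemma vanishD e P Q : vanish_upto e P -> vanish_upto e Q -> vanish_upto e (P + Q).
Proof. by move=> hP hQ i h; rewrite coefD hP ?hQ ?addr0. Qed.

Lemma vanishM e f P Q : vanish_upto e P -> vanish_upto f Q -> vanish_upto (e + f) (P * Q).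
Proof.
move=> hP hQ i h; rewrite coefM big1 // => j _.
have [je|je] := ltnP j e; first by rewrite hP ?mul0r.
rewrite hQ ?mulr0 //; move: (ltn_ord j) h je; clear; lia.
Qed.

Lemma vanish0 P : vanish_upto 0 P. Proof. by []. Qed.


Lemma vanishX e P m : vanish_upto e P -> vanish_upto (m * e) (P ^+ m).
Proof.
move=> h; elim: m => [|m IH]; first exact: vanish0.
by rewrite exprS mulSn; apply: vanishM.
Qed.

Lemma vanish_sum e (I : Type) (r : seq I) (S : pred I) (F : I -> {poly C}) :
  (forall i, S i -> vanish_upto e (F i)) -> vanish_upto e (\sum_(i <- r | S i) F i).
Proof.
by move=> h; elim/big_ind: _ => //; [move=> i _; rewrite coef0|exact: vanishD].
Qed.

Lemma vabs_horner_le B P t e : gauss_le B P -> vanish_upto e P -> L * vabs t <= 1 ->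
  vabs P.[t] <= B * (L * vabs t) ^+ e.
Proof.
move=> hP hv ht; have x0 : 0 <= L * vabs t by rewrite mulr_ge0 ?vabs_ge0.
have B0 : 0 <= B by have := le_trans (vabs_ge0 _) (hP 0%N); rewrite expr0 mulr1.
rewrite horner_coef; apply: vabs_sum_le => [|i _ _]; first by rewrite mulr_ge0 ?exprn_ge0.
have [ie|ie] := ltnP i e; first by rewrite hv // mul0r vabs0 mulr_ge0 ?exprn_ge0.
rewrite vabsM vabsX; apply: (@le_trans _ _ (B * L ^+ i * vabs t ^+ i)).
  by rewrite ler_wpM2r ?exprn_ge0 ?vabs_ge0.
by rewrite -mulrA -exprMn ler_wpM2l // ler_wiXn2l.
Qed.

(* If D vanishes at 0, the terms D ^+ m with m > j do not contribute to the
   j-th coefficient of P / (1 - D). *)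
Definition frac_coef P D j : C := (P * \sum_(m < j.+1) D ^+ m)`_j.

Lemma frac_coef_trunc P D N j : vanish_upto 1 D -> (j < N)%N ->
  (P * \sum_(m < N) D ^+ m)`_j = frac_coef P D j.
Proof.
move=> hD jN; rewrite /frac_coef -!(big_mkord xpredT (fun m => D ^+ m)) (big_cat_nat _ (n := j.+1)) //=.
rewrite mulrDr coefD [X in _ + X](_ : _ = 0) ?addr0 //.
apply: (@vanishM 0 j.+1 _ _ (@vanish0 _)); last by [].
rewrite big_nat; apply: vanish_sum => m /andP[h _].
by move=> i hi; apply: (vanishX hD (m := m)); rewrite muln1; apply: leq_trans hi h.
Qed.

Lemma frac_coef_low P D e f j : vanish_upto e P -> vanish_upto f D -> (j < e + f)%N ->
  frac_coef P D j = P`_j.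
Proof.
move=> hP hD h; rewrite /frac_coef big_ord_recl expr0 mulrDr mulr1 coefD.
rewrite [X in _ + X](_ : _ = 0) ?addr0 //.
apply: (vanishM hP _ h); apply: vanish_sum => m _ /=.
by move=> i hi; apply: (vanishX hD); rewrite mulSn; apply: leq_trans hi (leq_addr _ _).
Qed.

Lemma frac_coef_le B P D j : gauss_le B P -> gauss_le 1 D -> vabs (frac_coef P D j) <= B * L ^+ j.
Proof.
move=> hP hD; rewrite -[B]mulr1; apply: gauss_leM => //.
by apply: gauss_le_sum => // m _; apply: gauss_leX.
Qed.

Lemma frac_expansion B P D t N : gauss_le B P -> gauss_le 1 D -> vanish_upto 1 D ->
  L * vabs t < 1 ->
  vabs (P.[t] / (1 - D).[t] - \sum_(j < N) frac_coef P D j * t ^+ j) <= B * (L * vabs t) ^+ N.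
Proof.
move=> hP hD vD ht; have ht1 := ltW ht.
have x0 : 0 <= L * vabs t by rewrite mulr_ge0 ?vabs_ge0.
have B0 : 0 <= B by have := le_trans (vabs_ge0 _) (hP 0%N); rewrite expr0 mulr1.
have vDt : vabs D.[t] <= L * vabs t by have := vabs_horner_le hD vD ht1; rewrite mul1r expr1.
have d1 : vabs (1 - D).[t] = 1.
  by rewrite hornerD hornerN hornerC vabsB_dom vabs1 // (le_lt_trans vDt).
have d0 : (1 - D).[t] != 0 by rewrite -vabs_gt0 d1.
pose S := \sum_(m < N) D ^+ m; pose T := P * S.
have gT : gauss_le B T.
  by rewrite -[B]mulr1; apply: gauss_leM => //; apply: gauss_le_sum => // m _; apply: gauss_leX.
have E1 : P.[t] / (1 - D).[t] - T.[t] = P.[t] * D.[t] ^+ N / (1 - D).[t].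
  have : S * (1 - D) = 1 - D ^+ N.
    have := subrXX 1 D N; rewrite expr1n => ->; rewrite mulrC; congr (_ * _).
    by apply: eq_bigr => m _; rewrite expr1n mul1r.
  move=> /(congr1 (fun Q => Q.[t])); rewrite hornerM => E.
  apply: (mulIf d0); rewrite mulrBl !divfK // /T hornerM -mulrA E.
  by rewrite hornerD hornerN horner_exp hornerC; ring.
have E2 : T.[t] - \sum_(j < N) frac_coef P D j * t ^+ j = (T - \poly_(j < N) T`_j).[t].
  rewrite hornerD hornerN horner_poly; congr (_ - _); apply: eq_bigr => j _.
  by rewrite /T frac_coef_trunc.
rewrite (_ : _ - _ = (P.[t] / (1 - D).[t] - T.[t]) +
   (T.[t] - \sum_(j < N) frac_coef P D j * t ^+ j)); last by ring.
apply: vabsD_le.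
  rewrite E1 vabsM vabsV d1 invr1 mulr1 vabsM vabsX; apply: ler_pM; rewrite ?exprn_ge0 ?vabs_ge0 //.
    by have := vabs_horner_le hP (@vanish0 _) ht1; rewrite expr0 mulr1.
  by rewrite lerXn2r ?nnegrE ?vabs_ge0.
rewrite E2; apply: vabs_horner_le => // [i|i iN].
  rewrite coefB coef_poly; case: ifP => _; last by rewrite subr0.
  by rewrite subrr vabs0 mulr_ge0 ?exprn_ge0.
by rewrite coefB coef_poly iN subrr.
Qed.

Lemma poly_bound_of_values (pts : nat -> C) (m : nat) : injective pts ->
  exists2 K, 0 < K & forall P, (size P <= m)%N -> forall b,
    (forall i, vabs P.[pts i] <= b) -> forall j, vabs P`_j <= K * b.
Proof.
move=> pinj; suff [K K0 HK] : exists2 K, 0 < K & forall P, (size P <= m)%N -> forall b, 0 <= b ->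
    (forall i, (i < m)%N -> vabs P.[pts i] <= b) -> forall j, vabs P`_j <= K * b.
  exists K => // P sP b hb; apply: HK => //; exact: le_trans (vabs_ge0 _) (hb 0%N).
elim: m => [|m [K K0 IH]].
  exists 1 => // P; rewrite size_poly_leq0 => /eqP -> b b0 _ j; rewrite coef0 vabs0 mul1r //.
pose y := pts m; pose K' := \sum_(i < m) vabs (pts i - y)^-1.
have K'0 : 0 <= K' by apply: sumr_ge0 => i _; apply: vabs_ge0.
have y0 := vabs_ge0 y.
have KK : 0 <= K * K' by rewrite mulr_ge0 // ltW.
have KKy : 0 <= vabs y * (K * K') by rewrite mulr_ge0.
exists (K * K' + vabs y * (K * K') + 1) => [|P sP b b0 hb j]; first lra.
have /factor_theorem[Q E] : root (P - P.[y]%:P) y by rewrite rootE !hornerE subrr.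
have sQ : (size Q <= m)%N.
  have [->|Q0] := eqVneq Q 0; first by rewrite size_poly0.
  have : (size (Q * ('X - y%:P))%R <= m.+1)%N.
    rewrite -E; apply: leq_trans (size_polyD _ _) _; rewrite size_polyN geq_max sP.
    by apply: leq_trans (size_polyC_leq1 _) _.
  by rewrite size_Mmonic ?monicXsubC // size_XsubC addn2.
have hy : vabs P.[y] <= b by apply: hb.
have hQ i : (i < m)%N -> vabs Q.[pts i] <= K' * b.
  move=> im; have d0 : pts i - y != 0.
    by rewrite subr_eq0; apply/eqP => /pinj h; rewrite h ltnn in im.
  have -> : Q.[pts i] = (pts i - y)^-1 * (P.[pts i] - P.[y]).
    have := congr1 (fun Z => Z.[pts i]) E; rewrite hornerM hornerD hornerN hornerC hornerXsubC => ->.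
    by rewrite mulrC mulfK.
  rewrite vabsM; apply: ler_pM; rewrite ?vabs_ge0 //.
    rewrite /K' (bigD1 (Ordinal im)) //= lerDl; apply: sumr_ge0 => ? _; exact: vabs_ge0.
  by apply: vabsB_le => //; apply: hb; apply: ltnW.
have K'b : 0 <= K' * b by rewrite mulr_ge0.
have {}hQ l : vabs Q`_l <= K * (K' * b) := IH Q sQ _ K'b hQ l.
have -> : P = Q * ('X - y%:P) + P.[y]%:P by rewrite -E subrK.
have b1 : 0 <= K * (K' * b) by rewrite mulr_ge0 // ltW.
have b2 : 0 <= vabs y * (K * (K' * b)) by rewrite mulr_ge0.
have -> : (K * K' + vabs y * (K * K') + 1) * b = K * (K' * b) + vabs y * (K * (K' * b)) + b by ring.
rewrite coefD coefC mulrBr coefB coefMX coefMC.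
apply: vabsD_le; last by case: eqP => _; rewrite ?vabs0; lra.
apply: vabsB_le.
  case: eqP => _; first by rewrite vabs0; lra.
  by have := hQ j.-1; lra.
rewrite vabsM mulrC; have : vabs y * vabs Q`_j <= vabs y * (K * (K' * b)) by rewrite ler_wpM2l.
lra.
Qed.

End PowerSeries.

(** * The expansion in t *)

Section Expansion.
Context {Fq : finFieldType} {R : realType} {C : valuedExt Fq R}.
Local Notation q := #|Fq|.
Local Notation pC := (pemb C).
Variable n : {poly Fq}.
Hypothesis n_size : (1 < size n)%N.
Hypothesis Ccomplete : vcomplete C.
Variable k : nat.
Hypothesis hk : (0 < k < q)%N.
Implicit Types (z : C) (g : 'M[{poly Fq}]_2).

Let L : R := vabs (pC n).
Let far0 z := far (q%:R * L) z.
Let theta : C := e_lat n 1 ^+ q.-1.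

Lemma level_gt1 : 1 < L. Proof. exact: vabs_n_gt1. Qed.

Lemma level_gt0 : 0 < L. Proof. exact: lt_trans ltr01 level_gt1. Qed.

Lemma radius_ge1 : 1 <= q%:R * L.
Proof. by rewrite mulr_ege1 // ltW // ?qR_gt1 // level_gt1. Qed.

Lemma radius_gt0 : 0 < q%:R * L.
Proof. exact: lt_le_trans ltr01 radius_ge1. Qed.

Lemma e_lat_neq0 z : far0 z -> e_lat n z != 0.
Proof.
move=> hz; rewrite -vabs_gt0.
exact: lt_le_trans radius_gt0 (far_e_lat n_size Ccomplete radius_gt0 hz).
Qed.

Lemma t_par_lt z : far0 z -> L * vabs (t_par n z) < 1.
Proof.
move=> hz; rewrite /t_par vabsV -ltr_pdivlMr ?invr_gt0 ?vabs_gt0 ?e_lat_neq0 // invrK mul1r.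
apply: lt_le_trans (far_e_lat n_size Ccomplete radius_gt0 hz).
by rewrite ltr_pMl ?level_gt0 // qR_gt1.
Qed.

Lemma theta_vabs : vabs theta = 1.
Proof. by rewrite vabsX vabs_e_lat1 // expr1n. Qed.

Lemma theta_neq0 : theta != 0.
Proof. by rewrite -vabs_gt0 theta_vabs. Qed.

Definition den_poly (y : C) : {poly C} :=
  1 - theta *: 'X^(q.-1) + (theta * eLam n y) *: 'X^q.

Lemma eLam_frac z y : far0 z -> far0 (z - y) -> 
  (eLam n (z - y))^-1 = - theta * t_par n z ^+ q / (den_poly y).[t_par n z].
Proof.
move=> hz hzy; have e0 := e_lat_neq0 hz.
have E0 : eLam n (z - y) != 0.
  by rewrite -vabs_gt0; apply: lt_le_trans radius_gt0 (far_eLam n_size Ccomplete radius_gt0 hzy).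
have -> : (den_poly y).[t_par n z] = eLam n (z - y) * (- theta * t_par n z ^+ q).
  rewrite /den_poly !(hornerD, hornerN, hornerZ, hornerXn, hornerC) eLamB //.
  rewrite {2}/eLam -/theta /t_par !exprVn.
  have -> : e_lat n z ^+ q = e_lat n z * e_lat n z ^+ q.-1.
    by rewrite -exprS prednK ?card_Fq_gt0.
  by field; rewrite e0 theta_neq0 expf_neq0.
have t0 : t_par n z ^+ q != 0 by rewrite expf_neq0 // invr_eq0.
by field; rewrite E0 t0 oppr_eq0 theta_neq0.
Qed.

Lemma gauss_den y : vabs y < L -> gauss_le L 1 (den_poly y).
Proof.
move=> hy; have L1 := ltW level_gt1; have L0 := ltW level_gt0.
apply: gauss_leD.
  apply: gauss_leB; first exact: gauss_le1.
  by apply: gauss_le_cXn; rewrite ?ler01 // mul1r theta_vabs exprn_ege1.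
apply: gauss_le_cXn; rewrite ?ler01 // mul1r vabsM theta_vabs mul1r /eLam -/theta.
have hL : L <= L ^+ q by rewrite -[X in X <= _]expr1 ler_weXn2l // card_Fq_gt0.
apply: vabsB_le; first by rewrite vabs_e_lat_small // (le_trans (ltW hy)).
rewrite vabsM vabsV theta_vabs invr1 mulr1 vabsX vabs_e_lat_small //.
by rewrite lerXn2r ?nnegrE ?vabs_ge0 // ltW.
Qed.

Lemma den_poly0 y : (den_poly y)`_0 = 1.
Proof.
rewrite /den_poly !(coefD, coefN, coefZ, coefXn) coef1 /=.
have q1 : (0 == q.-1)%N = false by have := @card_Fq_gt1 Fq; case: #|Fq| => [|[]].
have q0 : (0 == q)%N = false by have := @card_Fq_gt0 Fq; case: #|Fq|.
by rewrite q1 q0 !mulr0 subr0 addr0.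
Qed.

Lemma vanish_1sub (P : {poly C}) : P`_0 = 1 -> vanish_upto 1 (1 - P).
Proof. by move=> h [|//] _; rewrite coefB coef1 h subrr. Qed.

Lemma coef0_prod (I : Type) (r : seq I) (S : pred I) (F : I -> {poly C}) :
  (forall i, S i -> (F i)`_0 = 1) -> (\prod_(i <- r | S i) F i)`_0 = 1.
Proof.
move=> h; elim/big_ind: _ => //; first by rewrite coef1.
by move=> P Q; rewrite coef0M => -> ->; rewrite mulr1.
Qed.

Lemma coef0X1 (P : {poly C}) m : P`_0 = 1 -> (P ^+ m)`_0 = 1.
Proof. by move=> h; elim: m => [|m IH]; rewrite ?expr0 ?coef1 // exprS coef0M h IH mulr1. Qed.

Lemma vabs_horner_den (P : {poly C}) z : far0 z -> gauss_le L 1 P -> P`_0 = 1 ->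
  vabs P.[t_par n z] = 1.
Proof.
move=> hz hP P0; have ht := t_par_lt hz; have L0 := ltW level_gt0.
have g : gauss_le L 1 (1 - P) by apply: gauss_leB => //; apply: gauss_le1.
have := vabs_horner_le L0 g (vanish_1sub P0) (ltW ht); rewrite mul1r expr1 => h.
by rewrite -{1}[P](subKr 1) hornerD hornerN hornerC vabsB_dom vabs1 // (le_lt_trans h).
Qed.

Definition Den g : {poly C} := \prod_(o : option Fq) den_poly (cuspC g o) ^+ k.

Definition Num g : {poly C} := ((- theta) ^+ k *: 'X^(q * k)) *
  \sum_(o : option Fq) (cusp_res g o ^+ k)%:P *
     \prod_(o' : option Fq | o' != o) den_poly (cuspC g o') ^+ k.

Lemma gauss_Den g : g \in reps n -> gauss_le L 1 (Den g).
Proof.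
move=> gr; have L0 := ltW level_gt0; apply: gauss_le_prod => // o _; apply: gauss_leX => //.
by apply: gauss_den; apply: vabs_cuspC.
Qed.

Lemma Den0 g : (Den g)`_0 = 1.
Proof. by apply: coef0_prod => o _; apply: coef0X1; apply: den_poly0. Qed.

Lemma rep_term_frac g z : g \in reps n -> far0 z ->
  rep_term n k g z = (Num g).[t_par n z] / (Den g).[t_par n z].
Proof.
move=> gr hz; set t := t_par n z.
have d0 o : (den_poly (cuspC g o)).[t] != 0.
  rewrite -vabs_gt0 vabs_horner_den ?den_poly0 //.
  by apply: gauss_den; apply: vabs_cuspC.
have D0 : (Den g).[t] != 0 by rewrite -vabs_gt0 vabs_horner_den ?Den0 //; apply: gauss_Den.
apply: (mulIf D0); rewrite divfK // /rep_term mulr_suml /Num hornerM horner_sum mulr_sumr.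
apply: eq_bigr => o _.
rewrite (eLam_frac hz); last exact: farB.
rewrite /Den (bigD1 o) //= !(hornerM, hornerZ, hornerXn, hornerC, horner_exp) exprM.
set W := (\prod_(o' | _) _).[t]; move: (d0 o) => {}d0; rewrite -/t.
move: (cusp_res g o) (- theta) (t ^+ q) (den_poly _).[t] W d0 => r th x d w d0.
rewrite !exprMn exprVn; have : d ^+ k != 0 by rewrite expf_neq0.
by move: (d ^+ k) => dk dk0; field.
Qed.

Lemma vanish_Num g : g \in reps n -> vanish_upto (q * k.+1) (Num g).
Proof.
move=> gr; rewrite mulnS addnC /Num; apply: vanishM.
  by move=> i hi; rewrite coefZ coefXn ltn_eqF // mulr0.
pose u : {poly C} := 1 - theta *: 'X^(q.-1).
have prodC (I : Type) (r : seq I) (S : pred I) (F G : I -> {poly C}) :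
    (forall i, S i -> vanish_upto q (F i - G i)) ->
    vanish_upto q (\prod_(i <- r | S i) F i - \prod_(i <- r | S i) G i).
  move=> h; elim/big_rec2: _ => [|i P Q Si IH]; first by rewrite subrr => ? _; rewrite coef0.
  rewrite (_ : _ - _ = F i * (Q - P) + (F i - G i) * P); last by ring.
  apply: vanishD; first by rewrite -[q]add0n; apply: vanishM.
  by rewrite -[q]addn0; apply: vanishM => //; apply: h.
have expC (P Q : {poly C}) m : vanish_upto q (P - Q) -> vanish_upto q (P ^+ m - Q ^+ m).
  by move=> h; rewrite subrXX -[q]addn0; apply: vanishM.
pose W := u ^+ k ^+ q.
have WE (o : option Fq) : \prod_(o' | o' != o) u ^+ k = W.
  by rewrite prodr_const (_ : #|_| = q) // -[q]/(q.+1.-1) -card_option -(cardC1 o);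
    apply: eq_card => o'; rewrite !inE.
rewrite (_ : \sum_o _ = \sum_o (cusp_res g o ^+ k)%:P *
    (\prod_(o' | o' != o) den_poly (cuspC g o') ^+ k - W)); last first.
  apply/eqP; rewrite -subr_eq0 -sumrB; apply/eqP.
  transitivity (\sum_o (cusp_res g o ^+ k)%:P * W).
    by apply: eq_bigr => o _; ring.
  by rewrite -mulr_suml -rmorph_sum (sum_cusp_res0 n_size gr hk) rmorph0 mul0r.
apply: vanish_sum => o _; rewrite -[q]add0n; apply: vanishM => //.
rewrite -(WE o); apply: prodC => o' _; apply: expC.
rewrite /den_poly -/u addrAC subrr add0r => i hi.
by rewrite coefZ coefXn ltn_eqF // mulr0.
Qed.

Definition Num_size := (q * k + #|{: option Fq}| * (q * k)).+1.

Lemma size_den y : (size (den_poly y) <= q.+1)%N.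
Proof.
apply: leq_trans (size_polyD _ _) _; rewrite geq_max; apply/andP; split; last first.
  by apply: leq_trans (size_scale_leq _ _) _; rewrite size_polyXn.
apply: leq_trans (size_polyD _ _) _; rewrite geq_max size_poly1 size_polyN /=.
apply: leq_trans (size_scale_leq _ _) _; rewrite size_polyXn; lia.
Qed.

Lemma size_polyM_le (P Q : {poly C}) a b : (size P <= a.+1)%N -> (size Q <= b.+1)%N ->
  (size (P * Q)%R <= (a + b).+1)%N.
Proof.
move=> hP hQ; apply: leq_trans (size_polyMleq _ _) _.
by apply: (@leq_trans (a.+1 + b.+1).-1); [move: (leq_add hP hQ); clear; lia|rewrite addSn addnS].
Qed.

Lemma size_Num g : (size (Num g) <= Num_size)%N.
Proof.
apply: size_polyM_le; first by apply: leq_trans (size_scale_leq _ _) _; rewrite size_polyXn.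
elim/big_ind: _ => [|P Q hP hQ|o _].
- by rewrite size_poly0.
- by apply: leq_trans (size_polyD _ _) _; rewrite geq_max hP.
apply: leq_trans (_ : (0 + #|{: option Fq}| * (q * k)).+1 <= _)%N; last by [].
apply: size_polyM_le; first exact: size_polyC_leq1.
apply: (@leq_trans (\sum_(o' : option Fq | o' != o) (q * k)).+1); last first.
  by rewrite ltnS sum_nat_const leq_mul2r max_card orbT.
elim/big_ind2: _ => [|P a Q b hP hQ|o' _]; first by rewrite size_poly1.
  exact: size_polyM_le.
apply: leq_trans (size_poly_exp_leq _ _) _; rewrite ltnS leq_mul2r; apply/orP; right.
by have := size_den (cuspC g o'); lia.
Qed.

Local Notation rb := (@row_bound Fq R C).

Variable pts : nat -> C.
Hypothesis pts_far : forall i, far0 (pts i).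
Hypothesis pts_inj : injective (fun i => t_par n (pts i)).

(* The values of Num g at the fixed points pts are those of rep_term, up to a
   factor of absolute value 1; interpolation turns their bound into one on the
   coefficients. *)
Lemma gauss_Num : exists2 K, 0 < K &
  forall g, g \in reps n -> gauss_le L (K * rb g) (Num g).
Proof.
have [K K0 HK] := poly_bound_of_values Num_size pts_inj.
exists K => // g gr i.
have b0 : 0 <= rb g.
  by rewrite invr_ge0 (le_trans ler01) //; apply: reps_max_ge1 gr.
apply: (@le_trans _ _ (K * rb g)).
  apply: HK => [|j]; first exact: size_Num.
  have D1 := vabs_horner_den (pts_far j) (gauss_Den gr) (Den0 g).
  have := vabs_rep_term_le n_size Ccomplete hk gr radius_ge1 (pts_far j).
  by rewrite (rep_term_frac gr (pts_far j)) vabsM vabsV D1 invr1 mulr1.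
by rewrite ler_peMr ?exprn_ege1 ?mulr_ge0 // ltW // level_gt1.
Qed.

Definition den1 : {poly C} := (1 - theta *: 'X^(q.-1)) ^+ k.

Lemma eLam0 : eLam n (0 : C) = 0.
Proof. by have := eLamB n_size Ccomplete (0 : C) 0; rewrite subr0 subrr. Qed.

Lemma den1E : den1 = den_poly 0 ^+ k.
Proof. by rewrite /den1 /den_poly eLam0 mulr0 scale0r addr0. Qed.

Lemma row_bound_le1 g : g \in reps n -> 0 <= rb g <= 1.
Proof.
move=> gr; have h := @reps_max_ge1 _ R C _ _ gr.
have h0 := lt_le_trans ltr01 h.
by rewrite invr_ge0 ltW //= invf_le1.
Qed.

Lemma t_expansion_Gamma : exists (c : nat -> C) B, [/\ 0 <= B,
    forall j, (j < k * q.+1)%N -> c j = if j == (k * q)%N then theta ^+ k else 0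
  & forall z, far0 z -> exists2 F, hassum (Gamma n) (fun g => QM g z ^- k) F &
      forall N, vabs (F - \sum_(j < N) c j * t_par n z ^+ j) <= B * (L * vabs (t_par n z)) ^+ N].
Proof.
have L0 := ltW level_gt0.
have [K K0 HK] := gauss_Num.
pose P0 : {poly C} := (- theta) ^+ k *: 'X^(q * k).
pose D0 := 1 - den1.
have gP0 : gauss_le L 1 P0.
  apply: gauss_le_cXn => //; rewrite mul1r vabsX vabsN theta_vabs expr1n.
  by rewrite exprn_ege1 // ltW // level_gt1.
have gden1 : gauss_le L 1 den1.
  by rewrite den1E; apply: gauss_leX => //; apply: gauss_den; rewrite vabs0 level_gt0.
have den10 : den1`_0 = 1 by rewrite den1E; apply: coef0X1; apply: den_poly0.
have gD0 : gauss_le L 1 D0 by apply: gauss_leB => //; apply: gauss_le1.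
have vD0 := vanish_1sub den10.
pose cg g j := frac_coef (Num g) (1 - Den g) j.
have gDg g : g \in reps n -> gauss_le L 1 (1 - Den g).
  by move=> gr; apply: gauss_leB; [apply: gauss_le1|apply: gauss_Den].
have cgB g j : g \in reps n -> vabs (cg g j) <= K * rb g * L ^+ j.
  by move=> gr; apply: frac_coef_le => //; [apply: HK|apply: gDg].
have /choice[d hd] : forall j, exists l, hassum (reps n) (cg^~ j) l.
  move=> j.
  apply: hassum_exists (reps_exhausts n) _ => // e e0.
  have KL : 0 < K * L ^+ j by rewrite mulr_gt0 // exprn_gt0 // level_gt0.
  have [S HS] := @vanishing_row_bound _ R C _ n_size _ (divr_gt0 e0 KL).
  exists S => g gr gS; apply: le_lt_trans (cgB g j gr) _.
  by have := HS _ gr gS; rewrite ltr_pdivlMr //; congr (_ < _); ring.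
pose c j := (-1) ^+ k * frac_coef P0 D0 j + d j.
pose B := Num.max 1 K.
exists c, B; split.
- by rewrite le_max ler01.
- have /andP[k0 kq] := hk.
  move=> j hj; rewrite /c; have -> : d j = 0.
    apply: hassum_unique (hd j) _; apply: hassum_ext (hassum0 _) => g gr.
    have v1 : vanish_upto 1 (1 - Den g) by apply: vanish_1sub; apply: Den0.
    have jq : (j < q * k.+1)%N by rewrite mulnS; move: hj kq; rewrite mulnS mulnC; clear; lia.
    rewrite /cg (frac_coef_low (vanish_Num gr) v1); last by rewrite addn1 ltnW.
    by rewrite vanish_Num.
  have vP : vanish_upto (q * k) P0.
    by move=> i hi; rewrite coefZ coefXn ltn_eqF // mulr0.
  have vD : vanish_upto q.-1 D0.
    rewrite /D0 /den1 -[X in X - _](expr1n _ k) subrXX subKr.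
    rewrite -[X in vanish_upto X]addn0; apply: vanishM => // i hi.
    by rewrite coefZ coefXn (ltn_eqF hi) mulr0.
  rewrite (frac_coef_low vP vD); last by move: hj kq; rewrite mulnS mulnC; clear; lia.
  rewrite coefZ coefXn mulnC addr0; case: eqP => _; last by rewrite !mulr0.
  by rewrite mulr1 -exprMn mulN1r opprK.
move=> z hz; set t := t_par n z; have ht := t_par_lt hz.
have x0 : 0 <= L * vabs t by rewrite mulr_ge0 ?vabs_ge0.
have [F [hF hG]] := hassum_Gamma n_size Ccomplete hk radius_ge1 hz.
exists ((-1) ^+ k * eLam n z ^- k + F) => // N.
have xN : 0 <= (L * vabs t) ^+ N by rewrite exprn_ge0.
rewrite (_ : _ - _ = (-1) ^+ k * (eLam n z ^- k - \sum_(j < N) frac_coef P0 D0 j * t ^+ j)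
   + (F - \sum_(j < N) d j * t ^+ j)); last first.
  rewrite mulrBr mulr_sumr /c.
  under [X in _ - X = _]eq_bigr => j _ do rewrite mulrDl -mulrA.
  by rewrite big_split /=; ring.
apply: vabsD_le.
  rewrite vabsM vabsX vabsN vabs1 expr1n mul1r.
  have -> : eLam n z ^- k = P0.[t] / (1 - D0).[t].
    have hz0 : far0 (z - 0) by rewrite subr0.
    rewrite /D0 subKr den1E horner_exp hornerZ hornerXn -[z in LHS]subr0 -exprVn (eLam_frac hz hz0).
    by rewrite expr_div_n exprMn -exprM -/t.
  apply: (@le_trans _ _ (1 * (L * vabs t) ^+ N)); first exact: frac_expansion.
  by rewrite ler_wpM2r // le_max lexx.
have H : hassum (reps n) (fun g => rep_term n k g z - \sum_(j < N) cg g j * t ^+ j)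
    (F - \sum_(j < N) d j * t ^+ j).
  have hs : hassum (reps n) (fun g => \sum_(j < N) t ^+ j * cg g j) (\sum_(j < N) t ^+ j * d j).
    by apply: (@hassum_sum _ _ _ _ _ _ _ _ (fun (j : 'I_N) g => t ^+ j * cg g j)) => j _; apply: hassumZ.
  have := hassumD hF (hassumZ (-1) hs).
  rewrite mulN1r; under [X in F - X]eq_bigr do rewrite mulrC.
  by apply: hassum_ext => g _; rewrite mulN1r; congr (_ - _); apply: eq_bigr => j _; apply: mulrC.
apply: hassum_le H _ _ => [|g gr]; first by rewrite mulr_ge0 // (le_trans ler01) // le_max lexx.
have v1 : vanish_upto 1 (1 - Den g) by apply: vanish_1sub; apply: Den0.
rewrite (rep_term_frac gr hz) -/t.
have := frac_expansion L0 N (HK _ gr) (gDg _ gr) v1 ht; rewrite subKr => h.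
apply: le_trans h _; apply: ler_wpM2r => //.
have /andP[r0 r1] := row_bound_le1 gr.
rewrite le_max; apply/orP; right; rewrite -[X in _ <= X]mulr1; apply: ler_wpM2l => //.
exact: ltW.
Qed.

End Expansion.

(** * Points far from the rational ones *)

Lemma ratfunP (Fq : finFieldType) (x : ratfun Fq) :
  exists p d : {poly Fq}, d != 0 /\ x = polyF p / polyF d.
Proof.
elim/quotW: x => y; exists (frac y).1, (frac y).2.
have d0 := denom_ratioP y; split => //.
have d0' : polyF (frac y).2 != 0 by rewrite /polyF tofrac_eq0.
apply: (mulIf d0'); rewrite divfK //.
rewrite /polyF !piE; apply/eqmodP => /=.
rewrite FracField.equivfE /FracField.mulf !numden_Ratio ?mulr1 ?oner_neq0 //.
by rewrite mulrC.
Qed.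

Section Points.
Context {Fq : finFieldType} {R : realType} {C : valuedExt Fq R}.
Local Notation q := #|Fq|.
Local Notation pC := (pemb C).
Local Notation iota x := (pC x%:P).
Implicit Types (p d : {poly Fq}) (z : C).

Lemma vemb_frac p d : vemb C (polyF p / polyF d) = pC p / pC d.
Proof. by rewrite rmorphM fmorphV. Qed.

(* The digits of x come from the long division of p 'X^m by d 'X^(size p). *)
Lemma Finf_vemb (x : ratfun Fq) : Finf (vemb C x).
Proof.
have [p [d [d0 ->]]] := ratfunP x; rewrite vemb_frac.
pose N := size p; pose d' := d * 'X^N.
have d'0 : d' != 0 by rewrite mulf_neq0 // monic_neq0 // monicXn.
pose T : C := pC 'X; have T0 : T != 0 by rewrite pemb_eq0 polyX_eq0.
pose P m := ((p * 'X^m) %/ d')%R; pose rm m := ((p * 'X^m) %% d')%R.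
have PE m : p * 'X^m = P m * d' + rm m by apply: divp_eq.
have sr m : (size (rm m) < size d')%N by rewrite ltn_modp.
pose a m := (P m)`_0.
have P0 : P 0%N = 0.
  rewrite /P expr0 mulr1 divp_small // /d' size_Mmonic ?monicXn // size_polyXn addnS /=.
  by rewrite -[X in (X < _)%N]add0n ltn_add2r size_poly_gt0.
have size_aux m : (size ('X * rm m)%R <= size d')%N.
  have [->|r0] := eqVneq (rm m) 0; first by rewrite mulr0 size_poly0.
  by rewrite mulrC size_mulX.
have PS m : P m.+1 = 'X * P m + (a m.+1)%:P.
  have [c cE] : exists c : Fq, P m.+1 = 'X * P m + c%:P.
    have E : (P m.+1 - 'X * P m) * d' = 'X * rm m - rm m.+1.
      have := PE m.+1; rewrite exprS mulrCA PE => H.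
      transitivity ('X * (P m * d' + rm m) - 'X * P m * d' - rm m.+1); last by ring.
      by rewrite H; ring.
    have s1 : (size (P m.+1 - 'X * P m)%R <= 1)%N.
      have [->|n0] := eqVneq (P m.+1 - 'X * P m) 0; first by rewrite size_poly0.
      have : (size ((P m.+1 - 'X * P m) * d')%R <= size d')%N.
        rewrite E; apply: leq_trans (size_polyD _ _) _.
        by rewrite geq_max size_polyN size_aux ltnW.
      rewrite size_mul //; move: d'0; rewrite -size_poly_gt0; case: (size d') => // u _.
      by rewrite addnS /= -[X in (_ <= X)%N]add1n leq_add2r.
    exists (P m.+1 - 'X * P m)`_0.
    by rewrite -(size1_polyC s1) addrC subrK.
  rewrite {1}cE; congr (_ + _%:P); rewrite /a cE coefD coefC mulrC coefMX /=.
  by rewrite add0r.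
exists N, a; apply/vcvg_seqP.
have S m : \sum_(i < m.+1) iota (a i) * T ^- i = pC (P m) * T ^- m.
  elim: m => [|m IH]; first by rewrite big_ord1 /a P0 coef0 polyC0 rmorph0 !mul0r.
  rewrite big_ord_recr /= IH [P m.+1]PS rmorphD rmorphM /= -/T exprS invfM mulrDl.
  by congr (_ + _); rewrite mulrACA divff // mul1r.
have Tq : vabs T = q%:R by rewrite vabs_pemb ?polyX_eq0 // size_polyX expr1.
move=> e e0; have [M HM] := @qexp_gt Fq R (q%:R ^+ N * e^-1).
exists M.+1 => -[//|m]; rewrite ltnS => hm.
have dC : pC d != 0 by rewrite pemb_eq0.
rewrite -[vemb C (polyF 'X)]/T (_ : \sum_(i < m.+1) _ = \sum_(i < m.+1) iota (a i) * T ^- i) // S.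
have -> : T ^+ N * (pC (P m) * T ^- m) - pC p / pC d = - (pC (rm m) / pC d' * T ^+ N * T ^- m).
  have /(congr1 pC) := PE m; rewrite rmorphM rmorphD !rmorphM !rmorphXn /= -/T => H.
  apply: (@mulIf _ (pC d * T ^+ m)); first by rewrite mulf_neq0 // expf_neq0.
  transitivity (T ^+ N * pC (P m) * pC d - pC p * T ^+ m).
    by field; rewrite expf_neq0 ?dC.
  by rewrite H; field; rewrite !expf_neq0 // dC.
rewrite vabsN !vabsM !vabsV !vabsX Tq.
have rd : vabs (pC (rm m)) < vabs (pC d') by apply: vabs_pemb_lt.
have qN : 0 < q%:R ^+ N :> R by rewrite exprn_gt0 // qR_gt0.
have qm : 0 < q%:R ^+ m :> R by rewrite exprn_gt0 // qR_gt0.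
rewrite ltr_pdivrMr //; apply: (@le_lt_trans _ _ (q%:R ^+ N)).
  by rewrite ler_piMl ?(ltW qN) // ler_pdivrMr ?mul1r ?(ltW rd) // vabs_gt0 pemb_eq0.
by have := HM _ hm; rewrite ltr_pdivrMr // mulrC.
Qed.

Lemma imabs_le z (x : C) : Finf x -> imabs z <= vabs (z - x).
Proof.
move=> hx; apply: ge_inf; last by exists x.
by exists 0 => _ [y _ <-]; apply: vabs_ge0.
Qed.

Lemma far_imabs M z : M < imabs z -> far M z.
Proof. by move=> h x; apply: ltW; apply: lt_le_trans h (imabs_le _ (Finf_vemb x)). Qed.

Lemma sqrtT_exists : is_Cinf C -> exists s : C, s ^+ 2 = pC 'X.
Proof.
case=> _ H _.
have alg (x : ratfun Fq) : algFinf (vemb C x).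
  exists ('X - (vemb C x)%:P); split; first by rewrite polyXsubC_eq0.
    move=> i; rewrite coefB coefX coefC; case: i => [|[|i]] /=.
    - by rewrite sub0r -rmorphN; apply: Finf_vemb.
    - by rewrite subr0 -[X in Finf X]/(1 : C) -(rmorph1 (vemb C)); apply: Finf_vemb.
    - by rewrite subr0 -[X in Finf X]/(0 : C) -(rmorph0 (vemb C)); apply: Finf_vemb.
  by rewrite root_XsubC.
have [||s _] := H ('X^2 - (pC 'X)%:P).
- by rewrite size_XnsubC.
- move=> i; rewrite coefB coefXn coefC; case: i => [|[|[|i]]] /=.
  + by rewrite sub0r -rmorphN; apply: alg (polyF _).
  + by rewrite subr0 -[X in algFinf X]/(0 : C) -(rmorph0 (vemb C)); apply: alg.
  + by rewrite subr0 -[X in algFinf X]/(1 : C) -(rmorph1 (vemb C)); apply: alg.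
  + by rewrite subr0 -[X in algFinf X]/(0 : C) -(rmorph0 (vemb C)); apply: alg.
rewrite rootE !hornerE subr_eq0 => /eqP E; by exists s.
Qed.

Variable s : C.
Hypothesis s2 : s ^+ 2 = pC 'X.

Lemma vabs_s2 : vabs s ^+ 2 = q%:R.
Proof. by rewrite -vabsX s2 vabs_pemb ?polyX_eq0 // size_polyX expr1. Qed.

(* |p s| is an odd power of the square root of q, hence not the absolute value
   of an element of F. *)
Lemma far_s_vemb p (x : ratfun Fq) : p != 0 -> vabs (pC p * s) <= vabs (pC p * s - vemb C x).
Proof.
move=> p0; have : vabs (pC p * s) != vabs (vemb C x).
  have [a [d [d0 ->]]] := ratfunP x; rewrite vemb_frac.
  have s0 : 0 < vabs s.
    by rewrite lt0r vabs_ge0 andbT -sqrf_eq0 vabs_s2 pnatr_eq0 -lt0n card_Fq_gt0.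
  have [->|a0] := eqVneq a 0.
    by rewrite rmorph0 mul0r vabs0 vabs_eq0 mulf_neq0 ?pemb_eq0 // -vabs_gt0.
  apply/eqP => /(congr1 (fun y => y ^+ 2)).
  rewrite !vabsM vabsV !vabs_pemb // exprMn vabs_s2 expr_div_n -!exprM.
  have qn b : q%:R ^+ b != 0 :> R by rewrite expf_neq0 // pnatr_eq0 -lt0n card_Fq_gt0.
  move=> /(congr1 (fun y => y * q%:R ^+ ((size d).-1 * 2))); rewrite divfK // -exprSr -exprD -!natrX.
  move=> /eqP; rewrite eqr_nat eqn_exp2l ?card_Fq_gt1 // => /eqP /(congr1 odd).
  by rewrite oddD /= !muln2 !odd_double.
rewrite neq_lt => /orP[h|h]; last by rewrite vabsB_dom.
by rewrite vabsB_domr // ltW.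
Qed.

Lemma far_s p : p != 0 -> far (vabs (pC p * s)) (pC p * s).
Proof. by move=> p0 x; apply: far_s_vemb. Qed.

Lemma vabs_s_Finf p (x : C) : p != 0 -> Finf x -> vabs (pC p * s) <= vabs (pC p * s - x).
Proof.
move=> p0 [N [a /vcvg_seqP hx]].
apply: lims_vabs_ge (limsB (lims_cst _) hx) _ => m /=.
set y := (X in vabs (_ - X)); have [w ->] : exists w, y = vemb C w; last exact: far_s_vemb.
exists (polyF 'X ^+ N * \sum_(i < m) cstF (a i) * polyF 'X ^- i).
rewrite rmorphM rmorphXn rmorph_sum; congr (_ * _); apply: eq_bigr => i _.
by rewrite rmorphM fmorphV rmorphXn.
Qed.

Lemma imabs_s p : p != 0 -> vabs (pC p * s) <= imabs (pC p * s).
Proof.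
move=> p0; apply: lb_le_inf; last by move=> _ [x hx <-]; apply: vabs_s_Finf.
by exists (vabs (pC p * s - vemb C 0)); exists (vemb C 0) => //; apply: Finf_vemb.
Qed.

Lemma s_neq0 : s != 0.
Proof. by apply: contra_eq_neq s2 => ->; rewrite expr0n eq_sym pemb_eq0 polyX_eq0. Qed.

Lemma Omega_s p : p != 0 -> Omega (pC p * s).
Proof.
move=> p0 /(vabs_s_Finf p0); rewrite subrr vabs0 leNgt vabs_gt0.
by rewrite mulf_neq0 ?pemb_eq0 ?s_neq0.
Qed.

Lemma vabs_s_ge1 : 1 <= vabs s.
Proof.
rewrite -(@ler_pXn2r _ 2) ?nnegrE ?vabs_ge0 // expr1n vabs_s2; by rewrite ltW // qR_gt1.
Qed.

Lemma vabs_Xn_s (i : nat) : q%:R ^+ i <= vabs (pC 'X^i * s).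
Proof.
rewrite vabsM vabs_pemb ?monic_neq0 ?monicXn // size_polyXn /= ler_peMr ?vabs_s_ge1 //.
by rewrite exprn_ge0.
Qed.

End Points.

Section Uniqueness.
Context {Fq : finFieldType} {R : realType} {C : valuedExt Fq R}.
Local Notation q := #|Fq|.
Local Notation pC := (pemb C).
Variable n : {poly Fq}.
Hypothesis n_size : (1 < size n)%N.
Hypothesis hC : is_Cinf C.

Let Ccomplete : vcomplete C. Proof. by case: hC. Qed.

Lemma t_par_s (s : C) (i : nat) : s ^+ 2 = pC 'X ->
  t_par n (pC 'X^i * s) != 0 /\ vabs (t_par n (pC 'X^i * s)) <= q%:R ^- i.
Proof.
move=> s2; have X0 : 'X^i != 0 :> {poly Fq} by rewrite monic_neq0 ?monicXn.
have v0 : 0 < vabs (pC 'X^i * s) by rewrite vabs_gt0 mulf_neq0 ?pemb_eq0 ?(s_neq0 s2).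
have h := far_e_lat n_size Ccomplete v0 (far_s s2 X0).
have e0 : e_lat n (pC 'X^i * s) != 0 by rewrite -vabs_gt0 (lt_le_trans v0).
have qi : 0 < q%:R ^+ i :> R by rewrite exprn_gt0 // qR_gt0.
rewrite /t_par invr_eq0 e0 vabsV; split=> //.
by rewrite lef_pV2 ?posrE ?vabs_gt0 // (le_trans _ h) // vabs_Xn_s.
Qed.

Lemma t_expansion_unique (f : C -> C) (c c' : nat -> C) :
  t_expansion n f c -> t_expansion n f c' -> forall j, c j = c' j.
Proof.
move=> [M1 H1] [M2 H2]; pose e j := c j - c' j.
have [s s2] := sqrtT_exists hC.
pose z i := pC 'X^i * s; pose t i := t_par n (z i).
have X0 i : 'X^i != 0 :> {poly Fq} by rewrite monic_neq0 ?monicXn.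
have [I HI] := @qexp_gt Fq R (Num.max M1 M2).
have zM i : (I <= i)%N -> Num.max M1 M2 < imabs (z i).
  by move=> /HI h; apply: lt_le_trans h (le_trans (vabs_Xn_s s2 _) (imabs_s s2 (X0 i))).
have lim0 i : (I <= i)%N -> lims (fun N => \sum_(j < N) e j * t i ^+ j) 0.
  move=> /zM; rewrite gt_max => /andP[h1 h2].
  have /vcvg_seqP l1 := H1 _ (Omega_s s2 (X0 i)) h1.
  have /vcvg_seqP l2 := H2 _ (Omega_s s2 (X0 i)) h2.
  have := limsB l1 l2; rewrite subrr; apply: lims_ext => N.
  by rewrite /= -sumrB; apply: eq_bigr => j _; rewrite mulrBl.
have [K K0 HK] : exists2 K, 0 < K & forall j, vabs (e j) * vabs (t I) ^+ j <= K.
  have [K [K0 HK]] := lims_bounded (lim0 I (leqnn _)); exists K => // j.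
  rewrite -vabsX -vabsM.
  have -> : e j * t I ^+ j = \sum_(i < j.+1) e i * t I ^+ i - \sum_(i < j) e i * t I ^+ i.
    by rewrite big_ord_recr /= addrAC subrr add0r.
  exact: vabsB_le.
suff e0 j : e j = 0 by move=> j; apply/eqP; rewrite -subr_eq0; apply/eqP/e0.
elim/ltn_ind: j => m IH; apply/eqP/negPn/negP => em.
have tI : 0 < vabs (t I) by rewrite vabs_gt0; have [] := t_par_s I s2.
have [J HJ] := @qexp_gt Fq R (K / vabs (t I) ^+ m.+1 / vabs (e m)).
have [J' HJ'] := @qexp_gt Fq R (vabs (t I))^-1.
pose i := maxn I (maxn J J').
have iI : (I <= i)%N by rewrite leq_maxl.
have iJ : (J <= i)%N by rewrite /i maxnCA leq_maxl.
have iJ' : (J' <= i)%N by rewrite /i maxnA leq_maxr.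
have [ti0 tiq] := t_par_s i s2; rewrite -/(z i) -/(t i) in ti0 tiq.
have qi : 0 < q%:R ^+ i :> R by rewrite exprn_gt0 // qR_gt0.
have em0 : 0 < vabs (e m) by rewrite vabs_gt0.
have tiI : vabs (t i) <= vabs (t I).
  apply: le_trans tiq _; rewrite -[X in _ <= X]invrK lef_pV2 ?posrE ?invr_gt0 // ltW //.
  exact: HJ'.
have tip : 0 < vabs (t i) by rewrite vabs_gt0.
have big_em : K * (vabs (t i) / vabs (t I)) ^+ m.+1 < vabs (e m * t i ^+ m).
  rewrite vabsM vabsX expr_div_n [vabs (t i) ^+ m.+1]exprSr.
  have := HJ _ iJ; rewrite ltr_pdivrMr // => h.
  have tm : 0 < vabs (t i) ^+ m by rewrite exprn_gt0.
  rewrite (_ : _ * _ = (K / vabs (t I) ^+ m.+1) * vabs (t i) * vabs (t i) ^+ m); last by ring.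
  rewrite ltr_pM2r // -ltr_pdivlMr //; apply: lt_le_trans h _.
  rewrite mulrC ler_pM2l // -[X in X <= _]invrK lef_pV2 // ?posrE ?invr_gt0 //.
have [N HN] := lim0 i iI _ (le_lt_trans (mulr_ge0 (ltW K0) (exprn_ge0 m.+1
  (divr_ge0 (ltW tip) (ltW tI)))) big_em).
have := HN (maxn N m.+1) (leq_maxl _ _); rewrite subr0.
suff -> : vabs (\sum_(j < maxn N m.+1) e j * t i ^+ j) = vabs (e m * t i ^+ m) by rewrite ltxx.
have mN : (m < maxn N m.+1)%N by rewrite leq_maxr.
rewrite (bigD1 (Ordinal mN)) //= vabsD_dom //; apply: le_lt_trans _ big_em.
have x1 : vabs (t i) / vabs (t I) <= 1 by rewrite ler_pdivrMr // mul1r.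
have x0 : 0 <= vabs (t i) / vabs (t I) by rewrite divr_ge0 // ltW.
apply: vabs_sum_le => [|j _ jm]; first by rewrite mulr_ge0 ?exprn_ge0 // ltW.
have [jlt|jge] := ltnP j m.
  by rewrite IH // mul0r vabs0 mulr_ge0 ?exprn_ge0 // ltW.
have jm' : (m < j)%N.
  by rewrite ltn_neqAle jge andbT; apply: contra jm => /eqP E; apply/eqP/val_inj.
apply: (@le_trans _ _ (K * (vabs (t i) / vabs (t I)) ^+ j)); last first.
  by rewrite ler_wpM2l ?(ltW K0) // ler_wiXn2l.
rewrite vabsM vabsX expr_div_n mulrA mulrAC.
by rewrite ler_wpM2r ?exprn_ge0 ?(ltW tip) // ler_pdivlMr ?exprn_gt0.
Qed.

End Uniqueness.

Section Slash.
Context {Fq : finFieldType} {R : realType} {C : valuedExt Fq R}.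
Local Notation q := #|Fq|.
Local Notation pC := (pemb C).
Local Notation iota x := (pC x%:P).
Variable n : {poly Fq}.
Hypothesis n_size : (1 < size n)%N.
Variables (k r : nat) (a b : 'I_r -> option Fq).
Hypothesis hab : pair_decomposition a b.

Definition kappa : Fq := oo_sign b * C0 a b.

Lemma fseries_hassum (z F : C) : (forall x, z != vemb C x) ->
  hassum (Gamma n) (fun g => QM g z ^- k) F -> fseries n k a b z = iota kappa ^+ k * F.
Proof.
move=> hz hF; apply: vsum_hassum; apply: hassum_ext (hassumZ (iota kappa ^+ k) hF) => g gG.
have dt : \det g = 1 by rewrite det_mx2; case/(GammaP n_size): gG.
by rewrite prodrXl prod_u_fun // => [|o]; [rewrite expr_div_n|apply: cusp_lin_neq0].
Qed.

Lemma slash_fseries (nu : 'M[Fq]_2) (z F : C) : nu \in unitmx -> (forall x, z != vemb C x) ->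
  hassum (Gamma n) (fun g => QM g z ^- k) F ->
  slash (k * q.+1) nu (fseries n k a b) z = iota (\det nu) ^- k * (iota kappa ^+ k * F).
Proof.
move=> nuU hz hF; rewrite /slash !mxE.
rewrite -!/(iota _).
have detn : \det nu != 0 by rewrite -unitfE -unitmxE.
have row0 : ((nu 1 0)%:P != 0) || ((nu 1 1)%:P != 0 :> {poly Fq}).
  rewrite -negb_and !polyC_eq0; apply/negP => /andP[/eqP h /eqP h'].
  by move: detn; rewrite det_mx2 h h' !mulr0 subrr eqxx.
set J := _ * z + _; set z' := _ / J.
have J0 : J != 0.
  have := @lin_neq0 Fq R C (nu 1 0)%:P (- (nu 1 1))%:P z hz.
  by rewrite polyCN oppr_eq0 rmorphN opprK; apply.
have hz' x : z' != vemb C x.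
  have [p [d [d0 ->]]] := ratfunP x; rewrite vemb_frac.
  apply/eqP => E.
  have : pC (d * (nu 0 0)%:P - p * (nu 1 0)%:P) * z - pC (p * (nu 1 1)%:P - d * (nu 0 1)%:P) = 0.
    have dC : pC d != 0 by rewrite pemb_eq0.
    have E2 : (iota (nu 0 0) * z + iota (nu 0 1)) * pC d = pC p * J.
      by move: E; rewrite /z' => /eqP; rewrite eqr_div // => /eqP.
    rewrite !rmorphB !rmorphM /=.
    transitivity ((iota (nu 0 0) * z + iota (nu 0 1)) * pC d - pC p * J); last by rewrite E2 subrr.
    by rewrite /J; ring.
  apply/eqP; apply: lin_neq0 => //; rewrite -negb_and; apply/negP => /andP[/eqP h /eqP h'].
  have : d * (\det nu)%:P = 0.
    rewrite det_mx2 polyCB !polyCM.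
    transitivity ((d * (nu 0 0)%:P - p * (nu 1 0)%:P) * (nu 1 1)%:P
      + (p * (nu 1 1)%:P - d * (nu 0 1)%:P) * (nu 1 0)%:P); first by ring.
    by rewrite h h' !mul0r addr0.
  by apply/eqP; rewrite mulf_neq0 // polyC_eq0.
have D0 : iota (\det nu) != 0 by rewrite pemb_eq0 polyC_eq0.
have hF' : hassum (Gamma n) (fun g => QM g z' ^- k) ((J ^+ q.+1) ^+ k * (iota (\det nu) ^- k * F)).
  have := hassum_bij (conj_mxK nuU) (conj_mx_invK nuU) (conj_mx_Gamma nuU n) hF.
  move=> /(hassumZ (iota (\det nu) ^- k))/(hassumZ ((J ^+ q.+1) ^+ k)).
  apply: hassum_ext => g gG /=.
  have dt : \det g = 1 by rewrite det_mx2; case/(GammaP n_size): gG.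
  have Q0 := QM_neq0 dt hz'.
  have := QM_conj nuU g J0; rewrite -/J -/z' => E.
  rewrite -invfM -exprMn -E exprMn invfM mulrA divff ?mul1r //.
  by rewrite !expf_neq0.
rewrite (fseries_hassum hz' hF') mulnC exprM; field.
by rewrite !expf_neq0.
Qed.

End Slash.

Section Assembly.
Context {Fq : finFieldType} {R : realType} {C : valuedExt Fq R}.
Local Notation q := #|Fq|.
Local Notation pC := (pemb C).
Local Notation iota x := (pC x%:P).
Variable n : {poly Fq}.
Hypothesis n_size : (1 < size n)%N.
Hypothesis hC : is_Cinf C.

Lemma distinct_points (M : R) : exists2 pts : nat -> C,
  forall i, far M (pts i) & injective (fun i => t_par n (pts i)).
Proof.
have Ccomplete : vcomplete C by case: hC.
have [s s2] := sqrtT_exists hC; have [I HI] := @qexp_gt Fq R M.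
have X0 i : 'X^i != 0 :> {poly Fq} by rewrite monic_neq0 ?monicXn.
exists (fun i => pC 'X^(i + I) * s) => [i|i j /invr_inj E].
  apply: far_imabs; apply: lt_le_trans (HI (i + I)%N (leq_addl _ _)) _.
  exact: le_trans (vabs_Xn_s s2 _) (imabs_s s2 (X0 _)).
apply/eqP; apply: contraT => ij.
have p0 : 'X^(i + I) - 'X^(j + I) != 0 :> {poly Fq}.
  rewrite subr_eq0; apply: contra ij => /eqP/(congr1 (fun p : {poly Fq} => size p)).
  by rewrite !size_polyXn => -[/eqP]; rewrite eqn_add2r.
have v0 : 0 < vabs (pC ('X^(i + I) - 'X^(j + I)) * s).
  by rewrite vabs_gt0 mulf_neq0 ?pemb_eq0 ?(s_neq0 s2).
have := far_e_lat n_size Ccomplete v0 (far_s s2 p0).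
by rewrite rmorphB mulrBl e_latB // E subrr vabs0 leNgt -mulrBl -rmorphB v0.
Qed.

Lemma t_expansion_of_bound (f : C -> C) (c : nat -> C) (B M x : R) :
  (forall z, Omega z -> M < imabs z -> forall N,
     vabs (f z - \sum_(j < N) c j * t_par n z ^+ j) <= B * (x * vabs (t_par n z)) ^+ N) ->
  (forall z : C, M < imabs z -> 0 <= x * vabs (t_par n z) <= (q%:R)^-1) -> 0 <= B ->
  t_expansion n f c.
Proof.
move=> H Hx B0; exists M => z hz hM; apply/vcvg_seqP => e e0.
have /andP[x0 xq] := Hx z hM.
have [N HN] := @qexp_gt Fq R (B / e); exists N => m hm.
rewrite vabsBC; apply: le_lt_trans (H z hz hM m) _.
apply: (@le_lt_trans _ _ (B * (q%:R)^-1 ^+ m)).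
  by rewrite ler_wpM2l // lerXn2r ?nnegrE // (le_trans x0).
have qm : 0 < q%:R ^+ m :> R by rewrite exprn_gt0 // qR_gt0.
by rewrite exprVn ltr_pdivrMr // mulrC -ltr_pdivrMr //; apply: HN.
Qed.

End Assembly.

Theorem theorem6p3p1 (q : nat) (Fq : finFieldType) (hq : #|Fq| = q)
    (q_odd : odd q) (R : realType) (C : valuedExt Fq R) (hC : is_Cinf C)
    (n : {poly Fq}) (n_monic : n \is monic) (n_deg : (1 <= (size n).-1)%N)
    (k : nat) (hk : (1 <= k <= q - 1)%N)
    (a b : 'I_(q.+1 %/ 2) -> 'P1 Fq) (hab : pair_decomposition a b) :
  let f : C -> C := fseries n k a b in
  let t : C -> C := t_par n in
  let eps : C := e_lat n 1 in
  let lead : C :=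
    vemb C (cstF (oo_sign b)) ^+ k * vemb C (cstF (C0 a b)) ^+ k
      * eps ^+ (k * (q - 1)) in
  [/\ forall c : nat -> C, t_expansion n f c ->
        c 0%N = 0 /\
        forall m, (1 <= m <= k * q.+1 - 1)%N ->
          c m = if m == (k * q)%N then lead else 0,
      exists B M : R, forall z : C, Omega z -> M < imabs z ->
        vabs (f z - lead * t z ^+ (k * q)) <= B * vabs (t z) ^+ (k * q.+1)
    & forall s, is_cusp n s -> (exists alpha : 'P1 Fq, s (pt_cst alpha)) ->
        order_at_cusp n (k * q.+1) f s (k * q)].
Proof.
move=> f t eps lead.
have n_size : (1 < size n)%N by case: (size n) n_deg => [|[]].
have Ccomplete : vcomplete C by case: hC.
have hkq : (0 < k < #|Fq|)%N by rewrite hq; move: hk (card_Fq_gt0 (Fq := Fq)); rewrite hq; lia.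
have /andP[k0 kq] := hkq.
pose L := vabs (pemb C n); pose M := #|Fq|%:R * L.
have [pts ptsF ptsI] := distinct_points n_size hC M.
have [c0 [B [B0 clow cexp]]] := t_expansion_Gamma n_size Ccomplete hkq ptsF ptsI.
pose kap : C := pemb C (kappa a b)%:P ^+ k.
have kap1 : vabs kap = 1.
  by rewrite vabsX vabs_iota ?expr1n // C0_neq0.
have leadE : lead = kap * (e_lat n 1 ^+ (#|Fq|).-1) ^+ k.
  rewrite /lead /kap /kappa polyCM rmorphM [in RHS]exprMn -exprM hq subn1 [(_.-1 * k)%N]mulnC.
  by [].
have lead0 : lead != 0.
  rewrite leadE mulf_neq0 // -vabs_gt0 ?kap1 //.
  by rewrite !vabsX vabs_e_lat1 // !expr1n.
pose c j := kap * c0 j.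
have fE z : (forall x, z != vemb C x) -> forall F, hassum (Gamma n) (fun g => QM g z ^- k) F ->
    f z = kap * F.
  by move=> hz F hF; apply: fseries_hassum.
have M1 : 1 <= M by apply: radius_ge1.
have farM z : M < imabs z -> far M z by apply: far_imabs.
have clowE j : (j < k * q.+1)%N -> c j = if j == (k * q)%N then lead else 0.
  move=> hj; rewrite /c clow ?hq //; case: eqP => _; last by rewrite mulr0.
  by rewrite leadE hq.
have tL z : M < imabs z -> 0 <= L * vabs (t z) <= (#|Fq|%:R)^-1.
  move=> /farM hz; rewrite mulr_ge0 ?vabs_ge0 //=.
  have M0 : 0 < M by apply: lt_le_trans M1.
  have he := far_e_lat n_size Ccomplete M0 hz.
  have e0 : 0 < vabs (e_lat n z) by apply: lt_le_trans he.
  rewrite /t /t_par vabsV ler_pdivrMr // -ler_pdivrMl ?invr_gt0 ?qR_gt0 // invrK.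
  exact: he.
have fexp z : Omega z -> M < imabs z -> forall N,
    vabs (f z - \sum_(j < N) c j * t z ^+ j) <= B * (L * vabs (t z)) ^+ N.
  move=> _ /farM hz N; have [F hF HF] := cexp z hz.
  rewrite (fE z (far_notin M1 hz) F hF) /c; under eq_bigr do rewrite -mulrA.
  by rewrite -mulr_sumr -mulrBr vabsM kap1 mul1r; apply: HF.
have ft : t_expansion n f c by apply: t_expansion_of_bound fexp tL B0.
split.
- move=> c' hc'; have cc := t_expansion_unique n_size hC hc' ft.
  split; first by rewrite cc clowE ?muln_gt0 ?k0 // eq_sym muln_eq0 -!leqn0 leqNgt k0 -hq leqNgt card_Fq_gt0.
  move=> m /andP[m1 m2]; rewrite cc clowE //.
  by move: m2; rewrite -ltnS; clear -k0; case: k k0 => // k _; rewrite mulSn; lia.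
- exists (B * L ^+ (k * q.+1)), M => z hz hM.
  have := fexp z hz hM (k * q.+1)%N; rewrite exprMn mulrA.
  have kqlt : (k * q < k * q.+1)%N by rewrite ltn_pmul2l.
  rewrite (bigD1 (Ordinal kqlt)) //= clowE // eqxx big1 ?addr0 // => j jk.
  rewrite clowE //; case: eqP => [E|_]; last by rewrite mul0r.
  by case/eqP: jk; apply/val_inj.
- move=> s _ _ alpha nu _ nuU _.
  have detn : \det nu != 0 by rewrite -unitfE -unitmxE.
  pose D : C := pemb C (\det nu)%:P ^- k.
  have D1 : vabs D = 1 by rewrite vabsV vabsX vabs_iota // expr1n invr1.
  exists (fun j => D * c j); split.
  + apply: (t_expansion_of_bound (B := B) (M := M) (x := L)) tL B0.
    move=> z _ /farM hz N; have [F hF HF] := cexp z hz.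
    rewrite -hq (slash_fseries n_size hab nuU (far_notin M1 hz) hF) -/kap -/D /c.
    rewrite (_ : _ - _ = D * kap * (F - \sum_(j < N) c0 j * t_par n z ^+ j)).
      by rewrite !vabsM D1 kap1 !mul1r; apply: HF.
    rewrite mulrBr mulr_sumr; congr (_ - _); first by ring.
    by apply: eq_bigr => j _; ring.
  + rewrite clowE ?ltn_pmul2l // eqxx mulf_neq0 // -vabs_gt0 D1 //.
  + move=> j hj; rewrite clowE ?ltn_eqF ?mulr0 //.
    by apply: leq_trans hj _; rewrite leq_pmul2l.
Qed.
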